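(* Let $(W_t)_{0\le t\le T}$ be an $n$-dimensional Brownian motion, let $A_1,\dots,A_n\in\mathbb R_+$, and let $\xi=\varphi(W)$ for a function $\varphi:C^n_0[0,T]\to\mathbb R$ satisfying $$|\varphi(v)-\varphi(w)|\le\sum_{i=1}^nA_i\sup_{0\le t\le T}|v^i(t)-w^i(t)|\quad\text{for all }v,w\in C^n_0[0,T].$$ Then $\xi\in\mathbb D^{1,2}$ and $|D^i_t\xi|\le A_i$ $dt\otimes d\mathbb P$-a.e. for all $i=1,\dots,n$.
   Context: $C^n_0[0,T]$ is the space of continuous functions from $[0,T]$ to $\mathbb R^n$ starting at $0$. $D_t\xi=(D^1_t\xi,\dots,D^n_t\xi)$, $0\le t\le T$, is the Malliavin derivative of $\xi$ with respect to $W$; $\mathbb D^{1,2}$ is the closure of the smooth random variables under $\|\xi\|_{1,2}=(\mathbb E[\xi^2+\int_0^T|D_t\xi|^2dt])^{1/2}$. *)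

(* Defs.v *)
From HB Require Import structures.
From mathcomp Require Import all_boot all_order all_algebra.
From mathcomp Require Import all_classical all_reals all_analysis.

Set Implicit Arguments.
Unset Strict Implicit.
Unset Printing Implicit Defensive.

Import Order.TTheory GRing.Theory Num.Theory.
Import numFieldNormedType.Exports.

Local Open Scope classical_set_scope.
Local Open Scope ring_scope.

(* Paths are total functions on R; only their restriction to [0, T] is meant. *)
Definition C0path (R : realType) (n : nat) (T : R) : set (R -> 'rV[R]_n) :=
  [set v : R -> 'rV[R]_n | {within `[0, T], continuous v} /\ v 0 = 0].

Definition supdist (R : realType) (n : nat) (T : R) (i : 'I_n)
    (v w : R -> 'rV[R]_n) : R :=
  sup [set `|v t 0 i - w t 0 i| | t in `[0, T]].

Definition mutually_independent (d : measure_display) (Omega : measurableType d)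
    (R : realType) (P : probability Omega R) (I : finType)
    (X : I -> Omega -> R) : Prop :=
  forall (J : {set I}) (B : I -> set R), (forall i, measurable (B i)) ->
    P (\bigcap_(i in [set` J]) (X i @^-1` B i)) =
    (\prod_(i in J) P (X i @^-1` B i))%E.

Record brownian_motion (d : measure_display) (Omega : measurableType d)
    (R : realType) (P : probability Omega R) (T : R) (n : nat)
    (W : R -> Omega -> 'rV[R]_n) : Prop := BrownianMotion {
  bm_path : forall w, C0path T (W ^~ w) ;
  bm_measurable : forall t i, t \in `[0, T] ->
    measurable_fun [set: Omega] (fun w => W t w 0 i) ;
  (* the second parameter of normal_prob is the standard deviation *)
  bm_gaussian : forall (s t : R) (i : 'I_n) (B : set R),
    0 <= s -> s < t -> t <= T -> measurable B ->
    P [set w | B (W t w 0 i - W s w 0 i)] = normal_prob 0 (Num.sqrt (t - s)) B ;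
  (* joint independence over time steps and over coordinates *)
  bm_independent : forall (m : nat) (t : nat -> R),
    (forall k, t k \in `[0, T]) -> nondecreasing_seq t ->
    mutually_independent P (fun (p : 'I_m * 'I_n) w =>
      W (t p.1.+1) w 0 p.2 - W (t p.1) w 0 p.2)
}.

Definition sqnorm (R : realType) (n : nat) (v : 'rV[R]_n) : R :=
  \sum_(i < n) v 0 i ^+ 2.

(* A triple (a, b, c) stands for the step function equal to c on ]a, b]. *)
Definition step_in (R : realType) (n : nat) (T : R)
    (s : seq (R * R * 'rV[R]_n)) : Prop :=
  forall x, x \in s -> [&& 0 <= x.1.1, x.1.1 <= x.1.2 & x.1.2 <= T].

Definition step_fun (R : realType) (n : nat) (s : seq (R * R * 'rV[R]_n))
    (t : R) : 'rV[R]_n :=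
  \sum_(x <- s) (if t \in `]x.1.1, x.1.2] then x.2 else 0).

Definition step_integral (Omega : Type) (R : realType) (n : nat)
    (W : R -> Omega -> 'rV[R]_n) (s : seq (R * R * 'rV[R]_n)) (w : Omega) : R :=
  \sum_(x <- s) \sum_(i < n) x.2 0 i * (W x.1.2 w 0 i - W x.1.1 w 0 i).

Definition L2_fun (R : realType) (n : nat) (T : R) (h : R -> 'rV[R]_n) : Prop :=
  (forall i, measurable_fun `[0, T] (fun t => h t 0 i)) /\
  (\int[lebesgue_measure]_(t in `[0%R, T]) (sqnorm (h t))%:E < +oo)%E.

(* X is a version of the Wiener integral W(h) = \int_0^T h(t) . dW_t *)
Definition wiener_integral (d : measure_display) (Omega : measurableType d)
    (R : realType) (P : probability Omega R) (T : R) (n : nat)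
    (W : R -> Omega -> 'rV[R]_n) (h : R -> 'rV[R]_n) (X : Omega -> R) : Prop :=
  measurable_fun [set: Omega] X /\
  exists s : nat -> seq (R * R * 'rV[R]_n),
    [/\ forall k, step_in T (s k),
        (\int[lebesgue_measure]_(t in `[0%R, T])
           (sqnorm (step_fun (s k) t - h t))%:E)%E @[k --> \oo] --> 0%E &
        (\int[P]_w ((step_integral W (s k) w - X w) ^+ 2)%:E)%E
           @[k --> \oo] --> 0%E].

Definition partial (R : realType) (m : nat) (j : 'I_m) (f : 'rV[R]_m -> R) :
    'rV[R]_m -> R :=
  fun x => 'D_(delta_mx 0 j) f x.

(* The class C_p^infty: smooth, with all partial derivatives of polynomial
   growth. *)
Definition smooth_polygrowth (R : realType) (m : nat) (f : 'rV[R]_m -> R) :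
    Prop :=
  forall s : seq 'I_m, let g := foldr (@partial R m) f s in
    [/\ continuous g,
        forall x j, derivable g x (delta_mx 0 j) &
        exists (C : R) (k : nat), forall x, `|g x| <= C * (1 + `|x|) ^+ k].

(* F = f(W(h_1), ..., W(h_m)) and D_t F = \sum_j (\partial_j f)(...) h_j(t) *)
Definition smooth_rv (d : measure_display) (Omega : measurableType d)
    (R : realType) (P : probability Omega R) (T : R) (n : nat)
    (W : R -> Omega -> 'rV[R]_n) (F : Omega -> R) (DF : R -> Omega -> 'rV[R]_n) :
    Prop :=
  exists (m : nat) (f : 'rV[R]_m -> R) (h : 'I_m -> R -> 'rV[R]_n)
      (X : 'I_m -> Omega -> R),
    [/\ smooth_polygrowth f,
        forall j, L2_fun T (h j),
        forall j, wiener_integral P T W (h j) (X j),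
        forall w, F w = f (\row_j X j w) &
        forall t w, DF t w =
          \sum_(j < m) partial j f (\row_k X k w) *: h j t].

(* ||xi||_{1,2}, with D in the role of the derivative of xi *)
Definition norm12 (d : measure_display) (Omega : measurableType d)
    (R : realType) (P : probability Omega R) (T : R) (n : nat)
    (xi : Omega -> R) (D : R -> Omega -> 'rV[R]_n) : \bar R :=
  ((\int[P]_w ((xi w ^+ 2)%:E +
      \int[lebesgue_measure]_(t in `[0%R, T]) (sqnorm (D t w))%:E)) `^ 2^-1)%E.

(* The graph of the closure of the derivative operator on smooth random
   variables: D is a version of the Malliavin derivative of xi. *)
Definition malliavin_derivative (d : measure_display) (Omega : measurableType d)
    (R : realType) (P : probability Omega R) (T : R) (n : nat)
    (W : R -> Omega -> 'rV[R]_n) (xi : Omega -> R) (D : R -> Omega -> 'rV[R]_n) :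
    Prop :=
  [/\ measurable_fun [set: Omega] xi,
      forall i, measurable_fun (`[0, T]%classic `*` [set: Omega])
        (fun p : measurableTypeR R * Omega => D p.1 p.2 0 i) &
      exists (F : nat -> Omega -> R) (DF : nat -> R -> Omega -> 'rV[R]_n),
        (forall k, smooth_rv P T W (F k) (DF k)) /\
        norm12 P T (fun w => F k w - xi w) (fun t w => DF k t w - D t w)
          @[k --> \oo] --> 0%E].

Definition D12 (d : measure_display) (Omega : measurableType d)
    (R : realType) (P : probability Omega R) (T : R) (n : nat)
    (W : R -> Omega -> 'rV[R]_n) (xi : Omega -> R) : Prop :=
  exists D, malliavin_derivative P T W xi D.

(* Main.v *)
(* Three ingredients prove the theorem.

   Uniqueness. Gaussian integration by parts gives Stein's identity
   E[X_a f(X)] = sum_b <h_a, h_b> E[d_b f(X)] for step integrals X, then for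
   Wiener integrals by passage to the limit. Hence every smooth K has a
   divergence delta(K) with E<DF, DK> = E[F delta(K)] for all smooth F. This
   determines <D, DK> for any derivative D of xi, and so D itself.

   Approximation. Let xi_J be phi evaluated at the linear interpolation of W on
   the dyadic grid of level J. Fourth moments of the increments bound
   E(xi_{J+1} - xi_J)^2 geometrically, so xi_J -> xi in L^2. Each xi_J is a
   Lipschitz function of the increments, with constant A_i in the increments of
   W^i. After squashing the variables into a cube by a logistic function,
   Bernstein polynomials approximate it by smooth functions without increasing
   the Lipschitz constants, so the derivatives of the resulting smooth variables
   are bounded by A_i.

   Existence. Smooth F with |D^i F| <= A_i and E(F - xi)^2 <= e form a nonempty
   convex set. As e decreases to 0, elements of nearly minimal derivative norm
   have Cauchy derivatives, whose limit is a derivative of xi bounded by A_i. *)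

(* Closability of the derivative operator is not built into the definitions: [malliavin_derivative]
   is a relation, and the bound is claimed for every [D] that it relates to [xi]. Exhibiting one
   bounded derivative is not enough, hence the duality argument. Nor is the law of a Wiener integral
   given, since it is defined as an L^2 limit: the moments that functions of polynomial growth
   require are themselves extracted from Stein's identity for bounded functions.

   The grid approximations keep the constants [A i] because, at a given time and coordinate, at most
   one increment contributes to the derivative. Fourth moments enter because the supremum over time
   is bounded by a sum over all cells: second moments of the increments would add up to a constant,
   fourth moments add up to a multiple of the mesh. Bernstein polynomials are preferred to
   convolution because, composed with logistic functions, they lie in an algebra stable under
   differentiation, so no derivative is taken under an integral. Minimising a norm over convex sets
   stands in for weak compactness. *)
Require Import Defs.
From HB Require Import structures.
From mathcomp Require Import all_boot all_order all_algebra.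
From mathcomp Require Import all_classical all_reals all_analysis measurable_realfun.
From mathcomp Require Import ring lra.

Set Implicit Arguments.
Unset Strict Implicit.
Unset Printing Implicit Defensive.

Import Order.TTheory GRing.Theory Num.Theory.
Import numFieldNormedType.Exports.

Local Open Scope classical_set_scope.
Local Open Scope ring_scope.

(** * Square-integrable functions *)

Section square_integrable.
Context {d} {T : measurableType d} {R : realType}.
Variables (mu : {measure set T -> \bar R}) (D : set T).
Hypothesis mD : measurable D.
Implicit Types f g : T -> R.

Definition intg f := mu.-integrable D (EFin \o f).

(** Measurability of [f] is required separately, since that of its square does not imply it. *)
Definition sqint f := measurable_fun D f /\ intg (fun x => f x ^+ 2).

Lemma intg_meas f : intg f -> measurable_fun D f.
Proof. by move=> /measurable_int/measurable_EFinP. Qed.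

Lemma intg_le f g : measurable_fun D f -> intg g ->
  (forall x, D x -> `|f x| <= g x) -> intg f.
Proof.
move=> mf ig fg; apply: (le_integrable mD _ _ ig) => /=.
  exact/measurable_EFinP.
move=> x Dx; rewrite lee_fin (le_trans (fg _ Dx))//.
exact: ler_norm.
Qed.

Lemma intgD f g : intg f -> intg g -> intg (fun x => f x + g x).
Proof.
by move=> If Ig; apply: eq_integrable (integrableD mD If Ig).
Qed.

Lemma intgN f : intg f -> intg (fun x => - f x).
Proof.
move=> If; have := integrableN If.
by apply: eq_integrable.
Qed.

Lemma intgB f g : intg f -> intg g -> intg (fun x => f x - g x).
Proof. by move=> If Ig; apply: intgD => //; exact: intgN. Qed.

Lemma intgZ c f : intg f -> intg (fun x => c * f x).
Proof. by move=> If; apply: eq_integrable (integrableZl mD c If). Qed.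

Lemma intg_sum (I : Type) (s : seq I) (P : pred I) (f : I -> T -> R) :
  (forall i, P i -> intg (f i)) -> intg (fun x => \sum_(i <- s | P i) f i x).
Proof.
move=> h; have := integrable_sum mD s h.
by apply: eq_integrable => // x _ /=; rewrite sumEFin.
Qed.

Lemma intg_ltP f : measurable_fun D f -> (forall x, D x -> 0 <= f x) ->
  (\int[mu]_(x in D) (f x)%:E < +oo)%E -> intg f.
Proof.
move=> mf f0 h; apply/integrableP; split; first exact/measurable_EFinP.
rewrite (eq_integral (fun x => (f x)%:E))// => x /set_mem Dx.
by rewrite /= ger0_norm// f0.
Qed.

Lemma Rintegral_sum (I : Type) (s : seq I) (P : pred I) (f : I -> T -> R) :
  (forall i, P i -> intg (f i)) ->
  \int[mu]_(x in D) (\sum_(i <- s | P i) f i x) =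
  \sum_(i <- s | P i) \int[mu]_(x in D) f i x.
Proof.
move=> If; elim: s => [|i s IHs].
  under eq_Rintegral do rewrite big_nil.
  by rewrite big_nil Rintegral_cst// mul0r.
under eq_Rintegral do rewrite big_cons.
rewrite big_cons; case: ifPn => // Pi.
by rewrite RintegralD ?IHs//; [exact: If|exact: intg_sum].
Qed.

Lemma EFin_Rintegral f : intg f ->
  (\int[mu]_(x in D) f x)%:E = (\int[mu]_(x in D) (f x)%:E)%E.
Proof. by move=> If; rewrite fineK//; exact: integrable_fin_num. Qed.

Lemma sqint_meas f : sqint f -> measurable_fun D f. Proof. by case. Qed.

Lemma sqint_sqr f : sqint f -> intg (fun x => f x ^+ 2). Proof. by case. Qed.

Lemma sqint_mul f g : sqint f -> sqint g -> intg (fun x => f x * g x).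
Proof.
move=> [mf sf] [mg sg]; apply: intg_le (intgD sf sg) _.
  exact: measurable_funM.
move=> x _; rewrite ler_norml; apply/andP; split.
  rewrite -subr_ge0; have -> : f x * g x - - (f x ^+ 2 + g x ^+ 2) =
    2^-1 * (f x + g x) ^+ 2 + 2^-1 * (f x ^+ 2 + g x ^+ 2) by field.
  by rewrite addr_ge0// mulr_ge0// ?addr_ge0// ?sqr_ge0.
rewrite -subr_ge0; have -> : (f x ^+ 2 + g x ^+ 2) - f x * g x =
    2^-1 * (f x - g x) ^+ 2 + 2^-1 * (f x ^+ 2 + g x ^+ 2) by field.
by rewrite addr_ge0// mulr_ge0// ?addr_ge0// ?sqr_ge0.
Qed.

Lemma sqintD f g : sqint f -> sqint g -> sqint (fun x => f x + g x).
Proof.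
move=> Sf Sg; split.
  by apply: measurable_funD; [case: Sf|case: Sg].
have := intgD (intgD Sf.2 Sg.2) (intgZ 2 (sqint_mul Sf Sg)).
by apply: eq_integrable => // x _ /=; congr EFin; ring.
Qed.

Lemma sqintZ c f : sqint f -> sqint (fun x => c * f x).
Proof.
move=> Sf; split; first by apply: measurable_funM => //; case: Sf.
have := intgZ (c ^+ 2) Sf.2.
by apply: eq_integrable => // x _ /=; congr EFin; ring.
Qed.

Lemma sqintN f : sqint f -> sqint (fun x => - f x).
Proof.
move=> Sf; split; first by apply: measurableT_comp => //; case: Sf.
have := Sf.2.
by apply: eq_integrable => // x _ /=; congr EFin; ring.
Qed.

Lemma sqintB f g : sqint f -> sqint g -> sqint (fun x => f x - g x).
Proof. by move=> Sf Sg; apply: sqintD => //; exact: sqintN. Qed.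

Lemma sqint_sum (I : Type) (s : seq I) (f : I -> T -> R) :
  (forall i, sqint (f i)) -> sqint (fun x => \sum_(i <- s) f i x).
Proof.
move=> h; elim: s => [|i s IHs].
  under eq_fun do rewrite big_nil.
  split=> //; under eq_fun do rewrite expr0n/=.
  exact: integrable0.
by under eq_fun do rewrite big_cons; exact: sqintD.
Qed.

Lemma sqr_Rintegral_mul_le f g : sqint f -> sqint g ->
  (\int[mu]_(x in D) (f x * g x)) ^+ 2 <=
  (\int[mu]_(x in D) (f x ^+ 2)) * (\int[mu]_(x in D) (g x ^+ 2)).
Proof.
move=> Sf Sg.
set F := \int[mu]_(x in D) (f x ^+ 2); set G := \int[mu]_(x in D) (g x ^+ 2).
set C := \int[mu]_(x in D) (f x * g x).
have h (a b : R) : 0 <= a ^+ 2 * F + b ^+ 2 * G - 2 * a * b * C.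
  rewrite /F /G /C -!RintegralZl//; last 3 first.
  - exact: sqint_mul.
  - by case: Sg.
  - by case: Sf.
  rewrite -RintegralD//; [|exact: intgZ (sqint_sqr Sf)
    |exact: intgZ (sqint_sqr Sg)].
  rewrite -RintegralB//; last 2 first.
  - apply: intgD; [exact: intgZ (sqint_sqr Sf)|exact: intgZ (sqint_sqr Sg)].
  - exact: intgZ (sqint_mul Sf Sg).
  apply: Rintegral_ge0 => x _.
  have -> : a ^+ 2 * f x ^+ 2 + b ^+ 2 * g x ^+ 2 - 2 * a * b * (f x * g x) =
    (a * f x - b * g x) ^+ 2 by ring.
  exact: sqr_ge0.
have F0 : 0 <= F by apply: Rintegral_ge0 => x _; exact: sqr_ge0.
have G0 : 0 <= G by apply: Rintegral_ge0 => x _; exact: sqr_ge0.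
have [G00|Gn0] := eqVneq G 0.
  have [->|C0] := eqVneq C 0; first by rewrite expr0n/= mulr_ge0.
  (* With [G = 0] the form is affine in [b]; this value makes it [F - 2 (F + 1)], which is
     negative. *)
  have := h 1 ((F + 1) / C); rewrite G00 mulr0 addr0 expr1n mul1r mulr1.
  by rewrite -mulrA divfK//; lra.
have Gp : 0 < G by rewrite lt_def Gn0.
(* Up to scale, the minimiser of the quadratic form: its value there is [G (F G - C^2)]. *)
have := h G C => hh.
have : 0 <= G * (F * G - C ^+ 2) by move: hh; lra.
by rewrite pmulr_rge0// subr_ge0.
Qed.

Lemma normr_Rintegral_mul_le f g : sqint f -> sqint g ->
  `|\int[mu]_(x in D) (f x * g x)| <=
  Num.sqrt (\int[mu]_(x in D) (f x ^+ 2)) *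
  Num.sqrt (\int[mu]_(x in D) (g x ^+ 2)).
Proof.
move=> Sf Sg; have := sqr_Rintegral_mul_le Sf Sg.
rewrite -ler_sqrt; last first.
  by rewrite mulr_ge0//; apply: Rintegral_ge0 => x _; exact: sqr_ge0.
rewrite sqrtr_sqr sqrtrM//.
by apply: Rintegral_ge0 => x _; exact: sqr_ge0.
Qed.

Lemma Rintegral_sqrD_le f g : sqint f -> sqint g ->
  \int[mu]_(x in D) ((f x + g x) ^+ 2) <=
  2 * \int[mu]_(x in D) (f x ^+ 2) + 2 * \int[mu]_(x in D) (g x ^+ 2).
Proof.
move=> Sf Sg; rewrite -!RintegralZl; [|by []|by case: Sg|by []|by case: Sf].
rewrite -RintegralD; [|by []|exact: intgZ (sqint_sqr Sf)
  |exact: intgZ (sqint_sqr Sg)].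
apply: le_Rintegral => //.
- exact: (sqintD _ _).2.
- by apply: intgD; apply: intgZ; [case: Sf|case: Sg].
- by move=> x _; have := sqr_ge0 (f x - g x); lra.
Qed.

(** Continuity of the L^2 inner product: [u v - f g = (u - f) v + f (v - g)], with Cauchy-Schwarz on
    each term. The norm of [v k] is controlled by those of [v k - g] and [g]. *)
Lemma cvg_Rintegral_mul (u v : nat -> T -> R) f g :
  (forall k, sqint (u k)) -> (forall k, sqint (v k)) -> sqint f -> sqint g ->
  (\int[mu]_(x in D) ((u k x - f x) ^+ 2)) @[k --> \oo] --> 0 ->
  (\int[mu]_(x in D) ((v k x - g x) ^+ 2)) @[k --> \oo] --> 0 ->
  (\int[mu]_(x in D) (u k x * v k x)) @[k --> \oo] -->
  (\int[mu]_(x in D) (f x * g x)).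
Proof.
move=> Su Sv Sf Sg uf vg.
set J := fun h : T -> R => \int[mu]_(x in D) (h x ^+ 2).
apply/subr_cvg0.
have key k : `|\int[mu]_(x in D) (u k x * v k x) -
     \int[mu]_(x in D) (f x * g x)| <=
    Num.sqrt (J (u k \- f)) * Num.sqrt (2 * J (v k \- g) + 2 * J g) +
    Num.sqrt (J f) * Num.sqrt (J (v k \- g)).
  have S1 : sqint (u k \- f) by exact: sqintB.
  have S2 : sqint (v k \- g) by exact: sqintB.
  rewrite -RintegralB//; [|exact: sqint_mul|exact: sqint_mul].
  have -> : \int[mu]_(x in D) (u k x * v k x - f x * g x) =
    \int[mu]_(x in D) ((u k x - f x) * v k x + f x * (v k x - g x)).
    by apply: eq_Rintegral => x _; ring.
  rewrite RintegralD//; [|exact: (sqint_mul S1)|exact: (sqint_mul Sf S2)].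
  rewrite (le_trans (ler_normD _ _))// lerD//; last first.
    exact: (normr_Rintegral_mul_le Sf S2).
  apply: (le_trans (normr_Rintegral_mul_le S1 (Sv k))).
  rewrite ler_wpM2l ?sqrtr_ge0// ler_wsqrtr//.
  have := Rintegral_sqrD_le S2 Sg.
  by under eq_Rintegral do rewrite subrK.
apply/norm_cvg0P.
apply: (squeeze_cvgr (f := fun=> 0) (h := fun k =>
    Num.sqrt (J (u k \- f)) * Num.sqrt (2 * J (v k \- g) + 2 * J g) +
    Num.sqrt (J f) * Num.sqrt (J (v k \- g)))).
- by near=> k; rewrite normr_ge0/= key.
- exact: cvg_cst.
- have E : 0 = Num.sqrt 0 * Num.sqrt (2 * 0 + 2 * J g) + Num.sqrt (J f) *
     Num.sqrt 0 :> R by rewrite sqrtr0; ring.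
  rewrite [X in _ --> X]E; apply: cvgD; apply: cvgM.
  + by apply: (cvg_comp _ _ uf); exact: sqrt_continuous.
  + apply: (cvg_comp (fun k => 2 * J (v k \- g) + 2 * J g)); last first.
      exact: sqrt_continuous.
    by apply: cvgD; [apply: cvgM => //; exact: cvg_cst|exact: cvg_cst].
  + exact: cvg_cst.
  + by apply: (cvg_comp _ _ vg); exact: sqrt_continuous.
Unshelve. all: by end_near. Qed.

End square_integrable.
Arguments intg {d T R} mu D f.
Arguments sqint {d T R} mu D f.

(** * Almost everywhere convergence, dominated convergence and completeness for bounded functions *)

Section sequences_of_functions.
Context {d} {T : measurableType d} {R : realType}.
Variables (mu : {measure set T -> \bar R}) (D : set T).
Hypothesis mD : measurable D.

Lemma cvg_le_bound (u : nat -> R) (l a : R) : u k @[k --> \oo] --> l ->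
  (\forall k \near \oo, u k <= a) -> l <= a.
Proof.
move=> ul ua; rewrite -(cvg_lim (@Rhausdorff R) ul).
by apply: limr_le => //; apply/cvg_ex; exists l.
Qed.

Lemma cvg_sqr (I : Type) (F : set_system I) (FF : Filter F) (u : I -> R) (l : R) :
  u k @[k --> F] --> l -> u k ^+ 2 @[k --> F] --> l ^+ 2.
Proof. by move=> ul; rewrite expr2; under eq_fun do rewrite expr2; exact: cvgM. Qed.

Lemma intg_cst (c : R) : (mu D < +oo)%E -> intg mu D (fun=> c).
Proof.
move=> muD; apply/integrableP; split; first exact: measurable_cst.
rewrite (eq_integral (cst `|c|%:E))// integral_cst//.
by rewrite lte_mul_pinfty// ?abse_ge0 ?abse_fin_num.
Qed.

Lemma nneseries_lty_cvg0 (u : nat -> R) : (forall k, 0 <= u k) ->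
  (\sum_(0 <= k <oo) (u k)%:E < +oo)%E -> u k @[k --> \oo] --> 0.
Proof.
move=> u0 us; apply: cvg_series_cvg_0.
have := @summable_cvg R xpredT (fun k => (u k)%:E) _ _; apply.
  by move=> i _; rewrite lee_fin.
rewrite /summable -nneseries_esum; last by move=> *; rewrite lee_fin.
rewrite (eq_eseriesr (g := fun k => (u k)%:E))// => i _.
by rewrite gee0_abs ?lee_fin.
Qed.

(** The integrals add up to at most 1, so by monotone convergence the series of the [g k] is finite
    almost everywhere, and its terms tend to 0 there. *)
Lemma ae_cvg0_summable (g : nat -> T -> R) :
  (forall k, measurable_fun D (g k)) -> (forall k x, D x -> 0 <= g k x) ->
  (forall k, (\int[mu]_(x in D) (g k x)%:E <= (1 / (2 ^ (k + 1))%:R)%:E)%E) ->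
  {ae mu, forall x, D x -> g k x @[k --> \oo] --> 0}.
Proof.
move=> mg g0 gle.
have lty : (\int[mu]_(x in D) (\sum_(0 <= k <oo) (g k x)%:E) < +oo)%E.
  rewrite integral_nneseries//; last first.
    by move=> n; exact/measurable_EFinP.
  apply: (@le_lt_trans _ _ (1 / 2 ^+ 0 : R)%:E); last by rewrite ltry.
  rewrite -(cvg_lim _ (cvg_geometric_eseries_half (r := 1 : R) (n := 0)))//.
  apply: lee_nneseries => [k _ _|k _].
    by apply: integral_ge0 => x Dx; rewrite lee_fin g0.
  exact: gle.
have mS : measurable_fun D (fun x => \sum_(0 <= k <oo) (g k x)%:E)%E.
  apply: ge0_emeasurable_sum => [k x Dx _|k _]; first by rewrite lee_fin g0.
  exact/measurable_EFinP.
have /(integrable_ae mD) : mu.-integrable D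
    (fun x => \sum_(0 <= k <oo) (g k x)%:E)%E.
  apply/integrableP; split => //.
  rewrite (eq_integral (fun x => \sum_(0 <= k <oo) (g k x)%:E)%E)//.
  move=> x /set_mem Dx; rewrite gee0_abs//.
  by apply: nneseries_ge0 => k _ _; rewrite lee_fin g0.
apply: filterS => x h Dx; apply: nneseries_lty_cvg0.
  by move=> k; exact: g0.
by have := h Dx; rewrite ge0_fin_numE// nneseries_ge0// => k _ _; rewrite lee_fin g0.
Qed.

Lemma ae_cvg_subseq (g : nat -> T -> R) :
  (forall k, measurable_fun D (g k)) -> (forall k x, D x -> 0 <= g k x) ->
  (\int[mu]_(x in D) (g k x)%:E)%E @[k --> \oo] --> 0%E ->
  exists2 phi : nat -> nat, (forall k, (k <= phi k)%N) &
    {ae mu, forall x, D x -> g (phi k) x @[k --> \oo] --> 0}.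
Proof.
move=> mg g0 gto0.
have /choice[phi Hphi] : forall k, exists j, (k <= j)%N /\
    (\int[mu]_(x in D) (g j x)%:E <= (1 / (2 ^ (k + 1))%:R)%:E)%E.
  move=> k; have /fine_cvgP[fing] := gto0.
  move=> /cvgr0Pnorm_le /(_ (1 / (2 ^ (k + 1))%:R)).
  have p0 : (0 : R) < 1 / (2 ^ (k + 1))%:R by rewrite divr_gt0// ltr0n expn_gt0.
  move=> /(_ p0) h.
  near \oo => j; exists j; split; first by near: j; exact: nbhs_infty_ge.
  have fj : (\int[mu]_(x in D) (g j x)%:E)%E \is a fin_num by near: j.
  rewrite -(fineK fj) lee_fin (le_trans (ler_norm _))//.
  by near: j; exact: h.
exists phi; first by move=> k; case: (Hphi k).
by apply: ae_cvg0_summable => k; [exact: mg|exact: g0|case: (Hphi k)].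
Unshelve. all: by end_near. Qed.

Lemma dominated_cvg_Rintegral (f : nat -> T -> R) (g G : T -> R) :
  (forall k, measurable_fun D (f k)) -> measurable_fun D g -> intg mu D G ->
  (forall k x, D x -> `|f k x| <= G x) ->
  {ae mu, forall x, D x -> f k x @[k --> \oo] --> g x} ->
  (\int[mu]_(x in D) (f k x)) @[k --> \oo] --> \int[mu]_(x in D) (g x).
Proof.
move=> mf mg iG fG fg.
have [| |ig _ h] := @dominated_convergence _ _ _ mu D mD
  (fun k x => (f k x)%:E) (fun x => (g x)%:E) (EFin \o G)
  (fun k => (measurable_EFinP _ _).2 (mf k)) ((measurable_EFinP _ _).2 mg) _ iG.
- apply: filterS fg => x h Dx; apply: cvg_EFin; first exact: nearW.
  exact: h.
- by apply: aeW => x k Dx; rewrite lee_fin fG.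
by apply: fine_cvg; rewrite EFin_Rintegral.
Qed.

Lemma bounded_cvg_ae (f : nat -> T -> R) (g : T -> R) (A : R) : (mu D < +oo)%E ->
  (forall k, measurable_fun D (f k)) -> measurable_fun D g ->
  (forall k x, D x -> `|f k x| <= A) ->
  {ae mu, forall x, D x -> f k x @[k --> \oo] --> g x} ->
  (\int[mu]_(x in D) (f k x)) @[k --> \oo] --> \int[mu]_(x in D) (g x).
Proof.
move=> muD mf mg; exact: (dominated_cvg_Rintegral mf mg (intg_cst A muD)).
Qed.

(** Riesz-Fischer, in a form where the limit inherits the bound [A] at every point of [D]. Uniform
    boundedness on a set of finite measure lets dominated convergence pass to the limit. *)
Lemma bounded_L2_complete (f : nat -> T -> R) (A : R) : (mu D < +oo)%E ->
  (forall k, measurable_fun D (f k)) ->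
  (forall k x, D x -> `|f k x| <= A) ->
  (forall e, 0 < e -> exists N, forall m n, (N <= m)%N -> (N <= n)%N ->
    \int[mu]_(x in D) ((f m x - f n x) ^+ 2) <= e) ->
  exists g : T -> R, [/\ measurable_fun D g, forall x, D x -> `|g x| <= A &
    (\int[mu]_(x in D) ((f k x - g x) ^+ 2)) @[k --> \oo] --> 0].
Proof.
move=> muD mf fA cf.
have bi (h : T -> R) (B : R) : measurable_fun D h ->
    (forall x, D x -> `|h x| <= B) -> intg mu D h.
  by move=> mh hB; apply: (intg_le mD mh (intg_cst B muD)).
have id m n : intg mu D (fun x => (f m x - f n x) ^+ 2).
  apply: (bi _ ((A + A) ^+ 2)).
    by apply: measurable_funX; exact: measurable_funB.
  move=> x Dx; rewrite normrX lerXn2r ?nnegrE ?addr_ge0//.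
  - by rewrite (le_trans _ (fA 0%N x Dx)).
  - by rewrite (le_trans _ (fA 0%N x Dx)).
  - by rewrite (le_trans (ler_normB _ _))// lerD// fA.
(* The factor [4 ^- k] forces increments of order [2 ^- k] almost everywhere along the subsequence;
   the other factor makes the weighted integrals summable. *)
pose e k : R := (4 ^+ k)^-1 * (1 / (2 ^ (k + 1))%:R).
have e0 k : 0 < e k.
  by rewrite mulr_gt0// ?invr_gt0 ?exprn_gt0// divr_gt0// ltr0n expn_gt0.
have /choice[N HN] := fun k : nat => cf (e k) (e0 k).
pose phi := fix phi (k : nat) : nat :=
  if k is j.+1 then maxn (phi j).+1 (N j.+1) else N 0%N.
have phiN k : (N k <= phi k)%N by case: k => //= k; rewrite leq_maxr.
have phiS k : (phi k < phi k.+1)%N by rewrite /= leq_max leqnn.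
have phik k : (k <= phi k)%N.
  by elim: k => // k IH; exact: leq_ltn_trans IH (phiS k).
have : {ae mu, forall x, D x ->
    4 ^+ k * (f (phi k.+1) x - f (phi k) x) ^+ 2 @[k --> \oo] --> (0 : R)}.
  apply: ae_cvg0_summable.
  - move=> k; apply: measurable_funM => //; apply: measurable_funX.
    exact: measurable_funB.
  - by move=> k x Dx; rewrite mulr_ge0 ?sqr_ge0// exprn_ge0.
  - move=> k; rewrite -EFin_Rintegral//; last exact: intgZ.
    rewrite lee_fin RintegralZl//; last exact: id.
    rewrite -ler_pdivlMl ?exprn_gt0//; apply: HN => //.
    by rewrite (leq_trans (phiN k))// ltnW.
move=> cae.
(* The upper limit is measurable everywhere; [fine] and the clipping give a real value bounded by
   [A] also where the subsequence diverges. *)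
pose g x := Num.max (- A) (Num.min A (fine (limn_esup (fun k => (f (phi k) x)%:E)))).
have gE x : D x -> forall l, f (phi k) x @[k --> \oo] --> l -> g x = l.
  move=> Dx l fl; rewrite /g (cvg_limn_einf_sup (l := l%:E))//=; last first.
    by apply: cvg_EFin => //; exact: nearW.
  have : `|l| <= A.
    apply: (cvg_le_bound (cvg_norm fl)).
    by near=> k; exact: fA.
  by rewrite ler_norml => /andP[Al lA]; rewrite min_r// max_r.
have cvgae : {ae mu, forall x, D x -> f (phi k) x @[k --> \oo] --> g x}.
  apply: filterS cae => x h Dx.
  suff /cvg_ex[l fl] : cvgn (fun k => f (phi k) x) by rewrite (gE _ Dx l).
  have /cvg_seq_bounded[M [Mr HM]] : cvgn (fun k => 4 ^+ k * (f (phi k.+1) x - f (phi k) x) ^+ 2).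
    by apply/cvg_ex; exists 0; exact: h.
  pose C := Num.sqrt (`|M| + 1).
  have HC k : `|f (phi k.+1) x - f (phi k) x| <= C * 2^-1 ^+ k.
    have : 4 ^+ k * (f (phi k.+1) x - f (phi k) x) ^+ 2 <= `|M| + 1.
      apply: (le_trans (ler_norm _)); apply: HM => //.
      by rewrite (le_lt_trans (ler_norm _))// ltrDl.
    have -> : 4 ^+ k * (f (phi k.+1) x - f (phi k) x) ^+ 2 =
        (2 ^+ k * (f (phi k.+1) x - f (phi k) x)) ^+ 2.
      by rewrite exprMn -exprM mulnC exprM; congr (_ ^+ _ * _); ring.
    rewrite -ler_sqrt ?addr_ge0// sqrtr_sqr normrM ger0_norm ?exprn_ge0//.
    by rewrite mulrC -ler_pdivlMr ?exprn_gt0// exprVn.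
  have cs : cvgn (series (telescope (fun k => f (phi k) x))).
    apply: normed_cvg.
    apply: (@series_le_cvg _ _ (geometric C 2^-1)) => //=.
    - by move=> n; rewrite mulr_ge0 ?sqrtr_ge0 ?exprn_ge0.
    - by apply: is_cvg_geometric_series; rewrite ger0_norm// invf_lt1// ltr1n.
  have -> : (fun k => f (phi k) x) = (fun k => f (phi 0%N) x + series (telescope (fun k => f (phi k) x)) k).
    by apply/funext => k; rewrite [LHS](eq_sum_telescope (fun k => f (phi k) x)).
  by apply: is_cvgD => //; exact: is_cvg_cst.
have mg : measurable_fun D g.
  apply: measurable_maxr => //; apply: measurable_minr => //.
  apply: (measurableT_comp (@fine_measurable _ setT measurableT)).
  by apply: measurable_fun_limn_esup => k; exact/measurable_EFinP.
have gA x : D x -> `|g x| <= A.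
  move=> Dx; have A0 : 0 <= A by rewrite (le_trans _ (fA 0%N x Dx)).
  rewrite ler_norml /g le_max lexx/= ge_max ge_min lexx/= andbT.
  by rewrite (le_trans _ A0)// oppr_le0.
exists g; split => //.
(* Letting the second index run to infinity along the subsequence turns the Cauchy condition into
   convergence of the whole sequence. *)
have lim n : (\int[mu]_(x in D) ((f n x - f (phi k) x) ^+ 2)) @[k --> \oo] -->
    \int[mu]_(x in D) ((f n x - g x) ^+ 2).
  apply: (bounded_cvg_ae (A := (A + A) ^+ 2)) => //.
  - by move=> k; apply: measurable_funX; exact: measurable_funB.
  - by apply: measurable_funX; exact: measurable_funB.
  - move=> k x Dx; rewrite normrX lerXn2r ?nnegrE ?addr_ge0//.
    + by rewrite (le_trans _ (fA 0%N x Dx)).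
    + by rewrite (le_trans _ (fA 0%N x Dx)).
    + by rewrite (le_trans (ler_normB _ _))// lerD// fA.
  - apply: filterS cvgae => x h Dx.
    have := h Dx => {}h.
    by apply: cvg_sqr; apply: cvgB => //; exact: cvg_cst.
apply/cvgr0Pnorm_le => eps eps0; have [M HM] := cf _ eps0.
near=> n.
rewrite ger0_norm; last by apply: Rintegral_ge0 => x _; exact: sqr_ge0.
apply: (cvg_le_bound (lim n)); near=> k; apply: HM.
  by near: n; exact: nbhs_infty_ge.
by rewrite (leq_trans _ (phik k))//; near: k; exact: nbhs_infty_ge.
Unshelve. all: by end_near. Qed.

End sequences_of_functions.

(** * Functions of class C^1 of several variables *)

Section row_vectors.
Context {R : realType} (m : nat).
Implicit Types (x y : 'rV[R]_m).

Lemma cvg_rowP (I : Type) (F : set_system I) (FF : Filter F)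
    (u : I -> 'rV[R]_m) (l : 'rV[R]_m) :
  (forall j, u k 0 j @[k --> F] --> l 0 j) -> u k @[k --> F] --> l.
Proof.
move=> ul; apply/cvg_ballP => e e0.
have h : \forall k \near F, forall j, ball (l 0 j) e (u k 0 j).
  apply: filter_forall => j; have /cvg_ballP := ul j; exact.
by apply: filterS h => k h; split=> // i j; rewrite ord1.
Qed.

Lemma ler_mx_norm_coord x j : `|x 0 j| <= `|x|.
Proof.
rewrite [leRHS]/Num.norm/= mx_normrE.
exact: (le_bigmax _ (fun ij : 'I_1 * 'I_m => `|x ij.1 ij.2|) (0, j)).
Qed.

Lemma mx_norm_le_sum x : `|x| <= \sum_j `|x 0 j|.
Proof.
rewrite [leLHS]/Num.norm/= mx_normrE; apply/bigmax_leP; split.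
  by apply: sumr_ge0.
move=> [i j] _ /=; rewrite ord1 (bigD1 j)//= lerDl.
exact: sumr_ge0.
Qed.

Lemma continuous_line x y : continuous (fun t : R => x + t *: y).
Proof.
move=> t; apply: cvgD; first exact: cvg_cst.
by apply: cvgZr_tmp; exact: cvg_id.
Qed.

End row_vectors.

Section measurable_composition.
Context {d} {T : measurableType d} {R : realType}.

(** The variables are rounded down to the lattice of mesh [1 / (k + 1)]. The rounded vector takes
    countably many values, so any function of it is measurable; continuity of [f] serves only for
    the limit in [k]. *)
Lemma measurable_continuous_rV (D : set T) (m : nat) (f : 'rV[R]_m -> R)
    (X : 'I_m -> T -> R) : measurable D -> continuous f ->
  (forall j, measurable_fun D (X j)) ->
  measurable_fun D (fun w => f (\row_j X j w)).
Proof.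
move=> mD cf mX.
pose q (k : nat) (w : T) : 'rV[int]_m := \row_j Num.floor (k.+1%:R * X j w).
pose F (k : nat) (a : 'rV[int]_m) := f (\row_j (k.+1%:R^-1 * (a 0 j)%:~R)).
apply: (measurable_fun_cvg (h := fun k w => F k (q k w))).
  move=> k _ B mB.
  have -> : D `&` (fun w => F k (q k w)) @^-1` B =
    \bigcup_(a in [set a | B (F k a)]) (D `&` \bigcap_j ((fun w => k.+1%:R * X j w) @^-1` `[(a 0 j)%:~R, (a 0 j + 1)%:~R[)).
    apply/seteqP; split => [w [Dw Bw]|w [a Ba [Dw aw]]].
      exists (q k w) => //; split=> // j _ /=; rewrite in_itv/= mxE.
      by rewrite floor_le_tmp//= floorD1_gt.
    split=> //=; suff -> : q k w = a by [].
    apply/rowP => j; rewrite mxE; apply: floor_def.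
    by have := aw j I; rewrite /= in_itv.
  rewrite bigcup_mkcond; apply: countable_bigcupT_measurable; first exact: countableP.
  move=> a; case: ifP => _ //.
  have -> : D `&` \bigcap_j ((fun w => k.+1%:R * X j w) @^-1` `[(a 0 j)%:~R, (a 0 j + 1)%:~R[) =
      D `&` \bigcap_j (D `&` (fun w => k.+1%:R * X j w) @^-1` `[(a 0 j)%:~R, (a 0 j + 1)%:~R[).
    apply/seteqP; split => [w [Dw h]|w [Dw h]]; split=> // j _; first by split=> //; exact: h.
    by case: (h j I).
  apply: measurableI => //; apply: fin_bigcap_measurable => // j _.
  have mk : measurable_fun D (fun w => k.+1%:R * X j w).
    exact: measurable_funM.
  exact: mk.
move=> w Dw; apply: (cvg_comp (fun k => \row_j (k.+1%:R^-1 * (q k w 0 j)%:~R)) f).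
  apply: (@cvg_rowP _ _ _ _ _ _ (\row_j X j w)) => j; rewrite mxE.
  apply/cvgrPdist_le => e e0; near=> k; rewrite !mxE.
  rewrite [X in `|X - _|](_ : X j w = k.+1%:R^-1 * (k.+1%:R * X j w)); last first.
    by rewrite mulKf// pnatr_eq0.
  rewrite -mulrBr normrM ger0_norm ?invr_ge0//.
  apply: (@le_trans _ _ k.+1%:R^-1).
    apply: ler_piMr; first by rewrite invr_ge0.
    have /andP[h1] := floor_itv (k.+1%:R * X j w); rewrite intrD => h2.
    by rewrite ger0_norm ?subr_ge0// lerBlDl (ltW h2).
  near: k; have := near_infty_natSinv_lt (PosNum e0).
  by apply: filterS => k /ltW.
exact: cf.
Unshelve. all: by end_near. Qed.

End measurable_composition.

Section directional_derivative.
Context {R : realType} (m : nat).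
Implicit Types (f : 'rV[R]_m -> R) (x c : 'rV[R]_m).

Definition C1 f :=
  [/\ continuous f, forall x j, derivable f x (delta_mx 0 j) &
      forall j, continuous (partial j f)].

Lemma MVT_between (g dg : R -> R) (a b : R) :
  (forall t : R, is_derive t 1 g (dg t)) ->
  exists2 c, Num.min a b <= c <= Num.max a b & g b - g a = dg c * (b - a).
Proof.
move=> gd.
have cg : continuous g.
  move=> t; have := gd t => -[dt _].
  exact/differentiable_continuous/derivable1_diffP.
have [ab|/ltW ba] := leP a b.
  have [c cab E] := @MVT_segment R g dg a b ab (fun t _ => gd t)
    (continuous_subspaceT cg).
  by exists c => //; move: cab; rewrite in_itv/=.
have [c cab E] := @MVT_segment R g dg b a ba (fun t _ => gd t)
  (continuous_subspaceT cg).
exists c; first by move: cab; rewrite in_itv/=.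
by rewrite -opprB E -mulrN opprB.
Qed.

Lemma ler_norm_between (y t : R) : Num.min 0 y <= t <= Num.max 0 y -> `|t| <= `|y|.
Proof.
rewrite ge_min le_max; case: (leP 0 y) => y0; rewrite ler_norml;
  [rewrite (ger0_norm y0)|rewrite (ltr0_norm y0)];
  by move=> /andP[/orP[|] ? /orP[|] ?]; apply/andP; split; lra.
Qed.

Lemma is_derive_line f x c (t df : R) :
  is_derive (x + t *: c) c f df -> is_derive t 1 (fun s => f (x + s *: c)) df.
Proof.
move=> [fd fE].
have E : (fun h : R => h^-1 *: (((fun s => f (x + s *: c)) \o shift t) (h *: 1) -
    f (x + t *: c))) =
  (fun h : R => h^-1 *: ((f \o shift (x + t *: c)) (h *: c) - f (x + t *: c))).
  apply/funext => h /=; congr (_ *: (f _ - _)).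
  by rewrite scalerDl [h%:A]mulr1 addrCA.
apply: DeriveDef; first by rewrite /derivable E.
by rewrite -fE /derive E.
Qed.

Lemma C1_is_derive_coord f x (j : 'I_m) (t : R) : C1 f ->
  is_derive t 1 (fun s => f (x + s *: delta_mx 0 j))
    (partial j f (x + t *: delta_mx 0 j)).
Proof. by case=> _ fd _; apply: is_derive_line; exact/derivableP. Qed.

Lemma norm_delta_mx_le1 (j : 'I_m) : `|delta_mx 0 j : 'rV[R]_m| <= 1.
Proof.
apply: (le_trans (mx_norm_le_sum _)).
rewrite (bigD1 j)//= mxE !eqxx/= normr1 big1 ?addr0// => i ij.
by rewrite mxE (negbTE ij) andbF normr0.
Qed.

(** The displacement [h c] is made one coordinate at a time. The mean value theorem gives each
    partial increment, and continuity of the partial derivatives at [x] replaces the intermediate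
    points by [x]. *)
Lemma C1_is_derive f x c : C1 f ->
  is_derive x c f (\sum_j c 0 j * partial j f x).
Proof.
move=> C1f; set L := \sum_j _.
suff : (fun h : R => h^-1 *: ((f \o shift x) (h *: c) - f x)) h @[h --> 0^'] --> L.
  move=> fL; apply: DeriveDef; first by apply/cvg_ex; exists L.
  exact: (cvg_lim (@Rhausdorff R) fL).
have S0 (s : seq 'I_m) : 0 <= \sum_(j <- s) `|c 0 j| by exact: sumr_ge0.
pose S : R := 1 + \sum_j `|c 0 j|.
have S_gt0 : 0 < S by rewrite ltr_pwDl.
apply/cvgrPdist_le => e e0.
have eS0 : 0 < e / S by rewrite divr_gt0.
have [dl /= dl0 Hdl] : exists2 dl, 0 < dl & forall z, `|z - x| < dl -> forall j,
    `|partial j f z - partial j f x| <= e / S.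
  have h : \forall z \near x, forall j, `|partial j f z - partial j f x| <= e / S.
    suff h j : \forall z \near x, `|partial j f z - partial j f x| <= e / S.
      exact: filter_forall h.
    case: C1f => _ _ /(_ j x) /cvgrPdist_le /(_ _ eS0).
    by apply: filterS => z; rewrite distrC.
  have /nbhs_normP[dl /= dl0 H] := h.
  by exists dl => // z zx; apply: H; rewrite /= distrC.
(* The hypothesis keeps every intermediate point within [dl] of [x]; the induction adds the
   coordinates of [s] one by one. *)
have key h (s : seq 'I_m) : `|h| * \sum_(j <- s) `|c 0 j| < dl ->
    `|f (x + h *: \sum_(j <- s) c 0 j *: delta_mx 0 j) - f x -
      h * \sum_(j <- s) c 0 j * partial j f x| <= `|h| * (\sum_(j <- s) `|c 0 j|) * (e / S).
  elim: s => [|j s IHs] hs.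
    by rewrite !big_nil scaler0 addr0 subrr mulr0 subr0 normr0 mulr0 mul0r.
  have hs' : `|h| * \sum_(j <- s) `|c 0 j| < dl.
    apply: le_lt_trans hs; rewrite big_cons ler_wpM2l// lerDr//.
  have {}IHs := IHs hs'.
  rewrite !big_cons.
  set u := \sum_(j <- s) c 0 j *: delta_mx 0 j in IHs *.
  have [t tb E] := @MVT_between _ _ 0 (h * c 0 j)
    (fun t => C1_is_derive_coord (x + h *: u) j t C1f).
  have tle : `|t| <= `|h| * `|c 0 j|.
    by rewrite -normrM; exact: ler_norm_between.
  rewrite scale0r addr0 subr0 in E.
  have -> : x + h *: (c 0 j *: delta_mx 0 j + u) =
      x + h *: u + (h * c 0 j) *: delta_mx 0 j.
    by rewrite scalerDr scalerA [in LHS](addrC (_ *: _)) addrA.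
  set a := f (x + h *: u) in E IHs *; set b := f _ in E *.
  set p := partial j f _ in E.
  have pp : `|p - partial j f x| <= e / S.
    apply: Hdl; rewrite addrC -[x + _ + _]addrA addKr.
    apply: le_lt_trans hs; rewrite (le_trans (ler_normD _ _))//.
    rewrite big_cons mulrDr addrC lerD//.
      rewrite normrZ -[leRHS]mulr1 ler_pM//; exact: norm_delta_mx_le1.
    rewrite normrZ ler_wpM2l//.
    rewrite /u; elim: (s) => [|i s' IH]; first by rewrite !big_nil normr0.
    rewrite !big_cons (le_trans (ler_normD _ _))// lerD//.
    by rewrite normrZ -[leRHS]mulr1 ler_wpM2l//; exact: norm_delta_mx_le1.
  set Q := \sum_(j <- s) c 0 j * partial j f x in IHs *.
  have -> : b - f x - h * (c 0 j * partial j f x + Q) =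
      (a - f x - h * Q) + (p - partial j f x) * (h * c 0 j).
    by move: E; lra.
  rewrite (le_trans (ler_normD _ _))// mulrDr mulrDl addrC lerD//.
  by rewrite !normrM mulrC ler_wpM2l// mulr_ge0.
have hc h : x + h *: c = x + h *: \sum_j c 0 j *: delta_mx 0 j.
  by rewrite [in LHS](row_sum_delta c).
have dS : 0 < dl / S by rewrite divr_gt0.
near=> h.
have h0 : h != 0 by near: h; exact: nbhs_dnbhs_neq.
have hl : `|h| < dl / S.
  near: h; apply: dnbhs0_lt => //.
have hS : `|h| * \sum_j `|c 0 j| < dl.
  rewrite (@le_lt_trans _ _ (`|h| * S))// ?ler_wpM2l// ?lerDr//.
  by rewrite -ltr_pdivlMr.
have := key h (index_enum _) hS; rewrite -hc => {}key.
rewrite /= [h *: c + x]addrC.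
have -> : L - h^-1 *: (f (x + h *: c) - f x) =
    - (h^-1 * (f (x + h *: c) - f x - h * L)).
  set b := f (x + h *: c).
  by rewrite -[h^-1 *: _]/(h^-1 * (b - f x)); field.
rewrite normrN normrM normfV ler_pdivrMl ?normr_gt0//.
apply: (le_trans key); rewrite -mulrA ler_wpM2l//.
rewrite mulrCA ler_piMr ?(ltW e0)// ler_pdivrMr// mul1r.
by rewrite /S lerDr.
Unshelve. all: by end_near. Qed.

Lemma C1_is_derive_line f x c (t : R) : C1 f ->
  is_derive t 1 (fun s => f (x + s *: c))
    (\sum_j c 0 j * partial j f (x + t *: c)).
Proof. by move=> C1f; apply: is_derive_line; exact: C1_is_derive. Qed.

End directional_derivative.

(** * Gaussian integration by parts *)

Lemma is_derive_ext (R : numFieldType) (V W : normedModType R) (f g : V -> W)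
    (x v : V) (df dg : W) :
  is_derive x v f df -> f =1 g -> df = dg -> is_derive x v g dg.
Proof. by move=> fd /funext <- <-. Qed.

(** Half of the exponent stays behind as the density with standard deviation [sqrt 2 * s], the other
    half is there to absorb a power of [x]. *)
Lemma gaussian_exponent_split (R : realFieldType) (x s : R) : s != 0 ->
  - x ^+ 2 / (s ^+ 2 *+ 2) =
  - (x / (2 * s)) ^+ 2 + - x ^+ 2 / (2 * s ^+ 2 *+ 2).
Proof.
by move=> s0; rewrite -(mulr_natr (s ^+ 2)) -(mulr_natr (2 * s ^+ 2)); field.
Qed.

Section cvg_integral_exhaustion.
Context {R : realType}.
Local Notation mu := (@lebesgue_measure R).

Lemma cvg_Rintegral_itvNn (g : R -> R) : intg mu setT g ->
  (\int[mu]_(x in `[- (k.+1%:R : R), k.+1%:R]) g x) @[k --> \oo] --> \int[mu]_x g x.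
Proof.
move=> Ig; have mg := intg_meas Ig.
pose J (k : nat) := `[- (k.+1%:R : R), k.+1%:R]%classic : set R.
have mJ k : measurable (J k) by exact: measurable_itv.
have [| | |_ _ h] := @dominated_convergence _ _ _ mu setT measurableT
  (fun k x => ((g \_ (J k)) x)%:E) (fun x => (g x)%:E) (fun x => `|(g x)%:E|%E)
  (fun k => _) ((measurable_EFinP _ _).2 mg) _ (integrable_abse Ig).
- move=> k; apply/measurable_EFinP.
  by apply/(measurable_restrictT _ (mJ k)); exact: measurable_funS mg.
- apply: aeW => x _; apply: cvg_near_cst; near=> k.
  rewrite patchE mem_set// /J /= in_itv/=.
  have : `|x| <= k.+1%:R.
    rewrite (@le_trans _ _ k%:R) ?ler_nat//.
    by near: k; exact: nbhs_infty_ger.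
  by rewrite ler_norml.
- apply: aeW => x k _; rewrite /= lee_fin patchE; case: ifP => // _.
  by rewrite normr0.
rewrite -EFin_Rintegral// in h.
have -> : (fun k => \int[mu]_(x in `[- (k.+1%:R : R), k.+1%:R]) g x) =
    fine \o (fun k => \int[mu]_x ((g \_ (J k)) x)%:E)%E.
  by apply/funext => k; rewrite Rintegral_mkcond.
exact: fine_cvg h.
Unshelve. all: by end_near. Qed.

End cvg_integral_exhaustion.

Section gaussian_integration_by_parts.
Context {R : realType}.
Variable s : R.
Hypothesis s0 : 0 < s.
Local Notation mu := (@lebesgue_measure R).
Local Notation nu := (normal_prob 0 s).
Local Notation p := (normal_pdf 0 s).

Let sn0 : s != 0. Proof. by rewrite gt_eqF. Qed.

(** The Radon-Nikodym derivative of the normal law agrees almost everywhere with the density, both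
    having the same integral over every measurable set. *)
Lemma ge0_integral_normal_prob (f : R -> R) :
  measurable_fun setT f -> (forall x, 0 <= f x) ->
  (\int[nu]_x (f x)%:E = \int[mu]_x (f x * p x)%:E)%E.
Proof.
move=> mf f0.
have dom := normal_prob_dominates (0 : R) s.
rewrite -(Radon_Nikodym_SigmaFinite.change_of_variables dom)//; last first.
  exact/measurable_EFinP.
under [RHS]eq_integral do rewrite EFinM.
have mp : measurable_fun setT (EFin \o p).
  by apply/measurable_EFinP; exact: measurable_normal_pdf.
have mfE : measurable_fun setT (EFin \o f) by exact/measurable_EFinP.
apply: ae_eq_integral => //.
- apply: emeasurable_funM => //.
  exact: measurable_int (Radon_Nikodym_SigmaFinite.f_integrable dom).
- exact: emeasurable_funM.
- apply: ae_eqe_mul2l; apply: integral_ae_eq => //.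
  + exact: Radon_Nikodym_SigmaFinite.f_integrable.
  + by move=> E _ mE; rewrite -Radon_Nikodym_SigmaFinite.f_integral.
Qed.

Lemma intg_normal_prob (f : R -> R) : measurable_fun setT f ->
  intg mu setT (fun x => f x * p x) -> intg nu setT f.
Proof.
move=> mf /integrableP[_ h]; apply/integrableP; split.
  exact/measurable_EFinP.
rewrite /= (ge0_integral_normal_prob (f := fun x => `|f x|))//; last first.
  exact: measurableT_comp.
apply: le_lt_trans h; rewrite le_eqVlt; apply/orP; left; apply/eqP.
by apply: eq_integral => x _; rewrite /= normrM [`|p x|]ger0_norm// normal_pdf_ge0.
Qed.

(** Reduced to nonnegative functions by [f = (f + |f|) - |f|]. *)
Lemma Rintegral_normal_prob (f : R -> R) : intg nu setT f ->
  intg mu setT (fun x => f x * p x) ->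
  \int[nu]_x f x = \int[mu]_x (f x * p x).
Proof.
move=> If Ifp; have mf := intg_meas If.
have E (g : R -> R) : measurable_fun setT g -> (forall x, 0 <= g x) ->
    \int[nu]_x g x = \int[mu]_x (g x * p x).
  by move=> mg g0; rewrite /Rintegral ge0_integral_normal_prob.
have mp : measurable_fun setT p by exact: measurable_normal_pdf.
have In : intg nu setT (fun x => `|f x|) by exact: integrable_norm If.
have Inp : intg mu setT (fun x => `|f x| * p x).
  apply: (intg_le _ _ (integrable_norm Ifp)) => //.
    by apply: measurable_funM => //; exact: measurableT_comp.
  by move=> x _ /=; rewrite !normrM normr_id.
have -> : \int[nu]_x f x = \int[nu]_x (f x + `|f x|) - \int[nu]_x `|f x|.
  by rewrite RintegralD// addrK.
have -> : \int[mu]_x (f x * p x) =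
    \int[mu]_x ((f x + `|f x|) * p x) - \int[mu]_x (`|f x| * p x).
  under [X in _ = X - _]eq_Rintegral do rewrite mulrDl.
  by rewrite RintegralD// addrK.
rewrite !E//.
- exact: measurableT_comp.
- by apply: measurable_funD => //; exact: measurableT_comp.
- by move=> x; rewrite -lerBlDl sub0r -normrN ler_norm.
Qed.

Lemma normal_pdf_expE : p = fun x => normal_peak s * expR (- (s ^+ 2 *+ 2)^-1 * x ^+ 2).
Proof.
apply/funext => x; rewrite normal_pdfE// /normal_fun subr0.
by congr (_ * expR _); rewrite !mulNr mulrC.
Qed.

Lemma normal_pdf_is_derive (x : R) : is_derive x 1 p (- (x / s ^+ 2) * p x).
Proof.
rewrite normal_pdf_expE; set c := - _^-1.
have D1 : is_derive x 1 (fun x : R => c * x ^+ 2) (c * (2 * x)).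
  apply: (is_derive_ext (is_deriveZ c (is_deriveX 2 (is_derive_id x (1 : R))))) => //.
  by rewrite /= expr1 /GRing.scale/= mulr1.
have D2 := @is_derive1_comp R expR (fun x => c * x ^+ 2) x _ _ (is_derive_expR _) D1.
apply: (is_derive_ext (is_deriveZ (normal_peak s) D2)) => //.
by rewrite /GRing.scale/= /c -(mulr_natr (s ^+ 2)); field.
Qed.

(** From [1 + y <= exp y] and [k <= k^2], the density at [k] is bounded by a multiple of [1 / k].
    This kills the boundary terms of the integration by parts. *)
Lemma normal_pdf_cvg0 : p k%:R @[k --> \oo] --> 0.
Proof.
pose C := normal_peak s * (s ^+ 2 *+ 2).
have s2 : 0 < s ^+ 2 *+ 2 by rewrite pmulrn_lgt0// exprn_gt0.
have C0 : 0 < C by rewrite mulr_gt0// normal_peak_gt0.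
rewrite -(cvg_shiftS (fun k => p k%:R)).
apply: (squeeze_cvgr (f := fun=> 0) (h := fun k => C * k.+1%:R^-1)).
- near=> k; rewrite normal_pdf_ge0/= normal_pdfE// /normal_fun subr0 /C -mulrA.
  rewrite ler_wpM2l ?normal_peak_ge0// mulNr expRN.
  rewrite -[leRHS]invrK invfM invrK lef_pV2 ?posrE ?expR_gt0 ?mulr_gt0 ?invr_gt0 ?ltr0n//.
  apply: le_trans (expR_ge1Dx _); rewrite mulrC.
  apply: (@le_trans _ _ (k.+1%:R ^+ 2 / (s ^+ 2 *+ 2))); last by rewrite lerDr.
  by rewrite ler_wpM2r ?invr_ge0 ?(ltW s2)// expr2 ler_peMl// ler1n.
- exact: cvg_cst.
- rewrite -[X in _ --> X](mulr0 C); apply: cvgM; first exact: cvg_cst.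
  exact: cvg_harmonic.
Unshelve. all: by end_near. Qed.

Lemma normal_pdfN (x : R) : p (- x) = p x.
Proof. by rewrite !normal_pdfE// /normal_fun !subr0 sqrrN. Qed.

(** With [y = |x| / (2 s)], the inequality [y <= 1 + y^2 <= exp (y^2)] consumes half of the Gaussian
    exponent and leaves a multiple of the wider density. *)
Lemma intg_id_normal_pdf : intg mu setT (fun x => x * p x).
Proof.
pose t := Num.sqrt 2 * s.
have t0 : t != 0 by rewrite mulf_neq0// sqrtr_eq0 -ltNge.
have t2 : t ^+ 2 = 2 * s ^+ 2 by rewrite exprMn sqr_sqrtr.
have It := integrable_normal_pdf (0 : R) t.
apply: (intg_le _ _ (intgZ _ (2 * s * normal_peak s / normal_peak t) It)) => //.
  by apply: measurable_funM => //; exact: measurable_normal_pdf.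
move=> x _; rewrite !normal_pdfE// /normal_fun subr0 t2.
have pt := normal_peak_gt0 t0; have ps := normal_peak_gt0 sn0.
rewrite !normrM (ger0_norm (ltW ps)) (ger0_norm (expR_ge0 _)).
set E' := expR (- x ^+ 2 / (2 * _ *+ _)).
have -> : 2 * s * normal_peak s / normal_peak t * (normal_peak t * E') =
    normal_peak s * (2 * s * E') by field; rewrite gt_eqF.
rewrite mulrCA ler_wpM2l ?(ltW ps)// /E'.
rewrite gaussian_exponent_split//.
rewrite expRD mulrA ler_wpM2r// ?expR_ge0//.
rewrite expRN ler_pdivrMr ?expR_gt0//.
have -> : `|x| = 2 * s * `|x / (2 * s)|.
  rewrite normrM normfV [`|2 * s|]ger0_norm ?mulr_ge0 ?(ltW s0)//.
  by rewrite mulrCA divff ?mulr1// mulf_neq0.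
rewrite ler_wpM2l ?mulr_ge0 ?(ltW s0)//.
apply: le_trans (expR_ge1Dx _); set y := x / _.
by rewrite -real_normK ?num_real//; have := sqr_ge0 (`|y| - 1); nra.
Qed.

Lemma intg_id_normal_prob : intg nu setT id.
Proof. by apply: intg_normal_prob => //; exact: intg_id_normal_pdf. Qed.

Lemma Rintegral_normal_prob_by_parts (f df : R -> R) (K : R) :
  (forall t : R, is_derive t 1 f (df t)) -> continuous df ->
  (forall t, `|f t| <= K) -> (forall t, `|df t| <= K) ->
  \int[nu]_x (x * f x) = s ^+ 2 * \int[nu]_x df x.
Proof.
move=> fd cdf fK dfK.
have cf : continuous f.
  move=> t; have [dt _] := fd t.
  exact/differentiable_continuous/derivable1_diffP.
have cp : continuous p by exact: continuous_normal_pdf.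
have mf : measurable_fun setT f by exact: continuous_measurable_fun.
have mdf : measurable_fun setT df by exact: continuous_measurable_fun.
have mp : measurable_fun setT p by exact: measurable_normal_pdf.
have Ip : intg mu setT p by exact: integrable_normal_pdf.
have Ixfp : intg mu setT (fun x => x * f x * p x).
  apply: (intg_le _ _ (intgZ _ K (integrable_norm intg_id_normal_pdf))) => //.
    by apply: measurable_funM => //; exact: measurable_funM.
  move=> x _ /=; rewrite mulrAC mulrC [leLHS]normrM.
  by rewrite ler_wpM2r.
have Idfp : intg mu setT (fun x => df x * p x).
  apply: (intg_le _ _ (intgZ _ K Ip)) => //; first exact: measurable_funM.
  move=> x _ /=; rewrite normrM [`|p x|]ger0_norm ?normal_pdf_ge0//.
  by rewrite ler_wpM2r// normal_pdf_ge0.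
rewrite !Rintegral_normal_prob//; last 2 first.
- by apply: intg_normal_prob.
- apply: intg_normal_prob => //; exact: measurable_funM.
(* The derivative of [f p], because [p' = - x p / s^2]; its integral over the line is the limit of
   the boundary terms. *)
pose g x := df x * p x - (x * f x * p x) / s ^+ 2.
have Ig : intg mu setT g.
  by apply: intgB => //; under eq_fun do rewrite mulrC; exact: intgZ.
suff : \int[mu]_x g x = 0.
  rewrite RintegralB//; last by under eq_fun do rewrite mulrC; exact: intgZ.
  rewrite RintegralZr// => /subr0_eq ->.
  by rewrite mulrC divfK// expf_neq0.
have cg : continuous g.
  move=> x; apply: cvgB; first by apply: cvgM; [exact: cdf|exact: cp].
  apply: cvgM; last exact: cvg_cst.
  by apply: cvgM; [apply: cvgM; [exact: cvg_id|exact: cf]|exact: cp].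
have FD (x : R) : is_derive x 1 (fun x => f x * p x) (g x).
  apply: (is_derive_ext (is_deriveM (fd x) (normal_pdf_is_derive x))) => //.
  by rewrite /g /GRing.scale/=; field.
have cF : continuous (fun x => f x * p x).
  by move=> x; apply: cvgM; [exact: cf|exact: cp].
have FTC k : \int[mu]_(x in `[- (k.+1%:R : R), k.+1%:R]) g x =
    (f k.+1%:R - f (- k.+1%:R)) * p k.+1%:R.
  have ab : - k.+1%:R < k.+1%:R :> R by rewrite gtrN.
  rewrite /Rintegral (@continuous_FTC2 _ g (fun x => f x * p x) _ _ ab)/=.
  - by rewrite normal_pdfN mulrBl.
  - exact: continuous_subspaceT.
  - split.
    + by move=> x _; case: (FD x).
    + by apply: cvg_at_right_filter; exact: cF.
    + by apply: cvg_at_left_filter; exact: cF.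
  - by move=> x _; rewrite derive1E; case: (FD x).
have lim1 := cvg_Rintegral_itvNn Ig.
have lim2 : (\int[mu]_(x in `[- (k.+1%:R : R), k.+1%:R]) g x) @[k --> \oo] --> (0 : R).
  under eq_fun do rewrite FTC.
  apply/norm_cvg0P.
  apply: (squeeze_cvgr (f := fun=> 0) (h := fun k => (K + K) * p k.+1%:R)).
  - near=> k; rewrite normr_ge0/= normrM [`|p _|]ger0_norm ?normal_pdf_ge0//.
    rewrite ler_wpM2r ?normal_pdf_ge0//.
    by rewrite (le_trans (ler_normB _ _))// lerD.
  - exact: cvg_cst.
  - rewrite -[X in _ --> X](mulr0 (K + K)); apply: cvgM; first exact: cvg_cst.
    by have := normal_pdf_cvg0; rewrite -(cvg_shiftS (fun k => p k%:R)).
exact: (cvg_unique _ lim1 lim2).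
Unshelve. all: by end_near. Qed.

End gaussian_integration_by_parts.

(** * Stein's identity for step integrals *)

Lemma cvg_sumr (R : realType) (T J : Type) (F : set_system T) (FF : Filter F)
    (s : seq J) (P : pred J) (u : J -> T -> R) (l : J -> R) :
  (forall j, P j -> u j k @[k --> F] --> l j) ->
  (\sum_(j <- s | P j) u j k) @[k --> F] --> \sum_(j <- s | P j) l j.
Proof.
move=> ul; elim: s => [|j s IHs].
  by under eq_fun do rewrite big_nil; rewrite big_nil; exact: cvg_cst.
under eq_fun do rewrite big_cons; rewrite big_cons.
by case: ifP => // Pj; apply: cvgD => //; exact: ul.
Qed.

Lemma continuous_sumr (R : realType) (T : topologicalType) (J : Type)
    (s : seq J) (P : pred J) (g : J -> T -> R) :
  (forall j, continuous (g j)) -> continuous (fun x => \sum_(j <- s | P j) g j x).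
Proof. by move=> cg x; apply: cvg_sumr => j _; exact: cg. Qed.

Lemma continuous_funM (R : realType) (T : topologicalType) (f g : T -> R) :
  continuous f -> continuous g -> continuous (fun x => f x * g x).
Proof. by move=> cf cg x; apply: cvgM; [exact: cf|exact: cg]. Qed.

Lemma continuous_funD (R : realType) (T : topologicalType) (f g : T -> R) :
  continuous f -> continuous g -> continuous (fun x => f x + g x).
Proof. by move=> cf cg x; apply: cvgD; [exact: cf|exact: cg]. Qed.

Lemma intg_bounded d (T : measurableType d) (R : realType) (P : probability T R)
    (g : T -> R) (B : R) : measurable_fun setT g -> (forall x, `|g x| <= B) ->
  intg P setT g.
Proof.
move=> mg gB; apply: (intg_le measurableT mg _ (fun x _ => gB x)).
by apply: intg_cst => //; rewrite (le_lt_trans (probability_le1 _ _))// ltry.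
Qed.

(** * Independence and product laws *)

Section independent_fubini.
Context {d d'} {Omega : measurableType d} {T' : measurableType d'} {R : realType}.
Variables (P : probability Omega R) (nu : probability (measurableTypeR R) R).
Variables (G : {mfun Omega >-> measurableTypeR R}) (Y : {mfun Omega >-> T'}).
Hypothesis nuE : forall A, measurable A -> P (G @^-1` A) = nu A.
Hypothesis GY : forall A B, measurable A -> measurable B ->
  P (G @^-1` A `&` Y @^-1` B) = (P (G @^-1` A) * P (Y @^-1` B))%E.

(** The joint law of [(Y, G)] is determined by rectangles, hence is a product measure, and Fubini
    applies. The target of [Y] is left arbitrary so that [Y] can be the identity of [Omega] with a
    coarser sigma-algebra on the target. *)
Lemma integral_independent (phi : T' * measurableTypeR R -> R) :
  measurable_fun setT phi -> intg P setT (fun w => phi (Y w, G w)) ->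
  (\int[P]_w (phi (Y w, G w))%:E =
   \int[P]_w (\int[nu]_x (phi (Y w, x))%:E))%E.
Proof.
move=> mphi Iphi.
have mYG : measurable_fun setT (fun w => (Y w, G w)) by exact: measurable_fun_pair.
pose YG : {mfun Omega >-> (T' * measurableTypeR R)%type} := mfun_Sub (mem_set mYG).
have mphiE : measurable_fun setT (EFin \o phi) by exact/measurable_EFinP.
pose YP : probability T' R := distribution P Y.
have E X : measurable X -> (YP \x nu)%E X = distribution P YG X.
  apply: product_measure_unique => A B mA mB.
  transitivity (P (G @^-1` B `&` Y @^-1` A)); first by rewrite setIC.
  by rewrite GY// nuE// muleC.
have I1 : (distribution P YG).-integrable setT (EFin \o phi).
  exact: (integrable_pushforward (mu := P) mYG mphiE Iphi).
have I2 : (YP \x nu)%E.-integrable setT (EFin \o phi).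
  case/integrableP : I1 => _ I1; apply/integrableP; split=> //.
  by rewrite (eq_measure_integral (distribution P YG))// => A mA _; exact: E.
have -> : (\int[P]_w (phi (Y w, G w))%:E = \int[distribution P YG]_z (phi z)%:E)%E.
  by rewrite (integral_distribution (X := YG) (f := EFin \o phi)).
transitivity (\int[(YP \x nu)%E]_z (EFin \o phi) z)%E.
  by apply: eq_measure_integral => A mA _; rewrite [RHS]E.
rewrite -(integral12_prod_meas1 I2).
have IF := integrable_fubini_F I2.
have mF : measurable_fun setT (fubini_F nu (EFin \o phi)) by exact: measurable_int IF.
rewrite (integral_distribution (X := Y) (f := fubini_F nu (EFin \o phi)))//.
case/integrableP : IF => _ IF; apply/integrableP; split; first exact: measurableT_comp.
rewrite (ge0_integral_distribution Y (f := abse \o fubini_F nu (EFin \o phi))) in IF => //.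
  exact: measurableT_comp.
by move=> y; exact: abse_ge0.
Qed.

End independent_fubini.

Section independent_complement.
Context {d} {Omega : measurableType d} {R : realType}.
Variables (P : probability Omega R) (I : finType) (G : I -> Omega -> R).
Hypothesis mG : forall i, measurable_fun setT (G i).
Hypothesis iG : mutually_independent P G.
Variable p : I.

(** A pi-system generating the sigma-algebra of all the variables other than [G p]. *)
Definition cylinders_except : set (set Omega) :=
  [set E | exists2 B : I -> set R, (forall i, measurable (B i)) &
    E = \bigcap_(i in [set i | i != p]) (G i @^-1` B i)].

Lemma measurable_cylinders_except : cylinders_except `<=` measurable.
Proof.
move=> E [B mB ->]; apply: fin_bigcap_measurable => [|i _].
  exact: finite_finset.
by rewrite -[X in measurable X]setTI; exact: mG.
Qed.

(** As functions of [E], both sides are finite measures; they agree on the pi-system of cylinders,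
    hence on the sigma-algebra it generates. *)
Lemma independent_cylinders_except (A : set R) (E : set Omega) :
  measurable A -> <<s cylinders_except >> E ->
  P (G p @^-1` A `&` E) = (P (G p @^-1` A) * P E)%E.
Proof.
move=> mA sE.
have mGA : measurable (G p @^-1` A).
  by rewrite -[X in measurable X]setTI; exact: mG.
have fP : P (G p @^-1` A) \is a fin_num by exact: fin_num_measure.
have f0 : 0 <= fine (P (G p @^-1` A)) by exact: fine_ge0.
have := @g_sigma_algebra_measure_unique _ R _ cylinders_except
  measurable_cylinders_except (fun=> setT) _ _ (mrestr P mGA)
  (mscale (NngNum f0) P) _ _ _ E sE.
rewrite /mrestr/= /mscale/= fineK// setIC; apply => //.
- move=> _; exists (fun=> setT) => //.
  by apply/seteqP; split.
- by rewrite bigcup_const.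
- move=> _ _ [B mB ->] [C mC ->]; exists (fun i => B i `&` C i).
    by move=> i; exact: measurableI.
  by rewrite -bigcapI.
- move=> _ [B mB ->].
  (* Putting [A] in position [p] allows the joint independence to be used twice, over all indices
     and over those other than [p]; the quotient of the two products is the factor of [G p]. *)
  pose B' i := if i == p then A else B i.
  have mB' i : measurable (B' i) by rewrite /B'; case: ifP.
  have H1 := iG [set: I]%SET mB'.
  have H2 := iG [set i | i != p]%SET mB'.
  rewrite /mrestr.
  have E1 : (\bigcap_(i in [set i | i != p]) (G i @^-1` B i)) `&` G p @^-1` A =
      \bigcap_(i in [set` [set: I]%SET]) G i @^-1` B' i.
    apply/seteqP; split => [w [Bw Aw] i _|w Bw].
      by rewrite /B' /=; case: eqVneq => [->//|ip]; exact: Bw.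
    split=> [i /= ip|].
      by have := Bw i; rewrite /B' /= (negbTE ip); apply; rewrite inE.
    by have := Bw p; rewrite /B' /= eqxx; apply; rewrite inE.
  rewrite E1 [LHS]H1 (bigD1 p)//= {1}/B' eqxx; congr (_ * _)%E.
  have -> : (\bigcap_(i in [set i | i != p]) (G i @^-1` B i)) =
      \bigcap_(i in [set` [set i | i != p]%SET]) G i @^-1` B' i.
    apply/seteqP; split => [w Bw i|w Bw i] /=.
      by rewrite inE => ip; rewrite /B' (negbTE ip); exact: Bw.
    by move=> ip; have := Bw i; rewrite /B' /= (negbTE ip); apply; rewrite inE.
  by rewrite [RHS]H2; apply: eq_bigl => i; rewrite !inE.
- by move=> _; rewrite /mrestr setTI (le_lt_trans (probability_le1 _ _))// ltry.
Qed.

End independent_complement.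

(* Stein's identity in one of the independent variables, along a line with
   direction [c]; the remaining variables only enter through [Y]. *)
Section stein_one_variable.
Context {d} {Omega : measurableType d} {R : realType}.
Variables (P : probability Omega R) (I : finType) (G : I -> Omega -> R).
Hypothesis mG : forall i, measurable_fun setT (G i).
Hypothesis iG : mutually_independent P G.
Variables (p : I) (s : R).
Hypothesis s0 : 0 < s.
Hypothesis Gp : forall A, measurable A -> P (G p @^-1` A) = normal_prob 0 s A.

Lemma intg_gaussian : intg P setT (G p).
Proof.
pose GG : {mfun Omega >-> measurableTypeR R} :=
  @mfun_Sub _ _ _ (measurableTypeR R) _ (mem_set (mG p)).
have := intg_id_normal_prob s0; rewrite /intg => I0.
apply/integrableP; split; first exact/measurable_EFinP.
have /integrableP[_] := I0; apply: le_lt_trans.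
rewrite -(ge0_integral_distribution GG (f := fun x : measurableTypeR R => `|x%:E|%E))//.
  rewrite (eq_measure_integral (distribution P GG))// => A mA _.
  exact/esym/Gp.
exact: measurableT_comp.
Qed.

Lemma Rintegral_gaussian_by_parts (m : nat) (f : 'rV[R]_m -> R) (c : 'rV[R]_m)
    (v : I -> 'rV[R]_m) (K : R) : C1 f ->
  (forall x, `|f x| <= K) -> (forall j x, `|partial j f x| <= K) ->
  let Z w := G p w *: c + \sum_(q | q != p) G q w *: v q in
  \int[P]_w (G p w * f (Z w)) =
  s ^+ 2 * \int[P]_w (\sum_j c 0 j * partial j f (Z w)).
Proof.
move=> C1f fK dfK Z.
have [cf _ cdf] := C1f.
(* [Omega] itself, with the sigma-algebra of the other variables, carries them all at once; [Y] is
   the identity map. *)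
pose T' := g_sigma_algebraType (cylinders_except G p).
have mid : measurable_fun setT (id : Omega -> T').
  move=> _ B mB; rewrite setTI preimage_id.
  move: B mB; apply: smallest_sub; first exact: sigma_algebra_measurable.
  exact: (measurable_cylinders_except mG).
pose Y : {mfun Omega >-> T'} := mfun_Sub (mem_set mid).
pose GG : {mfun Omega >-> measurableTypeR R} :=
  @mfun_Sub _ _ _ (measurableTypeR R) _ (mem_set (mG p)).
have indep (A : set (measurableTypeR R)) (B : set T') : measurable A ->
    measurable B -> P (GG @^-1` A `&` Y @^-1` B) = (P (GG @^-1` A) * P (Y @^-1` B))%E.
  by move=> mA mB; rewrite /= preimage_id; exact: independent_cylinders_except.
pose nu : probability (measurableTypeR R) R := normal_prob 0 s.
have nuE (A : set (measurableTypeR R)) : measurable A -> P (GG @^-1` A) = nu A.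
  exact: Gp.
pose y (w : T') := \sum_(q | q != p) G q w *: v q.
have my j : measurable_fun setT (fun w : T' => y w 0 j).
  rewrite (_ : (fun w => _) = fun w : T' => \sum_(q | q != p) G q w * v q 0 j); last first.
    by apply/funext => w; rewrite /y summxE; apply: eq_bigr => q _; rewrite mxE.
  rewrite (_ : (fun w => _) = fun w : T' => \sum_q if q != p then G q w * v q 0 j else 0); last first.
    by apply/funext => w; rewrite big_mkcond.
  suff hq q : measurable_fun setT (fun w : T' => if q != p then G q w * v q 0 j else 0).
    exact: measurable_sum hq.
  case: (boolP (q != p)) => qp; last exact: measurable_cst.
  apply: measurable_funM => // _ B mB; rewrite setTI.
  apply: sub_sigma_algebra; exists (fun i => if i == q then B else setT).
    by move=> i; case: ifP.
  apply/seteqP; split=> [w Bw i _|w /(_ q qp)]; last by rewrite eqxx.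
  by case: eqVneq => [->|].
have mZ j : measurable_fun setT (fun u : T' * measurableTypeR R => u.2 * c 0 j + y u.1 0 j).
  apply: measurable_funD.
    by apply: measurable_funM => //; exact: measurable_snd.
  exact: measurableT_comp (my j) measurable_fst.
have mcomp (g : 'rV[R]_m -> R) : continuous g ->
    measurable_fun setT (fun u : T' * measurableTypeR R => g (u.2 *: c + y u.1)).
  move=> cg; have := measurable_continuous_rV measurableT cg mZ.
  rewrite (_ : (fun w => _) = (fun u : T' * measurableTypeR R => g (u.2 *: c + y u.1)))//.
  by apply/funext => u; congr g; apply/rowP => j; rewrite !mxE.
have mZP (g : 'rV[R]_m -> R) : continuous g -> measurable_fun setT (g \o Z).
  move=> cg; exact: measurableT_comp (mcomp g cg) (measurable_fun_pair mid (mG p)).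
pose phi1 (u : T' * measurableTypeR R) := u.2 * f (u.2 *: c + y u.1).
pose df x := \sum_j c 0 j * partial j f x.
pose phi2 (u : T' * measurableTypeR R) := s ^+ 2 * df (u.2 *: c + y u.1).
have cdf' : continuous df.
  by apply: continuous_sumr => j; apply: continuous_funM => //; exact: cst_continuous.
have K0 : 0 <= K by rewrite (le_trans _ (fK 0)).
pose K' := \sum_j `|c 0 j| * K.
have dfK' x : `|df x| <= K'.
  rewrite (le_trans (ler_norm_sum _ _ _))//; apply: ler_sum => j _.
  by rewrite normrM ler_wpM2l.
have K'0 : 0 <= K' by rewrite (le_trans _ (dfK' 0)).
have mphi1 : measurable_fun setT phi1.
  by apply: measurable_funM; [exact: measurable_snd|exact: mcomp].
have mphi2 : measurable_fun setT phi2.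
  by apply: measurable_funM => //; exact: mcomp.
have I1 : intg P setT (fun w => phi1 (Y w, GG w)).
  apply: (intg_le _ _ (intgZ _ K (integrable_norm intg_gaussian))) => //.
    apply: measurable_funM; first exact: mG.
    exact: mZP cf.
  by move=> w _; rewrite /phi1/= normrM mulrC ler_wpM2r.
have IdfZ : intg P setT (df \o Z).
  exact: (intg_bounded _ (mZP df cdf') (fun w => dfK' (Z w))).
have I2 : intg P setT (fun w => phi2 (Y w, GG w)) by exact: intgZ.
(* Once the other variables are frozen at [w], what remains is the one-dimensional integration by
   parts along the line of direction [c]. *)
suff inner w : (\int[nu]_x (phi1 (w, x))%:E = \int[nu]_x (phi2 (w, x))%:E)%E.
  rewrite -RintegralZl// /Rintegral; congr fine.
  rewrite [LHS](integral_independent nuE indep mphi1 I1).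
  rewrite [RHS](integral_independent nuE indep mphi2 I2).
  by apply: eq_integral => w _.
have fd (t : R) : is_derive t 1 (fun t => f (t *: c + y w)) (df (t *: c + y w)).
  under eq_fun do rewrite addrC; rewrite addrC; exact: C1_is_derive_line.
have line_cont (g : 'rV[R]_m -> R) : continuous g -> continuous (fun t : R => g (t *: c + y w)).
  move=> cg t; apply: (cvg_comp (fun t => t *: c + y w) g); last exact: cg.
  by under eq_fun do rewrite addrC; rewrite addrC; exact: continuous_line.
have clf := line_cont f cf.
have cldf := line_cont df cdf'.
have IBP : \int[nu]_x (x * f (x *: c + y w)) = s ^+ 2 * \int[nu]_x df (x *: c + y w).
  apply: (@Rintegral_normal_prob_by_parts _ s s0 _ _ (K + K')) => // t.
    by rewrite (le_trans (fK _))// lerDl.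
  by rewrite (le_trans (dfK' _))// lerDr.
have mclf : measurable_fun setT (fun t : measurableTypeR R => f (t *: c + y w)).
  exact: continuous_measurable_fun.
have mcldf : measurable_fun setT (fun t : measurableTypeR R => df (t *: c + y w)).
  exact: continuous_measurable_fun.
have Inu1 : intg nu setT (fun t => phi1 (w, t)).
  apply: (intg_le _ _ (intgZ _ K (integrable_norm (intg_id_normal_prob s0)))) => //.
    by apply: measurable_funM => //; exact: measurable_id.
  by move=> t _; rewrite /phi1/= normrM mulrC ler_wpM2r.
have Inu0 : intg nu setT (fun t => df (t *: c + y w)).
  exact: (intg_bounded _ mcldf).
have Inu2 : intg nu setT (fun t => phi2 (w, t)) by exact: intgZ.
rewrite -!EFin_Rintegral//; congr EFin.
by rewrite /phi2/= RintegralZl.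
Qed.

End stein_one_variable.

Section stein_linear.
Context {d} {Omega : measurableType d} {R : realType}.
Variables (P : probability Omega R) (I : finType) (G : I -> Omega -> R).
Variable sg : I -> R.
Hypothesis mG : forall i, measurable_fun setT (G i).
Hypothesis iG : mutually_independent P G.
Hypothesis sg_ge0 : forall p, 0 <= sg p.
Hypothesis G0 : forall p, sg p = 0 -> forall w, G p w = 0.
Hypothesis Gn : forall p, 0 < sg p -> forall A, measurable A ->
  P (G p @^-1` A) = normal_prob 0 (sg p) A.
Variables (m : nat) (c : I -> 'rV[R]_m).

Let Z w := \sum_p G p w *: c p.

Lemma measurable_linear j : measurable_fun setT (fun w => Z w 0 j).
Proof.
rewrite (_ : (fun w => _) = fun w => \sum_p G p w * c p 0 j); last first.
  by apply/funext => w; rewrite /Z summxE; apply: eq_bigr => q _; rewrite mxE.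
by apply: measurable_sum => p; exact: measurable_funM.
Qed.

(** The factor [Z w 0 a] is expanded over the independent variables, and each [G p] is integrated by
    parts along its own direction [c p]. The coefficients collect into the covariance matrix of
    [Z]. *)
Lemma stein_linear (f : 'rV[R]_m -> R) (K : R) : C1 f ->
  (forall x, `|f x| <= K) -> (forall j x, `|partial j f x| <= K) ->
  forall a, \int[P]_w (Z w 0 a * f (Z w)) =
    \sum_b (\sum_p sg p ^+ 2 * c p 0 a * c p 0 b) * \int[P]_w (partial b f (Z w)).
Proof.
move=> C1f fK dfK a.
have [cf _ cdf] := C1f.
have mZf (g : 'rV[R]_m -> R) : continuous g -> measurable_fun setT (g \o Z).
  move=> cg; have := measurable_continuous_rV measurableT cg measurable_linear.
  by congr measurable_fun; apply/funext => w; congr g; apply/rowP => j; rewrite mxE.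
have IdfZ b : intg P setT (fun w => partial b f (Z w)).
  exact: (intg_bounded _ (mZf _ (cdf b)) (fun w => dfK b (Z w))).
have key p : intg P setT (fun w => G p w * f (Z w)) /\
    \int[P]_w (G p w * f (Z w)) =
    sg p ^+ 2 * \sum_b c p 0 b * \int[P]_w (partial b f (Z w)).
  (* A variable of zero deviation vanishes identically, and both sides are 0; such variables come
     from repeated grid points. *)
  have := sg_ge0 p; rewrite le_eqVlt => /predU1P[sp0|sp].
    have E : (fun w => G p w * f (Z w)) = fun=> 0.
      by apply/funext => w; rewrite G0 ?mul0r.
    rewrite E -sp0 expr0n/= mul0r Rintegral_cst// mul0r; split=> //.
    by apply: (intg_bounded _ (B := 0)) => // w; rewrite normr0.
  split.
    apply: (intg_le _ _ (intgZ _ K (integrable_norm (intg_gaussian mG sp (Gn sp))))) => //.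
      by apply: measurable_funM => //; exact: mZf.
    by move=> w _ /=; rewrite normrM mulrC ler_wpM2r.
  have E w : Z w = G p w *: c p + \sum_(q | q != p) G q w *: c q.
    by rewrite /Z (bigD1 p).
  have := Rintegral_gaussian_by_parts mG iG sp (Gn sp) (c p) c C1f fK dfK.
  move=> /= H; under eq_Rintegral do rewrite E; rewrite H; congr (_ * _).
  under eq_Rintegral do rewrite -E.
  rewrite Rintegral_sum//; last by move=> b _; exact: intgZ.
  by apply: eq_bigr => b _; rewrite RintegralZl//; exact: IdfZ.
transitivity (\int[P]_w (\sum_p c p 0 a * (G p w * f (Z w)))).
  apply: eq_Rintegral => w _; rewrite {1}/Z summxE mulr_suml.
  by apply: eq_bigr => p _; rewrite mxE; ring.
rewrite Rintegral_sum//; last by move=> p _; apply: intgZ => //; case: (key p).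
under eq_bigr => p _.
  rewrite RintegralZl//; last by case: (key p).
  rewrite (key p).2 !mulr_sumr; over.
rewrite exchange_big/=; apply: eq_bigr => b _; rewrite mulr_suml.
by apply: eq_bigr => p _; ring.
Qed.

End stein_linear.

(** * Step functions and step integrals on a common time grid *)

Definition dot (R : realType) (n : nat) (u v : 'rV[R]_n) : R :=
  \sum_(i < n) u 0 i * v 0 i.

Section grid.
Context {R : realType}.
Variables (T : R) (n : nat).
Hypothesis T0 : 0 <= T.

Lemma exists_grid (E : seq R) : (forall x, x \in E -> 0 <= x <= T) ->
  exists (t : nat -> R) (M : nat), [/\ forall k, t k \in `[0, T],
    nondecreasing_seq t & forall x, x \in E -> exists2 k, (k <= M)%N & t k = x].
Proof.
move=> ET; pose r := sort <=%R E.
have rT x : x \in r -> 0 <= x <= T by rewrite mem_sort; exact: ET.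
(* The default value [T] prolongs the sorted list into an infinite nondecreasing sequence in
   [[0, T]], the shape that [bm_independent] expects. *)
exists (nth T r), (size r); split.
- move=> k; rewrite in_itv/=; have [kr|kr] := ltnP k (size r).
    by apply: rT; exact: mem_nth.
  by rewrite nth_default// T0 lexx.
- move=> k l kl; have [lr|lr] := ltnP l (size r); last first.
    rewrite (nth_default _ lr); have [kr|kr] := ltnP k (size r).
      by have /andP[] := rT _ (mem_nth T kr).
    by rewrite nth_default.
  apply: (sorted_leq_nth (@le_trans _ R) (@lexx _ R)) => //.
  + exact: (sort_sorted (@le_total _ R)).
  + by rewrite inE (leq_ltn_trans kl).
- move=> x xE; exists (index x r); first by rewrite index_size.
  by rewrite nth_index// mem_sort.
Qed.

Variables (t : nat -> R) (M : nat).
Hypothesis tT : forall k, t k \in `[0, T].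
Hypothesis tnd : nondecreasing_seq t.

Lemma mem_grid_step (l : nat) (x : R) (j : nat) :
  x \in `]t l, t l.+1] -> x \in `]t j, t j.+1] -> l = j.
Proof.
rewrite !in_itv/= => /andP[a b] /andP[c e].
have [lj|jl|//] := ltngtP l j.
  by have := tnd lj; rewrite leNgt (lt_le_trans c b).
by have := tnd jl; rewrite leNgt (lt_le_trans a e).
Qed.

(** The half-open cells are disjoint, so at most one term of each sum survives at [tau] and there
    are no cross terms. *)
Lemma sum_grid_mul (u v : 'I_M -> R) (tau : R) :
  (\sum_(l < M) (if tau \in `]t l, t l.+1] then u l else 0)) *
  (\sum_(l < M) (if tau \in `]t l, t l.+1] then v l else 0)) =
  \sum_(l < M) (if tau \in `]t l, t l.+1] then u l * v l else 0).
Proof.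
have [/existsP[l0 hl0]|/existsPn h] := boolP [exists l : 'I_M, tau \in `]t l, t l.+1]].
  have E (w : 'I_M -> R) : \sum_(l < M) (if tau \in `]t l, t l.+1] then w l else 0) = w l0.
    rewrite (bigD1 l0)//= hl0 big1 ?addr0// => l ll0; case: ifPn => // hl.
    by have /val_inj ll := mem_grid_step hl hl0; rewrite ll eqxx in ll0.
  by rewrite !E.
have E (w : 'I_M -> R) : \sum_(l < M) (if tau \in `]t l, t l.+1] then w l else 0) = 0.
  by rewrite big1// => l _; rewrite (negbTE (h l)).
by rewrite !E mulr0.
Qed.

Lemma sum_ord_itv (V : nmodType) (F : nat -> V) (al be : nat) : (be <= M)%N ->
  \sum_(l < M) (if (al <= l < be)%N then F l else 0) = \sum_(al <= l < be) F l.
Proof.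
move=> bM; rewrite (big_nat_widenl al 0)// (big_nat_widen _ _ M)// big_mkcond big_mkord.
by apply: eq_bigr => l _; rewrite andTb.
Qed.

Lemma sum_grid_indic (V : nmodType) (v : V) (tau : R) (al be : nat) : (al <= be)%N ->
  \sum_(al <= l < be) (if tau \in `]t l, t l.+1] then v else 0) =
  if tau \in `]t al, t be] then v else 0.
Proof.
elim: be => [|be IHbe].
  by rewrite leqn0 => /eqP ->; rewrite big_geq// in_itv/= ltNge andNb.
rewrite leq_eqVlt => /predU1P[->|]; first by rewrite big_geq// in_itv/= ltNge andNb.
rewrite ltnS => ab; rewrite big_nat_recr//= IHbe// !in_itv/=.
have h1 := tnd ab; have h2 := tnd (leqnSn be).
have [tb|bt] := leP tau (t be).
  by rewrite andbT andFb addr0 (le_trans tb h2) andbT.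
by rewrite andbF add0r (le_lt_trans h1 bt).
Qed.

(* A triple of [step_in] adapted to the grid is carried by the indices in
   [al, be[ *)
Definition adapted (x : R * R * 'rV[R]_n) := exists al be : nat,
  [/\ (al <= be)%N, (be <= M)%N, t al = x.1.1 & t be = x.1.2].

(** One family of coefficients has to represent both the step function and its stochastic integral:
    this links the covariances of the integrals to the L^2 inner products of the functions. An
    interval splits into the cells between its two indices, and the increments of [W] telescope. *)
Lemma adapted_coef (s : seq (R * R * 'rV[R]_n)) : (forall x, x \in s -> adapted x) ->
  exists c : 'I_M -> 'rV[R]_n,
    (forall tau, step_fun s tau =
       \sum_(l < M) (if tau \in `]t l, t l.+1] then c l else 0)) /\
    (forall (Omega : Type) (W : R -> Omega -> 'rV[R]_n) (w : Omega),
       step_integral W s w =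
       \sum_(l < M) \sum_(i < n) c l 0 i * (W (t l.+1) w 0 i - W (t l) w 0 i)).
Proof.
elim: s => [|x s IHs] sa.
  exists (fun=> 0); split=> [tau|Omega W w].
    by rewrite /step_fun big_nil big1// => l _; rewrite if_same.
  rewrite /step_integral big_nil big1// => l _.
  by rewrite big1// => i _; rewrite mxE mul0r.
have [c [cf cW]] := IHs (fun y ys => sa y (mem_behead (s := x :: s) ys)).
have [al [be [ab bM tal tbe]]] := sa x (mem_head _ _).
exists (fun l : 'I_M => (if (al <= l < be)%N then x.2 else 0) + c l); split=> [tau|Omega W w].
  rewrite /step_fun big_cons -/(step_fun s tau) cf.
  rewrite [in RHS](eq_bigr (fun l : 'I_M =>
    (if (tau \in `]t l, t l.+1]) && (al <= l < be)%N then x.2 else 0) +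
    (if tau \in `]t l, t l.+1] then c l else 0))); last first.
    by move=> l _; case: ifP => //=; rewrite ?addr0.
  rewrite big_split/=; congr (_ + _).
  rewrite -tal -tbe -(sum_grid_indic _ _ ab) -(sum_ord_itv _ _ bM).
  by apply: eq_bigr => l _; case: (al <= l < be)%N; rewrite ?andbT ?andbF.
rewrite /step_integral big_cons -/(step_integral W s w) cW.
rewrite [RHS](eq_bigr (fun l : 'I_M =>
  (if (al <= l < be)%N then \sum_(i < n) x.2 0 i * (W (t l.+1) w 0 i - W (t l) w 0 i) else 0) +
  \sum_(i < n) c l 0 i * (W (t l.+1) w 0 i - W (t l) w 0 i))); last first.
  move=> l _; case: ifP => _; rewrite ?add0r// -big_split/=.
  by apply: eq_bigr => i _; rewrite mxE mulrDl.
rewrite big_split/=; congr (_ + _).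
rewrite (sum_ord_itv (fun l => \sum_(i < n) x.2 0 i * (W (t l.+1) w 0 i - W (t l) w 0 i)))//.
rewrite exchange_big/=; apply: eq_bigr => i _.
rewrite -mulr_sumr (telescope_sumr (fun l => W (t l) w 0 i))//.
by rewrite tal tbe.
Qed.

End grid.

Section stein_step_integral.
Context {d} {Omega : measurableType d} {R : realType}.
Variables (P : probability Omega R) (T : R) (n : nat).
Variable W : R -> Omega -> 'rV[R]_n.
Hypotheses (T_gt0 : 0 < T) (W_bm : brownian_motion P T W).
Local Notation mu := (@lebesgue_measure R).

Lemma Rintegral_grid_indic (a b : R) : 0 <= a -> a <= b -> b <= T ->
  \int[mu]_(x in `[0, T]) (if x \in `]a, b] then 1 else 0) = b - a.
Proof.
move=> a0 ab bT; rewrite /Rintegral.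
transitivity (fine (\int[mu]_(x in `[0, T]) (\1_(`]a, b] : set R) x)%:E)).
  congr fine; apply: eq_integral => x _; rewrite indicE mem_setE.
  by case: (x \in _).
rewrite integral_indic//.
rewrite setIidl; last first.
  move=> x /=; rewrite !in_itv/= => /andP[ax xb].
  by rewrite (le_trans a0 (ltW ax)) (le_trans xb bT).
have := lebesgue_measure_itv `]a, b]; rewrite /= lte_fin => ->.
case: ltP => // ba.
by have -> : b = a by [apply/eqP; rewrite eq_le ba]; rewrite subrr.
Qed.

Lemma intg_grid_indic (a b c : R) :
  intg mu `[0, T] (fun x => if x \in `]a, b] then c else 0).
Proof.
apply: (@intg_le _ _ _ mu `[0, T]%classic (measurable_itv _) _ (fun=> `|c|)).
- rewrite (_ : (fun x => _) = fun x => c * \1_(`]a, b] : set R) x); last first.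
    apply/funext => x; rewrite indicE mem_setE.
    by case: (x \in _); rewrite ?mulr1 ?mulr0.
  by apply: measurable_funM => //; exact: measurable_indic.
- apply: intg_cst; first exact: measurable_itv.
  by have := lebesgue_measure_itv `[0, T]; rewrite /= lte_fin T_gt0 => ->; rewrite ltry.
- by move=> x _; case: ifP => // _; rewrite normr0.
Qed.

Lemma Rintegral_grid_indicM (a b c : R) : 0 <= a -> a <= b -> b <= T ->
  \int[mu]_(x in `[0, T]) (if x \in `]a, b] then c else 0) = c * (b - a).
Proof.
move=> a0 ab bT; rewrite -(Rintegral_grid_indic a0 ab bT) -RintegralZl//.
- by apply: eq_Rintegral => x _; case: ifP; rewrite ?mulr1 ?mulr0.
- exact: intg_grid_indic.
Qed.

(** On the grid of all endpoints, every step integral is a linear combination of the same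
    independent Gaussian increments, so [stein_linear] applies. The variances are the cell lengths,
    which turns the covariance matrix into the matrix of integrals of [dot]. *)
Lemma stein_step_integral (m : nat) (s : 'I_m -> seq (R * R * 'rV[R]_n))
    (f : 'rV[R]_m -> R) (K : R) :
  (forall j, step_in T (s j)) -> C1 f ->
  (forall x, `|f x| <= K) -> (forall j x, `|partial j f x| <= K) ->
  let Z w := \row_j step_integral W (s j) w in
  forall a, \int[P]_w (Z w 0 a * f (Z w)) =
    \sum_b (\int[mu]_(t in `[0, T]) dot (step_fun (s a) t) (step_fun (s b) t)) *
            \int[P]_w (partial b f (Z w)).
Proof.
move=> sT C1f fK dfK Z a.
pose E := flatten [seq flatten [seq [:: x.1.1; x.1.2] | x <- s j] | j <- enum 'I_m].
have ET x : x \in E -> 0 <= x <= T.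
  move=> /flattenP[_ /mapP[j _ ->]] /flattenP[_ /mapP[y ys ->]].
  have /and3P[h1 h2 h3] := sT j y ys.
  by rewrite !inE => /predU1P[->|/eqP ->]; apply/andP; split=> //;
    [exact: le_trans h2 h3|exact: le_trans h1 h2].
have [t [M [tT tnd tE]]] := exists_grid (ltW T_gt0) ET.
have /choice[c cs] j : exists c : 'I_M -> 'rV[R]_n,
    (forall tau, step_fun (s j) tau =
       \sum_(l < M) (if tau \in `]t l, t l.+1] then c l else 0)) /\
    (forall (Omega : Type) (W : R -> Omega -> 'rV[R]_n) (w : Omega),
       step_integral W (s j) w =
       \sum_(l < M) \sum_(i < n) c l 0 i * (W (t l.+1) w 0 i - W (t l) w 0 i)).
  apply: (adapted_coef tnd) => x xs.
  have xE y : y \in [:: x.1.1; x.1.2] -> y \in E.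
    move=> yx; apply/flattenP; exists (flatten [seq [:: x.1.1; x.1.2] | x <- s j]).
      by apply/mapP; exists j => //; rewrite mem_enum.
    by apply/flattenP; exists [:: x.1.1; x.1.2] => //; apply/mapP; exists x.
  have [k1 k1M tk1] := tE _ (xE x.1.1 (mem_head _ _)).
  have [k2 k2M tk2] := tE _ (xE x.1.2 (mem_last x.1.1 [:: x.1.2])).
  have /and3P[_ x12 _] := sT j x xs.
  (* The grid may list a point several times, so the indices can come in the wrong order; the two
     endpoints are then equal and the empty range [k1, k1] represents the interval. *)
  have [k12|k21] := leqP k1 k2; first by exists k1, k2.
  exists k1, k1; split=> //; rewrite tk1; apply/eqP; rewrite eq_le x12/=.
  by rewrite -tk1 -tk2 tnd// ltnW.
pose G (p : 'I_M * 'I_n) w := W (t p.1.+1) w 0 p.2 - W (t p.1) w 0 p.2.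
pose sg (p : 'I_M * 'I_n) := Num.sqrt (t p.1.+1 - t p.1).
pose C (p : 'I_M * 'I_n) : 'rV[R]_m := \row_j c j p.1 0 p.2.
have tS k : 0 <= t k.+1 - t k by rewrite subr_ge0 tnd.
have mG p : measurable_fun setT (G p).
  by apply: measurable_funB; apply: (bm_measurable W_bm).
have iG : mutually_independent P G by exact: (bm_independent W_bm).
have G0 p : sg p = 0 -> forall w, G p w = 0.
  move=> /eqP; rewrite sqrtr_eq0 => h w.
  have tt : t p.1.+1 = t p.1.
    by apply/eqP; rewrite -subr_eq0 eq_le h tS.
  by rewrite /G tt subrr.
have Gn p : 0 < sg p -> forall A, measurable A -> P (G p @^-1` A) = normal_prob 0 (sg p) A.
  rewrite sqrtr_gt0 subr_gt0 => h A mA; rewrite -(bm_gaussian W_bm p.2)//.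
  - by have := tT p.1; rewrite in_itv/= => /andP[].
  - by have := tT p.1.+1; rewrite in_itv/= => /andP[].
have ZE w : Z w = \sum_p G p w *: C p.
  apply/rowP => j; rewrite mxE (cs j).2 summxE pair_big/=.
  by apply: eq_bigr => -[l i] _; rewrite !mxE mulrC.
have H := stein_linear mG iG (fun p => sqrtr_ge0 _) G0 Gn C C1f fK dfK a.
transitivity (\int[P]_w ((\sum_p G p w *: C p) 0 a * f (\sum_p G p w *: C p))).
  by apply: eq_Rintegral => w _; rewrite -ZE.
rewrite {}H.
apply: eq_bigr => b _.
have -> : \int[P]_w partial b f (\sum_p G p w *: C p) = \int[P]_w partial b f (Z w).
  by apply: eq_Rintegral => w _; rewrite -ZE.
congr (_ * _).
have coordE j tau i : step_fun (s j) tau 0 i =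
    \sum_(l < M) (if tau \in `]t l, t l.+1] then c j l 0 i else 0).
  rewrite (cs j).1 summxE; apply: eq_bigr => l _.
  by case: ifP => // _; rewrite mxE.
have dotE tau : dot (step_fun (s a) tau) (step_fun (s b) tau) =
    \sum_(p : 'I_M * 'I_n) (if tau \in `]t p.1, t p.1.+1] then c a p.1 0 p.2 * c b p.1 0 p.2 else 0).
  rewrite /dot -(pair_bigA _ (fun (l : 'I_M) i => if tau \in `]t l, t l.+1] then c a l 0 i * c b l 0 i else 0))/=.
  rewrite exchange_big/=; apply: eq_bigr => i _.
  by rewrite !coordE (sum_grid_mul tnd).
under [RHS]eq_Rintegral do rewrite dotE.
rewrite Rintegral_sum; [|exact: measurable_itv|]; last first.
  by move=> p _; exact: intg_grid_indic.
apply: eq_bigr => p _; rewrite Rintegral_grid_indicM ?tnd//.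
- by rewrite /sg sqr_sqrtr// !mxE; ring.
- by have := tT p.1; rewrite in_itv/= => /andP[].
- by have := tT p.1.+1; rewrite in_itv/= => /andP[].
Qed.

End stein_step_integral.

(** * Squashing functions and moments *)

Section sigmoid.
Context {R : realType}.
Implicit Types (c x y : R).

Definition sigm x : R := (1 + expR (- x))^-1.

Lemma sigm_gt0 x : 0 < sigm x.
Proof. by rewrite invr_gt0 addr_gt0// expR_gt0. Qed.

Lemma sigm_lt1 x : sigm x < 1.
Proof. by rewrite invf_lt1 ?addr_gt0 ?expR_gt0// ltrDl expR_gt0. Qed.

Lemma is_derive_sigm x : is_derive x 1 sigm (sigm x * (1 - sigm x)).
Proof.
have e0 : 1 + expR (- x) != 0 by rewrite gt_eqF// addr_gt0 ?expR_gt0.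
have D1 : is_derive x 1 (fun y => 1 + expR (- y)) (- expR (- x)).
  have h := @is_derive1_comp R expR (fun y => - y) x _ _ (is_derive_expR _)
    (is_deriveNid x (1 : R)).
  apply: (is_derive_ext (is_deriveD (is_derive_cst (1 : R) x (1 : R)) h)) => //.
  by rewrite add0r mulrN1.
apply: (is_derive_ext (@is_deriveV R (fun y => 1 + expR (- y)) x _ _ e0 D1)) => //.
by rewrite /sigm /GRing.scale/=; field.
Qed.

(* [psi c x = c tanh (x / c)] squashes the line onto ]-c, c[ *)
Definition psi c x := c * (2 * sigm (2 * x / c) - 1).

Definition dpsi c x := 4 * (sigm (2 * x / c) * (1 - sigm (2 * x / c))).

Lemma is_derive_psi c x : 0 < c -> is_derive x 1 (psi c) (dpsi c x).
Proof.
move=> c0; have cn0 : c != 0 by rewrite gt_eqF.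
have D1 : is_derive x 1 (fun y => 2 * y / c) (2 / c).
  apply: (is_derive_ext (is_deriveZ (2 / c) (is_derive_id x (1 : R)))).
    by move=> y /=; rewrite /GRing.scale/= mulrAC.
  by rewrite /GRing.scale/= mulr1.
have D2 := @is_derive1_comp R sigm (fun y => 2 * y / c) x _ _ (is_derive_sigm _) D1.
have D3 := is_deriveB (is_deriveZ 2 D2) (is_derive_cst (1 : R) x (1 : R)).
apply: (is_derive_ext (is_deriveZ c D3)) => //.
by rewrite /dpsi /GRing.scale/=; field.
Qed.

(** The equation [tanh' = 1 - tanh^2], rescaled by [c]. *)
Lemma dpsiE c x : 0 < c -> dpsi c x = 1 - (psi c x / c) ^+ 2.
Proof. by move=> c0; rewrite /dpsi /psi; field; rewrite gt_eqF. Qed.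

Lemma psi0 c : psi c 0 = 0.
Proof.
by rewrite /psi mulr0 mul0r /sigm oppr0 expR0 -[X in X^-1]/(2%:R) divff// subrr mulr0.
Qed.

Lemma normr_psi_lt c x : 0 < c -> `|psi c x| < c.
Proof.
move=> c0; rewrite /psi normrM gtr0_norm// gtr_pMr// ltr_norml.
by have := sigm_gt0 (2 * x / c); have := sigm_lt1 (2 * x / c) => *; apply/andP; split; lra.
Qed.

Lemma dpsi_ge0 c x : 0 <= dpsi c x.
Proof.
rewrite mulr_ge0// mulr_ge0// ?subr_ge0; first exact: ltW (sigm_gt0 _).
exact: ltW (sigm_lt1 _).
Qed.

Lemma dpsi_le1 c x : 0 < c -> dpsi c x <= 1.
Proof. by move=> c0; rewrite dpsiE// lerBlDr lerDl sqr_ge0. Qed.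

Lemma psi_lip c x y : 0 < c -> `|psi c x - psi c y| <= `|x - y|.
Proof.
move=> c0; have [z _ ->] := MVT_between y x (fun t => is_derive_psi t c0).
by rewrite normrM ger0_norm ?dpsi_ge0// ler_piMl// dpsi_le1.
Qed.

Lemma normr_psi_le c x : 0 < c -> `|psi c x| <= `|x|.
Proof. by move=> c0; have := psi_lip x 0 c0; rewrite psi0 !subr0. Qed.

(** By the mean value theorem [psi c x = l x] with [0 <= l <= 1]. In a moment of [psi c X] this
    frees one factor [X], on which Stein's identity can act. *)
Lemma sqr_psi_le c x : 0 < c -> psi c x ^+ 2 <= x * psi c x.
Proof.
move=> c0; have [z _] := MVT_between 0 x (fun t => is_derive_psi t c0).
rewrite psi0 !subr0 => ->; have := dpsi_ge0 c z; have := dpsi_le1 z c0.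
set l := dpsi c z => l1 l0.
have -> : x * (l * x) = l * x ^+ 2 by ring.
by rewrite exprMn ler_wpM2r ?sqr_ge0// expr2 ler_piMl.
Qed.

(** The error is [1 - dpsi c z] times [x], with [z] between 0 and [x], and
    [1 - dpsi c z = (psi c z / c)^2] is at most [(x / c)^2]. *)
Lemma psi_approx c x : 0 < c -> `|x - psi c x| <= `|x| ^+ 3 / c ^+ 2.
Proof.
move=> c0; have [z zx] := MVT_between 0 x (fun t => is_derive_psi t c0).
rewrite psi0 !subr0 => ->; have {}zx := ler_norm_between zx.
have := normr_psi_le z c0; rewrite dpsiE//; move: (psi c z) => q qz.
have -> : x - (1 - (q / c) ^+ 2) * x = q ^+ 2 * (x / c ^+ 2).
  by field; rewrite gt_eqF.
rewrite !normrM normfV [`|c ^+ 2|]ger0_norm ?sqr_ge0// mulrA ler_wpM2r ?invr_ge0 ?sqr_ge0//.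
have qx := le_trans qz zx.
by rewrite exprSr ler_wpM2r// expr2 ler_pM.
Qed.

Lemma cvg_psi x : psi k.+1%:R x @[k --> \oo] --> x.
Proof.
apply/subr_cvg0/norm_cvg0P.
apply: (squeeze_cvgr (f := fun=> 0) (h := fun k => `|x| ^+ 3 * k.+1%:R^-1)).
- near=> k; rewrite normr_ge0/= distrC (le_trans (psi_approx _ _))//.
  rewrite ler_wpM2l ?exprn_ge0// lef_pV2 ?posrE ?exprn_gt0//.
  by rewrite expr2 ler_peMl// ler1n.
- exact: cvg_cst.
- rewrite -[X in _ --> X](mulr0 (`|x| ^+ 3)); apply: cvgM; first exact: cvg_cst.
  exact: cvg_harmonic.
Unshelve. all: by end_near. Qed.

Lemma continuous_sigm : continuous sigm.
Proof.
move=> x; have [dx _] := is_derive_sigm x.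
exact/differentiable_continuous/derivable1_diffP.
Qed.

Lemma continuous_psi c : 0 < c -> continuous (psi c).
Proof.
move=> c0 x; have [dx _] := is_derive_psi x c0.
exact/differentiable_continuous/derivable1_diffP.
Qed.

Lemma continuous_dpsi c : 0 < c -> continuous (dpsi c).
Proof.
move=> c0; rewrite (_ : dpsi c = fun x => 1 - (psi c x / c) * (psi c x / c)).
  have ch : continuous (fun x => psi c x / c).
    by apply: continuous_funM; [exact: continuous_psi|exact: cst_continuous].
  move=> x; apply: cvgB; first exact: cvg_cst.
  by apply: cvgM; exact: ch.
by apply/funext => x; rewrite dpsiE.
Qed.

End sigmoid.

(** * Random variables with moments of all orders *)

Section moments.
Context {d} {Omega : measurableType d} {R : realType}.
Variable P : probability Omega R.
Implicit Types f g : Omega -> R.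

(** Unlike [sqint], this class is stable under products, which the products of Wiener integrals and
    smooth functions require. *)
Definition all_moments f :=
  measurable_fun setT f /\ forall p : nat, intg P setT (fun w => `|f w| ^+ p).

Lemma all_moments_le f g : measurable_fun setT f -> all_moments g ->
  (forall w, `|f w| <= `|g w|) -> all_moments f.
Proof.
move=> mf [mg ig] fg; split=> // p; apply: (intg_le _ _ (ig p)) => //.
  by apply: measurable_funX; exact: measurableT_comp.
by move=> w _; rewrite normrX normr_id lerXn2r ?nnegrE.
Qed.

Lemma all_moments_bounded f B : measurable_fun setT f ->
  (forall w, `|f w| <= B) -> all_moments f.
Proof.
move=> mf fB; split=> // p; apply: (intg_bounded _ (B := B ^+ p)).
  by apply: measurable_funX; exact: measurableT_comp.
move=> w; rewrite normrX normr_id lerXn2r ?nnegrE//.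
by rewrite (le_trans _ (fB w)).
Qed.

Lemma all_moments_cst c : all_moments (fun=> c).
Proof. exact: (@all_moments_bounded _ `|c|). Qed.

Lemma all_momentsD f g : all_moments f -> all_moments g ->
  all_moments (fun w => f w + g w).
Proof.
move=> [mf If] [mg Ig]; have mfg : measurable_fun setT (fun w => f w + g w).
  exact: measurable_funD.
split=> // p; apply: (intg_le _ _ (intgZ _ (2 ^+ p) (intgD _ (If p) (Ig p)))) => //.
  by apply: measurable_funX; exact: measurableT_comp.
move=> w _; rewrite normrX normr_id; set a := `|f w|; set b := `|g w|.
have ab : `|f w + g w| <= 2 * Num.max a b.
  rewrite (le_trans (ler_normD _ _))// mulr_natl mulr2n lerD// le_max lexx ?orbT//.
have m0 : 0 <= Num.max a b by rewrite le_max normr_ge0.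
apply: (@le_trans _ _ ((2 * Num.max a b) ^+ p)).
  by rewrite lerXn2r ?nnegrE// mulr_ge0.
rewrite exprMn ler_wpM2l ?exprn_ge0//.
have a0 : 0 <= a ^+ p by rewrite exprn_ge0// normr_ge0.
have b0 : 0 <= b ^+ p by rewrite exprn_ge0// normr_ge0.
by rewrite maxEle; case: ifP => _; rewrite ?lerDr ?lerDl.
Qed.

Lemma all_momentsM f g : all_moments f -> all_moments g ->
  all_moments (fun w => f w * g w).
Proof.
move=> [mf If] [mg Ig]; have mfg : measurable_fun setT (fun w => f w * g w).
  exact: measurable_funM.
split=> // p; apply: (intg_le _ _ (intgD _ (If (p + p)%N) (Ig (p + p)%N))) => //.
  by apply: measurable_funX; exact: measurableT_comp.
move=> w _; rewrite normrX normr_id normrM exprMn !exprD.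
set a := `|f w| ^+ p; set b := `|g w| ^+ p.
have a0 : 0 <= a by rewrite exprn_ge0.
have b0 : 0 <= b by rewrite exprn_ge0.
have := sqr_ge0 (a - b); nra.
Qed.

Lemma all_momentsX f p : all_moments f -> all_moments (fun w => f w ^+ p).
Proof.
move=> mf; elim: p => [|p IHp]; first exact: all_moments_cst.
by under eq_fun do rewrite exprS; exact: all_momentsM.
Qed.

Lemma all_moments_norm f : all_moments f -> all_moments (fun w => `|f w|).
Proof.
move=> [mf If]; split; first exact: measurableT_comp.
by move=> p; under eq_fun do rewrite normr_id.
Qed.

Lemma all_moments_sum (I : Type) (s : seq I) (f : I -> Omega -> R) :
  (forall i, all_moments (f i)) -> all_moments (fun w => \sum_(i <- s) f i w).
Proof.
move=> mf; elim: s => [|i s IHs].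
  by under eq_fun do rewrite big_nil; exact: all_moments_cst.
by under eq_fun do rewrite big_cons; exact: all_momentsD.
Qed.

Lemma all_moments_intg f : all_moments f -> intg P setT f.
Proof.
by move=> [mf If]; apply: (intg_le _ mf (If 1%N)).
Qed.

Lemma all_moments_sqint f : all_moments f -> sqint P setT f.
Proof.
by move=> mf; split; [case: mf|exact/all_moments_intg/all_momentsX].
Qed.

Lemma fourth_moment_sqint f : measurable_fun setT f ->
  intg P setT (fun w => f w ^+ 4) -> sqint P setT f.
Proof.
move=> mf If; split=> //.
have I1 := all_moments_intg (all_moments_cst 1).
apply: (intg_le _ _ (intgD _ I1 If)) => //; first exact: measurable_funX.
move=> w _; rewrite ger0_norm ?sqr_ge0//.
have -> : f w ^+ 4 = (f w ^+ 2) ^+ 2 by rewrite -exprM.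
by have := sqr_ge0 (f w ^+ 2 - 1); have := sqr_ge0 (f w ^+ 2); nra.
Qed.

End moments.

(** * Fourth moments of Gaussian variables and of Brownian increments *)

Section gaussian_fourth_moment.
Context {R : realType}.
Local Notation mu := (@lebesgue_measure R).

(** [exp (u^2)] is the square of [exp (u^2 / 2)], which is at least [u^2 / 2]. *)
Lemma expr4_le_expR (u : R) : u ^+ 4 <= 4 * expR (u ^+ 2).
Proof.
have h := expR_ge1Dx (u ^+ 2 / 2); have u2 := sqr_ge0 u.
have -> : expR (u ^+ 2) = expR (u ^+ 2 / 2) ^+ 2.
  by rewrite -expRM_natr; congr expR; field.
have -> : u ^+ 4 = (u ^+ 2) ^+ 2 by rewrite -exprM.
move: (expR _) h => e h; move: (u ^+ 2) h u2 => v h v0.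
have : v / 2 <= e by lra.
by move=> ve; nra.
Qed.

Lemma normal_peak_sqrt2 (s : R) : 0 < s ->
  normal_peak s <= 2 * normal_peak (Num.sqrt 2 * s).
Proof.
move=> s0; rewrite /normal_peak exprMn sqr_sqrtr//.
have -> : 2 * s ^+ 2 * pi *+ 2 = 2 * (s ^+ 2 * pi *+ 2) by ring.
rewrite sqrtrM//; set q := Num.sqrt (s ^+ 2 * pi *+ 2).
have q0 : 0 < q by rewrite sqrtr_gt0 pmulrn_lgt0// mulr_gt0 ?exprn_gt0 ?pi_gt0.
have r0 : 0 < Num.sqrt 2 :> R by rewrite sqrtr_gt0.
have r2 : Num.sqrt 2 ^+ 2 = 2 :> R by rewrite sqr_sqrtr.
rewrite invfM mulrA ler_peMl ?invr_ge0 ?(ltW q0)//.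
by rewrite ler_pdivlMr// mul1r; nra.
Qed.

(** The constant is [16 * 4 * 2]: 16 from writing [x] as [2 s] times [x / (2 s)], 4 from
    [expr4_le_expR], and 2 from comparing the peaks of the two densities. Only the order [s^4]
    matters later. *)
Lemma pow4_normal_pdf_le (s x : R) : 0 < s ->
  x ^+ 4 * normal_pdf 0 s x <= 128 * s ^+ 4 * normal_pdf 0 (Num.sqrt 2 * s) x.
Proof.
move=> s0; have t0 : Num.sqrt 2 * s != 0 by rewrite mulf_neq0 ?gt_eqF// sqrtr_gt0.
have sn0 : s != 0 by rewrite gt_eqF.
rewrite !normal_pdfE// /normal_fun subr0 exprMn sqr_sqrtr//.
rewrite gaussian_exponent_split// expRD.
set E' := expR (- x ^+ 2 / (2 * _ *+ _)); rewrite expRN.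
have E'0 : 0 < E' by exact: expR_gt0.
have h := expr4_le_expR (x / (2 * s)); have e0 := expR_gt0 ((x / (2 * s)) ^+ 2).
have pk := normal_peak_sqrt2 s0.
have p0 := normal_peak_gt0 sn0.
move: (expR _) h e0 => e h e0.
have -> : x ^+ 4 * (normal_peak s * (e^-1 * E')) =
    16 * s ^+ 4 * (normal_peak s * E') * ((x / (2 * s)) ^+ 4 / e).
  by field; rewrite sn0 gt_eqF.
have : (x / (2 * s)) ^+ 4 / e <= 4 by rewrite ler_pdivrMr.
move: (_ / e) => q q4.
apply: (@le_trans _ _ (16 * s ^+ 4 * (normal_peak s * E') * 4)).
  by rewrite ler_wpM2l// !mulr_ge0// ?exprn_ge0 ?(ltW s0) ?(ltW p0) ?(ltW E'0).
have -> : 16 * s ^+ 4 * (normal_peak s * E') * 4 = 64 * s ^+ 4 * (normal_peak s * E') by ring.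
have -> : 128 * s ^+ 4 * (normal_peak (Num.sqrt 2 * s) * E') =
  64 * s ^+ 4 * (2 * normal_peak (Num.sqrt 2 * s) * E') by ring.
rewrite ler_wpM2l ?mulr_ge0 ?exprn_ge0 ?(ltW s0)//.
by rewrite ler_wpM2r// ltW.
Qed.

Lemma normal_prob_fourth_moment (s : R) : 0 < s ->
  (\int[normal_prob 0 s]_x (x ^+ 4)%:E <= (128 * s ^+ 4)%:E)%E.
Proof.
move=> s0; rewrite (@ge0_integral_normal_prob _ s (fun x => x ^+ 4))//; last first.
  by move=> x; rewrite exprn_even_ge0.
apply: (@le_trans _ _ (\int[mu]_x (128 * s ^+ 4 * normal_pdf 0 (Num.sqrt 2 * s) x)%:E)%E).
  apply: ge0_le_integral => //.
  - by move=> x _; rewrite lee_fin mulr_ge0 ?exprn_even_ge0 ?normal_pdf_ge0.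
  - by apply/measurable_EFinP/measurable_funM => //; exact: measurable_normal_pdf.
  - by apply/measurable_EFinP/measurable_funM => //; exact: measurable_normal_pdf.
  - by move=> x _; rewrite lee_fin; exact: pow4_normal_pdf_le.
under eq_integral do rewrite EFinM.
rewrite integralZl//; last exact: integrable_normal_pdf.
by rewrite integral_normal_pdf mule1.
Qed.

End gaussian_fourth_moment.

Section brownian_increments.
Context {d} {Omega : measurableType d} {R : realType}.
Variables (P : probability Omega R) (T : R) (n : nat).
Variable W : R -> Omega -> 'rV[R]_n.
Hypotheses (W_bm : brownian_motion P T W).

Lemma measurable_increment (a b : R) i : 0 <= a <= T -> 0 <= b <= T ->
  measurable_fun setT (fun w => W b w 0 i - W a w 0 i).
Proof.
by move=> aT bT; apply: measurable_funB; apply: (bm_measurable W_bm); rewrite in_itv.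
Qed.

Lemma increment_fourth_moment (a b : R) i : 0 <= a -> a <= b -> b <= T ->
  (\int[P]_w ((W b w 0 i - W a w 0 i) ^+ 4)%:E <= (128 * (b - a) ^+ 2)%:E)%E.
Proof.
(* [bm_gaussian] speaks of positive durations only; for [a = b] the increment is 0. *)
move=> a0; rewrite le_eqVlt => /predU1P[->|ab] bT.
  rewrite (eq_integral (cst 0)) ?integral_cst ?mul0e//; last first.
    by move=> w _; rewrite subrr expr0n.
  by rewrite lee_fin mulr_ge0 ?sqr_ge0.
have mD : measurable_fun setT (fun w => W b w 0 i - W a w 0 i).
  by apply: measurable_increment; rewrite ?a0 ?bT ?(le_trans a0 (ltW ab)) ?(le_trans (ltW ab) bT).
pose D : {mfun Omega >-> measurableTypeR R} :=
  @mfun_Sub _ _ _ (measurableTypeR R) _ (mem_set mD).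
have s0 : 0 < Num.sqrt (b - a) by rewrite sqrtr_gt0 subr_gt0.
have := normal_prob_fourth_moment s0.
rewrite [X in (_ <= (128 * X)%:E)%E -> _](_ : _ = (b - a) ^+ 2); last first.
  by rewrite (exprM _ 2 2) sqr_sqrtr// subr_ge0 ltW.
apply: le_trans; rewrite le_eqVlt; apply/orP; left; apply/eqP.
rewrite -[LHS](ge0_integral_distribution D (f := fun x : measurableTypeR R => (x ^+ 4)%:E))//.
- apply: eq_measure_integral => A mA _.
  exact: (bm_gaussian W_bm i a0 ab bT mA).
- by apply/measurable_EFinP; exact: measurable_funX.
- by move=> x; rewrite lee_fin exprn_even_ge0.
Qed.

Lemma increment_sqint (a b : R) i : 0 <= a -> a <= b -> b <= T ->
  sqint P setT (fun w => W b w 0 i - W a w 0 i).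
Proof.
move=> a0 ab bT.
have mD : measurable_fun setT (fun w => W b w 0 i - W a w 0 i).
  by apply: measurable_increment; rewrite ?a0 ?bT ?(le_trans a0 ab) ?(le_trans ab bT).
apply: fourth_moment_sqint => //; apply: intg_ltP => //.
- exact: measurable_funX.
- by move=> w _; rewrite exprn_even_ge0.
- by rewrite (le_lt_trans (increment_fourth_moment _ a0 ab bT))// ltry.
Qed.

Lemma step_integral_sqint s : step_in T s -> sqint P setT (step_integral W s).
Proof.
move=> sT; rewrite /step_integral.
elim: s sT => [|x s IHs] sT.
  under eq_fun do rewrite big_nil.
  exact/all_moments_sqint/all_moments_cst.
under eq_fun do rewrite big_cons.
apply: sqintD => //; last by apply: IHs => y ys; apply: sT; rewrite inE ys orbT.
apply: sqint_sum => // i; apply: sqintZ => //.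
by have /and3P[x0 xx xT] := sT x (mem_head _ _); exact: increment_sqint.
Qed.

End brownian_increments.

(** * Stein's identity for Wiener integrals *)

Section cvg_Rintegral_dominated.
Context {d} {T : measurableType d} {R : realType}.
Variables (mu : {measure set T -> \bar R}) (D : set T).
Hypothesis mD : measurable D.

Lemma cvg0_Rintegral_le (g G : nat -> T -> R) :
  (forall k, measurable_fun D (g k)) -> (forall k, measurable_fun D (G k)) ->
  (forall k x, D x -> 0 <= g k x <= G k x) ->
  (\int[mu]_(x in D) (G k x)%:E)%E @[k --> \oo] --> 0%E ->
  (\int[mu]_(x in D) (g k x)) @[k --> \oo] --> 0.
Proof.
move=> mg mG gG G0; apply: (@fine_cvg _ _ _ _ (fun k => (\int[mu]_(x in D) (g k x)%:E)%E) 0).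
apply: (squeeze_cvge (f := fun=> 0%E) (h := fun k => (\int[mu]_(x in D) (G k x)%:E)%E)) => //.
- near=> k; apply/andP; split.
    by apply: integral_ge0 => x Dx; rewrite lee_fin; case/andP: (gG k x Dx).
  apply: ge0_le_integral => //.
  + by move=> x Dx; rewrite lee_fin; case/andP: (gG k x Dx).
  + exact/measurable_EFinP.
  + exact/measurable_EFinP.
  + by move=> x Dx; rewrite lee_fin; case/andP: (gG k x Dx).
- exact: cvg_cst.
Unshelve. all: by end_near. Qed.

(** Convergence to 0 in the extended reals makes some integral finite, so that [f = u k - (u k - f)]
    is square-integrable. The definitions of Wiener integral and derivative ask only for
    measurability of the limit. *)
Lemma sqint_of_cvg0 (u : nat -> T -> R) (f : T -> R) :
  (forall k, sqint mu D (u k)) -> measurable_fun D f ->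
  (\int[mu]_(x in D) ((u k x - f x) ^+ 2)%:E)%E @[k --> \oo] --> 0%E ->
  sqint mu D f.
Proof.
move=> su mf /fine_cvgP[[k _ fk] _].
have mk : measurable_fun D (fun x => u k x - f x).
  by apply: measurable_funB => //; case: (su k).
have sk : sqint mu D (fun x => u k x - f x).
  split=> //; apply: intg_ltP => //.
  - exact: measurable_funX.
  - by move=> x _; exact: sqr_ge0.
  - have := fk k (leqnn k); rewrite ge0_fin_numE//.
    by apply: integral_ge0 => x _; rewrite lee_fin sqr_ge0.
have := sqintB mD (su k) sk.
by under eq_fun do rewrite opprB addrC subrK.
Qed.

End cvg_Rintegral_dominated.

Section wiener_inner_product.
Context {R : realType}.
Variables (T : R) (n : nat).
Hypothesis T_gt0 : 0 < T.
Local Notation mu := (@lebesgue_measure R).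
Let D : set (measurableTypeR R) := `[0, T]%classic.
Let mD : measurable D. Proof. exact: measurable_itv. Qed.

Lemma sqnorm_coord_le (v : 'rV[R]_n) i : v 0 i ^+ 2 <= sqnorm v.
Proof.
by rewrite /sqnorm (bigD1 i)//= lerDl sumr_ge0// => j _; exact: sqr_ge0.
Qed.

Lemma sqnorm_ge0 (v : 'rV[R]_n) : 0 <= sqnorm v.
Proof. by apply: sumr_ge0 => j _; exact: sqr_ge0. Qed.

Lemma measurable_sqnorm d (U : measurableType d) (E : set U) (v : U -> 'rV[R]_n) :
  (forall i, measurable_fun E (fun x => v x 0 i)) ->
  measurable_fun E (fun x => sqnorm (v x)).
Proof.
move=> mv; have h i : measurable_fun E (fun x => v x 0 i ^+ 2) by exact: measurable_funX.
exact: measurable_sum h.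
Qed.

Lemma L2_fun_sqint (h : R -> 'rV[R]_n) i : L2_fun T h ->
  sqint mu D (fun t => h t 0 i).
Proof.
move=> [mh hfin]; split; first exact: mh.
have mh2 j : measurable_fun D (fun t => h t 0 j ^+ 2).
  by apply: measurable_funX; exact: mh.
apply: (intg_ltP (mh2 i)); first by move=> t _; exact: sqr_ge0.
apply: le_lt_trans hfin; apply: ge0_le_integral => //.
- by move=> t _; rewrite lee_fin sqr_ge0.
- by apply/measurable_EFinP; exact: mh2.
- by apply/measurable_EFinP; exact: measurable_sqnorm.
- by move=> t _; rewrite lee_fin; exact: sqnorm_coord_le.
Qed.

Lemma step_fun_sqint (s : seq (R * R * 'rV[R]_n)) i :
  sqint mu D (fun t => step_fun s t 0 i).
Proof.
rewrite (_ : (fun t => _) = fun t => \sum_(x <- s) if t \in `]x.1.1, x.1.2] then x.2 0 i else 0); last first.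
  apply/funext => t; rewrite /step_fun summxE; apply: eq_bigr => x _.
  by case: ifP => // _; rewrite mxE.
apply: sqint_sum => // x; split.
  by have := intg_grid_indic (T := T) T_gt0 x.1.1 x.1.2 (x.2 0 i); exact: intg_meas.
have := intg_grid_indic (T := T) T_gt0 x.1.1 x.1.2 (x.2 0 i ^+ 2).
by congr intg; apply/funext => t; case: ifP => //; rewrite expr0n.
Qed.

Lemma cvg_Rintegral_dot (s1 s2 : nat -> seq (R * R * 'rV[R]_n)) (h1 h2 : R -> 'rV[R]_n) :
  L2_fun T h1 -> L2_fun T h2 ->
  (\int[mu]_(t in D) (sqnorm (step_fun (s1 k) t - h1 t))%:E)%E @[k --> \oo] --> 0%E ->
  (\int[mu]_(t in D) (sqnorm (step_fun (s2 k) t - h2 t))%:E)%E @[k --> \oo] --> 0%E ->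
  (\int[mu]_(t in D) dot (step_fun (s1 k) t) (step_fun (s2 k) t)) @[k --> \oo] -->
  \int[mu]_(t in D) dot (h1 t) (h2 t).
Proof.
move=> L1 L2 c1 c2.
have coord (s : nat -> seq (R * R * 'rV[R]_n)) h i : L2_fun T h ->
    (\int[mu]_(t in D) (sqnorm (step_fun (s k) t - h t))%:E)%E @[k --> \oo] --> 0%E ->
    (\int[mu]_(t in D) ((step_fun (s k) t 0 i - h t 0 i) ^+ 2)) @[k --> \oo] --> 0.
  move=> Lh ch.
  have mc k j : measurable_fun D (fun t => step_fun (s k) t 0 j - h t 0 j).
    apply: measurable_funB; first exact: sqint_meas (step_fun_sqint (s k) j).
    exact: sqint_meas (L2_fun_sqint j Lh).
  apply: (cvg0_Rintegral_le mD _ _ _ ch).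
  - by move=> k; exact: measurable_funX.
  - move=> k; apply: measurable_sqnorm => j.
    by under eq_fun do rewrite !mxE; exact: mc.
  - move=> k t _; rewrite sqr_ge0/=.
    by have := sqnorm_coord_le (step_fun (s k) t - h t) i; rewrite !mxE.
have E (u v : R -> 'rV[R]_n) : (forall i, sqint mu D (fun t => u t 0 i)) ->
    (forall i, sqint mu D (fun t => v t 0 i)) ->
    \int[mu]_(t in D) dot (u t) (v t) = \sum_i \int[mu]_(t in D) (u t 0 i * v t 0 i).
  by move=> su sv; rewrite Rintegral_sum// => i _; exact: sqint_mul.
rewrite E; [|by move=> i; exact: L2_fun_sqint..].
rewrite (_ : (fun k => _) = fun k => \sum_i \int[mu]_(t in D) (step_fun (s1 k) t 0 i * step_fun (s2 k) t 0 i)); last first.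
  by apply/funext => k; rewrite E// => i; exact: step_fun_sqint.
apply: cvg_sumr => i _; apply: cvg_Rintegral_mul => //.
- by move=> k; exact: step_fun_sqint.
- by move=> k; exact: step_fun_sqint.
- exact: L2_fun_sqint.
- exact: L2_fun_sqint.
- exact: coord.
- exact: coord.
Qed.

End wiener_inner_product.

Lemma cvg_ge_id (phi : nat -> nat) : (forall k, (k <= phi k)%N) -> phi @ \oo --> \oo.
Proof.
by move=> h A [N _ NA]; exists N => // k /= Nk; apply: NA => /=; exact: leq_trans Nk (h k).
Qed.

Lemma cvg_of_sqr_le {R : realType} (u g : nat -> R) (l : R) :
  (forall k, (u k - l) ^+ 2 <= g k) -> g k @[k --> \oo] --> 0 -> u k @[k --> \oo] --> l.
Proof.
move=> ug g0; apply/cvgrPdist_lt => e e0; near=> k.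
rewrite -(ltr_pXn2r (n := 2))// ?nnegrE ?normr_ge0 ?(ltW e0)//.
rewrite real_normK ?num_real// -sqrrN opprB; apply: le_lt_trans (ug k) _.
rewrite -[g k]subr0; apply: le_lt_trans (ler_norm _) _; rewrite -normrN opprB.
near: k; move/cvgrPdist_lt : g0 => /(_ (e ^+ 2)); apply; exact: exprn_gt0.
Unshelve. all: by end_near. Qed.

Section wiener_stein.
Context {d} {Omega : measurableType d} {R : realType} {P : probability Omega R}.
Context {T : R} {n : nat} {W : R -> Omega -> 'rV[R]_n}.
Hypotheses (T_gt0 : 0 < T) (W_bm : brownian_motion P T W).
Local Notation mu := (@lebesgue_measure R).

Lemma wiener_integral_sqint (h : R -> 'rV[R]_n) (X : Omega -> R) :
  wiener_integral P T W h X -> sqint P setT X.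
Proof.
move=> [mX [s [sT _ cX]]]; apply: (sqint_of_cvg0 measurableT _ mX cX) => k.
exact: (step_integral_sqint W_bm).
Qed.

(** The identity for step integrals passes to the limit: along a subsequence they converge almost
    everywhere, which settles the bounded continuous factors, while the unbounded factor [X a] is
    handled by L^2 convergence. *)
Lemma stein_wiener_bounded (m : nat) (h : 'I_m -> R -> 'rV[R]_n)
    (X : 'I_m -> Omega -> R) (f : 'rV[R]_m -> R) (K : R) :
  (forall j, L2_fun T (h j)) -> (forall j, wiener_integral P T W (h j) (X j)) ->
  C1 f -> (forall x, `|f x| <= K) -> (forall j x, `|partial j f x| <= K) ->
  let Z := fun w => \row_j X j w in forall a,
  \int[P]_w (X a w * f (Z w)) =
  \sum_b (\int[mu]_(t in `[0, T]) dot (h a t) (h b t)) * \int[P]_w partial b f (Z w).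
Proof.
move=> Lh HX fC fK dfK Z a.
have [cf _ cdf] := fC.
have [s sP] : {s : 'I_m -> nat -> seq (R * R * 'rV[R]_n) & forall j,
    [/\ forall k, step_in T (s j k),
    (\int[mu]_(t in `[0%R, T]) (sqnorm (step_fun (s j k) t - h j t))%:E)%E @[k --> \oo] --> 0%E &
    (\int[P]_w ((step_integral W (s j k) w - X j w) ^+ 2)%:E)%E @[k --> \oo] --> 0%E]}.
  apply: (@choice _ _ (fun j (s : nat -> seq (R * R * 'rV[R]_n)) =>
    [/\ forall k, step_in T (s k),
    (\int[mu]_(t in `[0%R, T]) (sqnorm (step_fun (s k) t - h j t))%:E)%E @[k --> \oo] --> 0%E &
    (\int[P]_w ((step_integral W (s k) w - X j w) ^+ 2)%:E)%E @[k --> \oo] --> 0%E])) => j.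
  by case: (HX j).
have mX j : measurable_fun setT (X j) by case: (HX j).
have sX j : sqint P setT (X j) by exact: wiener_integral_sqint (HX j).
pose Y k j w := step_integral W (s j k) w.
have sY k j : sqint P setT (Y k j) by apply: (step_integral_sqint W_bm); case: (sP j).
(* Summing the errors over [j] yields one subsequence that serves all coordinates. *)
pose g k w := \sum_j (Y k j w - X j w) ^+ 2.
have mYX k j : measurable_fun setT (fun w => (Y k j w - X j w) ^+ 2).
  by apply: measurable_funX; apply: measurable_funB => //; exact: sqint_meas (sY k j).
have mg k : measurable_fun setT (g k) by exact: measurable_sum (mYX k).
have g0 : (\int[P]_w (g k w)%:E)%E @[k --> \oo] --> 0%E.
  rewrite (_ : (fun k => _) = fun k => (\sum_j \int[P]_w ((Y k j w - X j w) ^+ 2)%:E)%E); last first.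
    apply/funext => k; rewrite /g; under eq_integral do rewrite -sumEFin.
    rewrite ge0_integral_sum// => j; first exact/measurable_EFinP.
    by move=> w _; rewrite lee_fin sqr_ge0.
  rewrite [X in _ --> X](_ : _ = (\sum_(j < m) 0)%E); last by rewrite big1.
  apply: cvg_nnesum => j _; last by case: (sP j).
  by near=> k; apply: integral_ge0 => w _; rewrite lee_fin sqr_ge0.
have [phi phik aeg] := ae_cvg_subseq measurableT mg (fun k x _ => sumr_ge0 _ (fun j _ => sqr_ge0 _)) g0.
have phioo := cvg_ge_id phik.
pose V k w := \row_j Y (phi k) j w.
have aeV : \forall x \ae P, setT x -> V k x @[k --> \oo] --> Z x.
  apply: filterS aeg => w h0 _; apply: cvg_rowP => j; rewrite !mxE.
  under eq_fun do rewrite mxE.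
  apply: (cvg_of_sqr_le _ (h0 I)) => k.
  by rewrite /g (bigD1 j)//= lerDl sumr_ge0// => i _; exact: sqr_ge0.
have Pfin : (P setT < +oo)%E by rewrite probability_setT ltry.
have cvgF (F : 'rV[R]_m -> R) : continuous F -> (forall x, `|F x| <= K) ->
    (\int[P]_w F (V k w)) @[k --> \oo] --> \int[P]_w F (Z w).
  move=> cF bF; apply: (bounded_cvg_ae measurableT (A := K)) => //.
  - by move=> k; apply: measurable_continuous_rV => // j; exact: sqint_meas (sY _ _).
  - exact: measurable_continuous_rV.
  - by apply: filterS aeV => w /(_ I) Vw _; apply: cvg_comp Vw _; exact: cF.
have mfV k : measurable_fun setT (fun w => f (V k w)).
  by apply: measurable_continuous_rV => // j; exact: sqint_meas (sY _ _).
have mfZ : measurable_fun setT (fun w => f (Z w)) by exact: measurable_continuous_rV.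
have sqb (u : Omega -> R) : measurable_fun setT u -> (forall w, `|u w| <= K) -> sqint P setT u.
  move=> mu_ uK; split => //; apply: (intg_bounded _ (B := K ^+ 2)); first exact: measurable_funX.
  by move=> w; rewrite normrX lerXn2r// nnegrE (le_trans _ (uK w)).
have lhs : (\int[P]_w (Y (phi k) a w * f (V k w))) @[k --> \oo] --> \int[P]_w (X a w * f (Z w)).
  apply: cvg_Rintegral_mul => //; first by move=> k; exact: sqb.
  - exact: sqb.
  - case: (sP a) => _ _ /fine_cvg /=; exact: cvg_comp.
  - rewrite [X in _ --> X](_ : _ = \int[P]_w (0 : R)); last by rewrite /Rintegral integral0.
    apply: (bounded_cvg_ae measurableT (A := (K + K) ^+ 2)) => //.
    + by move=> k; apply: measurable_funX; exact: measurable_funB.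
    + move=> k w _; rewrite normrX lerXn2r ?nnegrE ?addr_ge0 ?(le_trans _ (fK 0))//.
      by apply: le_trans (ler_normB _ _) _; exact: lerD.
    + apply: filterS aeV => w /(_ I) Vw _; rewrite -[X in _ --> X](expr0n R 2).
      apply: cvg_sqr; rewrite -(subrr (f (Z w))); apply: cvgB; last exact: cvg_cst.
      by apply: cvg_comp Vw _; exact: cf.
apply: (cvg_unique _ lhs) => //.
rewrite (_ : (fun k => _) = fun k => \sum_b
    (\int[mu]_(t in `[0, T]) dot (step_fun (s a (phi k)) t) (step_fun (s b (phi k)) t)) *
    \int[P]_w partial b f (V k w)); last first.
  apply/funext => k.
  rewrite -(stein_step_integral T_gt0 W_bm (s := fun j => s j (phi k)) (K := K))//; last first.
    by move=> j; case: (sP j).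
  by apply: eq_Rintegral => w _; rewrite !mxE.
apply: cvg_sumr => b _; apply: cvgM; last by apply: cvgF; [exact: cdf|exact: dfK].
have [_ ca _] := sP a; have [_ cb _] := sP b.
exact: cvg_comp phioo (cvg_Rintegral_dot T_gt0 (Lh a) (Lh b) ca cb).
Unshelve. all: by end_near. Qed.
End wiener_stein.

Lemma limn_einf_le {R : realType} (u : nat -> \bar R) (C : \bar R) :
  (forall k, (u k <= C)%E) -> (limn_einf u <= C)%E.
Proof.
move=> uC; rewrite limn_einf_lim; apply: lime_le; first exact: is_cvg_einfs.
near=> k; apply: le_trans (uC k); apply: ereal_inf_lbound.
by exists k => //=.
Unshelve. all: by end_near. Qed.

(** * Partial derivatives of coordinatewise compositions and of powers *)

Section C1_calculus.
Context {R : realType}.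
Variable m : nat.
Implicit Types (f : 'rV[R]_m -> R) (x c : 'rV[R]_m).

Lemma is_derive_of_line f x c (df : R) :
  is_derive (0 : R) 1 (fun s : R => f (x + s *: c)) df -> is_derive x c f df.
Proof.
move=> [fd fE].
have E : (fun h : R => h^-1 *: (((fun s => f (x + s *: c)) \o shift 0) (h *: 1) -
    f (x + 0 *: c))) =
  (fun h : R => h^-1 *: ((f \o shift x) (h *: c) - f x)).
  apply/funext => h /=; rewrite scale0r !addr0; congr (_ *: (f _ - _)).
  by rewrite [h%:A]mulr1 addrC.
apply: DeriveDef; first by rewrite /derivable -E.
by rewrite -fE /derive -E.
Qed.

Lemma is_derive_coord x c a : is_derive x c (fun y => y 0 a) (c 0 a).
Proof.
apply: is_derive_of_line.
have := is_deriveD (is_derive_cst (x 0 a) (0 : R) 1)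
  (is_deriveM (is_derive_id (0 : R) 1) (is_derive_cst (c 0 a) (0 : R) 1)).
move/is_derive_ext; apply=> [s|]; first by rewrite !mxE.
by rewrite /= scaler0 add0r add0r [_%:A]mulr1.
Qed.

Lemma C1I f (df : 'I_m -> 'rV[R]_m -> R) : continuous f ->
  (forall j x, is_derive x (delta_mx 0 j) f (df j x)) ->
  (forall j, continuous (df j)) -> C1 f /\ forall j x, partial j f x = df j x.
Proof.
move=> cf fd cd.
have E j x : partial j f x = df j x by rewrite /partial; case: (fd j x) => _ ->.
split=> //; split=> // j; rewrite (_ : partial j f = df j)//; apply/funext => x.
exact: E.
Qed.

Lemma continuous_coord a : continuous (fun x : 'rV[R]_m => x 0 a).
Proof. exact: coord_continuous. Qed.

Lemma continuous_coord_map (g : R -> R) : continuous g ->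
  continuous (fun x : 'rV[R]_m => \row_j g (x 0 j)).
Proof.
move=> cg x; apply: (cvg_rowP (F := nbhs x)) => j; rewrite mxE; under eq_fun do rewrite mxE.
apply: (cvg_comp (fun y : 'rV[R]_m => y 0 j) g); last exact: cg.
exact: continuous_coord.
Qed.

(** Moving the [j]-th coordinate of [x] moves only the [j]-th coordinate of the image, so a
    one-dimensional chain rule suffices. *)
Lemma C1_comp_coord f (g dg : R -> R) : C1 f ->
  (forall t : R, is_derive t 1 g (dg t)) -> continuous dg ->
  let G x := \row_j g (x 0 j) in
  C1 (f \o G) /\ forall j x, partial j (f \o G) x = dg (x 0 j) * partial j f (G x).
Proof.
move=> fC gd cdg G; have [cf _ cdf] := fC.
have cg : continuous g.
  by move=> t; have [td _] := gd t; exact/differentiable_continuous/derivable1_diffP.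
have cG : continuous G by exact: continuous_coord_map.
apply: C1I.
- by move=> x; apply: continuous_comp; [exact: cG|exact: cf].
- move=> j x; apply: is_derive_of_line.
  rewrite (_ : (fun s => _) = (fun t => f (G x + t *: delta_mx 0 j)) \o (fun s => g (x 0 j + s) - g (x 0 j))); last first.
    apply/funext => s /=; congr f; apply/rowP => i; rewrite !mxE eqxx/=.
    by have [->|] := eqVneq i j; rewrite ?mulr1 ?mulr0 ?addr0// addrCA subrr addr0.
  have gj : is_derive (0 : R) 1 (fun s => g (x 0 j + s) - g (x 0 j)) (dg (x 0 j)).
    have D1 : is_derive (0 : R) 1 (fun s => x 0 j + s) 1.
      apply: is_derive_ext (is_deriveD (is_derive_cst (x 0 j) (0 : R) 1) (is_derive_id (0 : R) 1)) _ _ => //.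
      by rewrite add0r.
    have gd0 : is_derive (x 0 j + 0) 1 g (dg (x 0 j)) by rewrite addr0.
    have := is_deriveB (is_derive1_comp gd0 D1) (is_derive_cst (g (x 0 j)) (0 : R) 1).
    by move/is_derive_ext; apply=> //; rewrite mulr1 subr0.
  have := C1_is_derive_coord (G x) j (g (x 0 j + 0) - g (x 0 j)) fC.
  move/(is_derive1_comp (g := fun s => g (x 0 j + s) - g (x 0 j))) => /(_ _ gj).
  by rewrite addr0 subrr scale0r addr0 mulrC.
- move=> j; apply: continuous_funM.
    move=> x; apply: continuous_comp; [exact: continuous_coord|exact: cdg].
  move=> x; apply: continuous_comp; [exact: cG|exact: cdf].
Qed.

Lemma C1_coordX a p : C1 (fun x : 'rV[R]_m => x 0 a ^+ p) /\
  forall j x, partial j (fun x : 'rV[R]_m => x 0 a ^+ p) x = (p%:R * x 0 a ^+ p.-1) * (j == a)%:R.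
Proof.
have cX q : continuous (fun x : 'rV[R]_m => x 0 a ^+ q).
  elim: q => [|q IH]; first by under eq_fun do rewrite expr0; exact: cst_continuous.
  by under eq_fun do rewrite exprS; apply: continuous_funM => //; exact: continuous_coord.
apply: C1I => //.
- move=> j x; have := is_derive_coord x (delta_mx 0 j) a; rewrite mxE eqxx/=.
  rewrite eq_sym => /(is_deriveX p) /is_derive_ext; apply=> // y.
  by elim: p => [|p IH] //; rewrite !exprS -IH.
- move=> j; apply: continuous_funM; last exact: cst_continuous.
  by apply: continuous_funM => //; exact: cst_continuous.
Qed.

End C1_calculus.

Lemma cvg_dpsi {R : realType} (x : R) : dpsi k.+1%:R x @[k --> \oo] --> (1 : R).
Proof.
suff : 1 - (psi k.+1%:R x / k.+1%:R) ^+ 2 @[k --> \oo] --> 1 - (x * 0) ^+ 2.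
  by rewrite mulr0 expr0n subr0; under eq_fun do rewrite -dpsiE//.
apply: cvgB; first exact: cvg_cst.
by apply: cvg_sqr; apply: cvgM; [exact: cvg_psi|exact: cvg_harmonic].
Qed.

(** * Moments of Wiener integrals, and Stein's identity under polynomial growth *)

Section wiener_moments.
Context {d} {Omega : measurableType d} {R : realType} {P : probability Omega R}.
Context {T : R} {n : nat} {W : R -> Omega -> 'rV[R]_n}.
Hypotheses (T_gt0 : 0 < T) (W_bm : brownian_motion P T W).
Local Notation mu := (@lebesgue_measure R).

(* Stein's identity for [psi c x ^+ (2 p + 1)], whose derivative is at most
   [(2 p + 1) psi c x ^+ (2 p)]: the moments of [psi c X] are bounded uniformly
   in [c]. *)
Lemma wiener_psi_moment (h : R -> 'rV[R]_n) (X : Omega -> R) (p : nat) :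
  L2_fun T h -> wiener_integral P T W h X ->
  exists C, forall c, 0 < c -> \int[P]_w (psi c (X w) ^+ p.*2) <= C.
Proof.
move=> Lh HX; have mX : measurable_fun setT X by case: HX.
have sX := wiener_integral_sqint W_bm HX.
have mpsi c q : 0 < c -> measurable_fun setT (fun w => psi c (X w) ^+ q).
  move=> c0; apply: measurable_funX; apply: measurableT_comp => //.
  by apply: continuous_measurable_fun; exact: continuous_psi.
have bpsi' c q x : 0 < c -> `|psi c x ^+ q| <= c ^+ q.
  by move=> c0; rewrite normrX lerXn2r ?nnegrE ?(ltW c0)// ltW// normr_psi_lt.
have bpsi c q w : 0 < c -> `|psi c (X w) ^+ q| <= c ^+ q by exact: bpsi'.
elim: p => [|p [C HC]].
  exists 1 => c c0; under eq_Rintegral do rewrite double0 expr0.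
  have P1 : fine (P setT) <= 1 by rewrite probability_setT.
  by rewrite Rintegral_cst// mul1r; exact: P1.
pose s2 := \int[mu]_(t in `[0, T]) dot (h t) (h t).
(* The recursion of the Gaussian moments: passing from order [2 p] to [2 p + 2] costs the variance
   times [2 p + 1]. *)
exists (s2 * (p.*2.+1)%:R * C) => c c0.
pose G (x : 'rV[R]_1) := \row_j psi c (x 0 j).
pose e (x : 'rV[R]_1) := x 0 0 ^+ p.*2.+1.
have [eC ep] := @C1_coordX R 1 0 p.*2.+1.
have [fC fp] := C1_comp_coord eC (fun t => is_derive_psi t c0) (continuous_dpsi c0).
have Gx x : G x 0 0 = psi c (x 0 0) by rewrite mxE.
have n0 : 0 <= (p.*2.+1)%:R * c ^+ p.*2 by rewrite mulr_ge0// exprn_ge0// ltW.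
have n1 : 0 <= c ^+ p.*2.+1 by rewrite exprn_ge0// ltW.
have pE j x : partial j (e \o G) x = dpsi c (x 0 0) * ((p.*2.+1)%:R * psi c (x 0 0) ^+ p.*2).
  by rewrite fp ep (ord1 j) Gx eqxx mulr1.
have ev (x : R) : 0 <= x ^+ p.*2 by rewrite exprn_even_ge0// odd_double.
pose K := c ^+ p.*2.+1 + (p.*2.+1)%:R * c ^+ p.*2.
have b1 x : `|(e \o G) x| <= K.
  by rewrite /e /= Gx; apply: le_trans (bpsi' _ _ _ _ c0) _; rewrite lerDl.
have b2 j x : `|partial j (e \o G) x| <= K.
  rewrite pE normrM (ger0_norm (dpsi_ge0 _ _)).
  apply: le_trans (ler_piMl _ (dpsi_le1 _ c0)) _ => //.
  rewrite normrM normr_nat; apply: (@le_trans _ _ ((p.*2.+1)%:R * c ^+ p.*2)); last by rewrite lerDr.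
  by rewrite ler_wpM2l// bpsi'.
have := stein_wiener_bounded T_gt0 W_bm (h := fun=> h) (X := fun=> X)
  (f := e \o G) (fun=> Lh) (fun=> HX) fC b1 b2 0.
rewrite big_ord1 => S.
have E : \int[P]_w (X w * psi c (X w) ^+ p.*2.+1) =
    s2 * \int[P]_w (dpsi c (X w) * ((p.*2.+1)%:R * psi c (X w) ^+ p.*2)).
  rewrite -[RHS](_ : s2 * \int[P]_w partial 0 (e \o G) (\row_j X w) = _); last first.
    by congr (_ * _); apply: eq_Rintegral => w _; rewrite pE mxE.
  by rewrite -S; apply: eq_Rintegral => w _; rewrite /e /= Gx mxE.
have s20 : 0 <= s2.
  by apply: Rintegral_ge0 => t _; apply: sumr_ge0 => i _; rewrite -expr2 sqr_ge0.
have iX q : intg P setT (fun w => psi c (X w) ^+ q).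
  by apply: (intg_bounded _ (mpsi c q c0)) => w; exact: bpsi.
apply: (@le_trans _ _ (\int[P]_w (X w * psi c (X w) ^+ p.*2.+1))).
  apply: le_Rintegral => //; first exact: iX.
    apply: sqint_mul => //; split; first exact: mpsi.
    by under eq_fun do rewrite -exprM; exact: iX.
  move=> w _; rewrite doubleS !exprS.
  have := ler_wpM2r (ev (psi c (X w))) (sqr_psi_le (X w) c0).
  by rewrite expr2 !mulrA.
rewrite E -mulrA ler_wpM2l//.
apply: (@le_trans _ _ (\int[P]_w ((p.*2.+1)%:R * psi c (X w) ^+ p.*2))).
  have i2 : intg P setT (fun w => (p.*2.+1)%:R * psi c (X w) ^+ p.*2) by exact: intgZ.
  have lepsi w : dpsi c (X w) * ((p.*2.+1)%:R * psi c (X w) ^+ p.*2) <= (p.*2.+1)%:R * psi c (X w) ^+ p.*2.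
    by rewrite ler_piMl ?dpsi_le1// mulr_ge0.
  apply: le_Rintegral => //.
  apply: (intg_le measurableT _ i2).
    apply: measurable_funM; last exact: intg_meas i2.
    by apply: measurableT_comp => //; apply: continuous_measurable_fun; exact: continuous_dpsi.
  by move=> w _; rewrite ger0_norm// mulr_ge0 ?dpsi_ge0// mulr_ge0.
rewrite RintegralZl//; first by rewrite ler_wpM2l// HC.
exact: iX.
Qed.

(** Fatou's lemma as the squashing level [c] grows, from the bounds of [wiener_psi_moment] that do
    not depend on [c]. Even orders suffice because [a <= 1 + a^2]. *)
Lemma wiener_integral_moments (h : R -> 'rV[R]_n) (X : Omega -> R) :
  L2_fun T h -> wiener_integral P T W h X -> all_moments P X.
Proof.
move=> Lh HX; have mX : measurable_fun setT X by case: HX.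
have I2 q : intg P setT (fun w => X w ^+ q.*2).
  have [C HC] := wiener_psi_moment q Lh HX.
  have mpsi k : measurable_fun setT (fun w => psi k.+1%:R (X w) ^+ q.*2).
    apply: measurable_funX; apply: measurableT_comp => //.
    by apply: continuous_measurable_fun; exact: continuous_psi.
  have ev (x : R) : 0 <= x ^+ q.*2 by rewrite -mul2n exprM exprn_ge0// sqr_ge0.
  apply: intg_ltP => //; first exact: measurable_funX.
  apply: le_lt_trans (ltry C).
  have := @fatou _ _ _ P setT measurableT (fun k w => (psi k.+1%:R (X w) ^+ q.*2)%:E).
  move=> /(_ (fun k => (measurable_EFinP _ _).2 (mpsi k))) H.
  rewrite -(_ : \int[P]_w limn_einf (fun k => (psi k.+1%:R (X w) ^+ q.*2)%:E) =
    \int[P]_w (X w ^+ q.*2)%:E)%E; last first.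
    apply: eq_integral => w _.
    apply: (fun l => (@cvg_limn_einf_sup R _ _ l).1); apply: cvg_EFin; first exact: nearW.
    by apply: (cvg_comp (fun k => psi k.+1%:R (X w)) (fun x => x ^+ q.*2));
      [exact: cvg_psi|exact: exprn_continuous].
  apply: le_trans (H _) _; first by move=> k w _; rewrite lee_fin.
  apply: limn_einf_le => k; rewrite -EFin_Rintegral ?lee_fin//; first exact: HC.
  apply: (intg_bounded _ (mpsi k) (B := k.+1%:R ^+ q.*2)) => w.
  by rewrite normrX lerXn2r ?nnegrE// ltW// normr_psi_lt.
have Pfin : (P setT < +oo)%E by rewrite probability_setT ltry.
split=> // q; apply: (intg_le measurableT _ (intgD measurableT (intg_cst measurableT 1 _) (I2 q))).
- by apply: measurable_funX; apply: measurableT_comp.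
- exact: Pfin.
- move=> w _; rewrite normrX normr_id.
  rewrite -[X w ^+ q.*2]ger0_norm ?exprn_even_ge0 ?odd_double// normrX -mul2n exprM.
  have := ler0n R 0; set a := `|X w| ^+ q.
  rewrite (_ : (`|X w| ^+ 2) ^+ q = a ^+ 2); last by rewrite /a -!exprM mulnC.
  have := sqr_ge0 (a - 1); nra.
Qed.


Definition poly_growth (m : nat) (f : 'rV[R]_m -> R) :=
  exists (C : R) (k : nat), forall x, `|f x| <= C * (1 + `|x|) ^+ k.

(** A single dominating variable serves every [y] below [X] coordinatewise, in particular the
    squashed vectors at all levels at once. *)
Lemma poly_growth_moments (m : nat) (f : 'rV[R]_m -> R) (X : 'I_m -> Omega -> R) :
  continuous f -> poly_growth f -> (forall j, all_moments P (X j)) ->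
  exists B : Omega -> R, all_moments P B /\ forall w (y : 'rV[R]_m),
    (forall j, `|y 0 j| <= `|X j w|) -> `|f y| <= B w.
Proof.
move=> cf [C [k fC]] MX; exists (fun w => C * (1 + \sum_j `|X j w|) ^+ k); split.
  apply: all_momentsM; first exact: all_moments_cst.
  apply/all_momentsX/all_momentsD; first exact: all_moments_cst.
  by apply: all_moments_sum => j; exact: all_moments_norm.
move=> w y yX; apply: le_trans (fC y) _.
have C0 : 0 <= C.
  by have := le_trans (normr_ge0 _) (fC 0); rewrite normr0 addr0 expr1n mulr1.
rewrite ler_wpM2l// lerXn2r ?nnegrE ?addr_ge0//; first exact: sumr_ge0.
by rewrite lerD2l; apply: le_trans (mx_norm_le_sum _) _; exact: ler_sum.
Qed.

Lemma all_moments_poly_growth (m : nat) (f : 'rV[R]_m -> R) (X : 'I_m -> Omega -> R) :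
  continuous f -> poly_growth f -> (forall j, all_moments P (X j)) ->
  all_moments P (fun w => f (\row_j X j w)).
Proof.
move=> cf fG MX; have [B [MB fB]] := poly_growth_moments cf fG MX.
apply: all_moments_le MB _.
  by apply: measurable_continuous_rV => // j; case: (MX j).
by move=> w; apply: le_trans (fB w _ _) (ler_norm _) => j; rewrite mxE.
Qed.

(** The bounded case is applied to [f] composed with [psi c] in each coordinate. Its partial
    derivatives carry a factor [dpsi c] between 0 and 1 that tends to 1, and [poly_growth_moments]
    supplies the domination. *)
Lemma stein_wiener (m : nat) (h : 'I_m -> R -> 'rV[R]_n)
    (X : 'I_m -> Omega -> R) (f : 'rV[R]_m -> R) :
  (forall j, L2_fun T (h j)) -> (forall j, wiener_integral P T W (h j) (X j)) ->
  C1 f -> poly_growth f -> (forall j, poly_growth (partial j f)) ->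
  let Z := fun w => \row_j X j w in forall a,
  \int[P]_w (X a w * f (Z w)) =
  \sum_b (\int[mu]_(t in `[0, T]) dot (h a t) (h b t)) * \int[P]_w partial b f (Z w).
Proof.
move=> Lh HX fC fG dfG Z a; have [cf _ cdf] := fC.
have MX j : all_moments P (X j) by exact: wiener_integral_moments (Lh j) (HX j).
have mX j : measurable_fun setT (X j) by case: (MX j).
pose c k : R := k.+1%:R.
have c0 k : 0 < c k by exact: ltr0Sn.
pose G k (x : 'rV[R]_m) := \row_j psi (c k) (x 0 j).
have cG k : continuous (G k) by apply: continuous_coord_map; exact: continuous_psi.
have FC k := C1_comp_coord fC (fun t => is_derive_psi t (c0 k)) (continuous_dpsi (c0 k)).
have bounded (F : 'rV[R]_m -> R) : poly_growth F -> forall k, exists K, forall x, `|F (G k x)| <= K.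
  move=> [C [q FG]] k; exists (C * (1 + \sum_(j < m) c k) ^+ q) => x.
  have C0 : 0 <= C.
    by have := le_trans (normr_ge0 _) (FG 0); rewrite normr0 addr0 expr1n mulr1.
  apply: le_trans (FG _) _; rewrite ler_wpM2l// lerXn2r ?nnegrE ?addr_ge0//.
    by apply: sumr_ge0 => *; exact: ltW.
  rewrite lerD2l; apply: le_trans (mx_norm_le_sum _) _; apply: ler_sum => j _.
  by rewrite mxE ltW// normr_psi_lt.
have cvgG x : G k x @[k --> \oo] --> x.
  apply: cvg_rowP => j; under eq_fun do rewrite mxE; exact: cvg_psi.
have dom (F : 'rV[R]_m -> R) : continuous F -> poly_growth F ->
    exists B, all_moments P B /\ forall k w, `|F (G k (Z w))| <= B w.
  move=> cF pF; have [B [MB FB]] := poly_growth_moments cF pF MX.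
  by exists B; split=> // k w; apply: FB => j; rewrite !mxE normr_psi_le.
have mF (F : 'rV[R]_m -> R) k : continuous F -> measurable_fun setT (fun w => F (G k (Z w))).
  move=> cF; apply: (measurable_continuous_rV (f := F \o G k)) => //.
  by move=> x; apply: continuous_comp; [exact: cG|exact: cF].
have mFZ (F : 'rV[R]_m -> R) : continuous F -> measurable_fun setT (fun w => F (Z w)).
  by move=> cF; exact: measurable_continuous_rV.
have Fcvg (F : 'rV[R]_m -> R) x : continuous F -> F (G k x) @[k --> \oo] --> F x.
  by move=> cF; apply: cvg_comp (cvgG x) _; exact: cF.
have lhs : (\int[P]_w (X a w * f (G k (Z w)))) @[k --> \oo] --> \int[P]_w (X a w * f (Z w)).
  have [B [MB fB]] := dom _ cf fG.
  apply: (dominated_cvg_Rintegral measurableT (G := fun w => `|X a w| * B w)) => //.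
  - by move=> k; apply: measurable_funM => //; exact: mF.
  - by apply: measurable_funM => //; exact: mFZ.
  - by apply: all_moments_intg; apply: all_momentsM => //; exact: all_moments_norm.
  - by move=> k w _; rewrite normrM ler_wpM2l.
  - by apply: aeW => w _; apply: cvgM; [exact: cvg_cst|exact: Fcvg].
apply: (cvg_unique _ lhs) => //.
rewrite (_ : (fun k => _) = fun k => \sum_b
    (\int[mu]_(t in `[0, T]) dot (h a t) (h b t)) *
    \int[P]_w (dpsi (c k) (X b w) * partial b f (G k (Z w)))); last first.
  apply/funext => k.
  have [K1 fK] := bounded _ fG k.
  have /(@choice _ _ _)[K2 dfK] : forall j, exists K, forall x, `|partial j f (G k x)| <= K.
    by move=> j; exact: bounded.
  have K2_ge0 j : 0 <= K2 j by apply: le_trans (dfK j 0).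
  have [FC1 FC2] := FC k.
  rewrite (stein_wiener_bounded T_gt0 W_bm Lh HX FC1 (K := K1 + \sum_j K2 j)).
  - apply: eq_bigr => b _; congr (_ * _); apply: eq_Rintegral => w _.
    by rewrite FC2 mxE.
  - by move=> x; apply: le_trans (fK x) _; rewrite lerDl sumr_ge0.
  - move=> j x; rewrite FC2 normrM ger0_norm ?dpsi_ge0//.
    apply: le_trans (ler_piMl _ (dpsi_le1 _ (c0 k))) _ => //.
    apply: le_trans (dfK j x) _; rewrite (bigD1 j)//= addrCA lerDl addr_ge0//.
      exact: le_trans (fK 0).
    exact: sumr_ge0.
apply: cvg_sumr => b _; apply: cvgM; first exact: cvg_cst.
have [B [MB fB]] := dom _ (cdf b) (dfG b).
apply: (dominated_cvg_Rintegral measurableT (G := B)) => //.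
- move=> k; apply: measurable_funM; last exact: mF.
  by apply: measurableT_comp => //; apply: continuous_measurable_fun; exact: continuous_dpsi.
- exact: mFZ.
- exact: all_moments_intg.
- move=> k w _; rewrite normrM ger0_norm ?dpsi_ge0//.
  by apply: le_trans (ler_piMl _ (dpsi_le1 _ (c0 k))) _.
- apply: aeW => w _; rewrite -[X in _ --> X]mul1r; apply: cvgM; last exact: Fcvg.
  exact: cvg_dpsi.
Qed.

End wiener_moments.

(** * Smooth functions of polynomial growth *)

Section smooth_functions.
Context {R : realType} (m : nat).
Implicit Types f g : 'rV[R]_m -> R.

(** The requirement that [smooth_polygrowth] places on each single iterated derivative. *)
Definition smooth1 f := [/\ continuous f, forall x j, derivable f x (delta_mx 0 j) &
  poly_growth f].

Lemma poly_growthD f g : poly_growth f -> poly_growth g -> poly_growth (fun x => f x + g x).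
Proof.
move=> [C [k fC]] [D [l gD]]; exists (`|C| + `|D|), (k + l)%N => x.
apply: le_trans (ler_normD _ _) _; rewrite mulrDl exprD.
have x1 : 1 <= 1 + `|x| by rewrite lerDl.
have e1 q : 1 <= (1 + `|x|) ^+ q by exact: exprn_ege1.
have e0 q : 0 <= (1 + `|x|) ^+ q by apply: le_trans (e1 q).
apply: lerD.
  apply: le_trans (fC x) _; apply: (@le_trans _ _ (`|C| * (1 + `|x|) ^+ k)).
    by rewrite ler_wpM2r// ler_norm.
  by rewrite ler_wpM2l// ler_peMr.
apply: le_trans (gD x) _; apply: (@le_trans _ _ (`|D| * (1 + `|x|) ^+ l)).
  by rewrite ler_wpM2r// ler_norm.
by rewrite ler_wpM2l// ler_peMl.
Qed.

Lemma poly_growthM f g : poly_growth f -> poly_growth g -> poly_growth (fun x => f x * g x).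
Proof.
move=> [C [k fC]] [D [l gD]]; exists (C * D), (k + l)%N => x.
by rewrite normrM exprD mulrACA ler_pM.
Qed.

Lemma poly_growth_cst (c : R) : poly_growth (fun _ : 'rV[R]_m => c).
Proof. by exists `|c|, 0%N => x; rewrite expr0 mulr1. Qed.

Lemma smooth1_is_derive f x j : smooth1 f ->
  is_derive x (delta_mx 0 j) f (partial j f x).
Proof. by case=> _ fd _; exact/derivableP. Qed.

Lemma is_derive_partial f x j (df : R) :
  is_derive x (delta_mx 0 j) f df -> partial j f x = df.
Proof. by case=> _ <-. Qed.

Lemma smooth1_cst (c : R) : smooth1 (fun=> c).
Proof.
split; [exact: cst_continuous| |exact: poly_growth_cst].
by move=> x j; exact: derivable_cst.
Qed.

Lemma smooth1D f g : smooth1 f -> smooth1 g -> smooth1 (fun x => f x + g x).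
Proof.
move=> [cf fd fG] [cg gd gG]; split; [exact: continuous_funD| |exact: poly_growthD].
by move=> x j; exact: derivableD.
Qed.

Lemma smooth1M f g : smooth1 f -> smooth1 g -> smooth1 (fun x => f x * g x).
Proof.
move=> [cf fd fG] [cg gd gG]; split; [exact: continuous_funM| |exact: poly_growthM].
by move=> x j; exact: derivableM.
Qed.

Lemma partial_cst (c : R) j : partial j (fun _ : 'rV[R]_m => c) = fun=> 0.
Proof. by apply/funext => x; apply: is_derive_partial; exact: is_derive_cst. Qed.

Lemma partialD f g j : smooth1 f -> smooth1 g ->
  partial j (fun x => f x + g x) = fun x => partial j f x + partial j g x.
Proof.
move=> fs gs; apply/funext => x; apply: is_derive_partial.
by apply: is_deriveD; exact: smooth1_is_derive.
Qed.

Lemma partialM f g j : smooth1 f -> smooth1 g ->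
  partial j (fun x => f x * g x) = fun x => partial j f x * g x + f x * partial j g x.
Proof.
move=> fs gs; apply/funext => x; apply: is_derive_partial.
have := is_deriveM (smooth1_is_derive x j fs) (smooth1_is_derive x j gs).
by move/is_derive_ext; apply=> //; rewrite addrC mulrC.
Qed.

Inductive algebra_of (B : ('rV[R]_m -> R) -> Prop) : ('rV[R]_m -> R) -> Prop :=
| algebra_base f : B f -> algebra_of B f
| algebra_cst c : algebra_of B (fun=> c)
| algebraD f g : algebra_of B f -> algebra_of B g -> algebra_of B (fun x => f x + g x)
| algebraM f g : algebra_of B f -> algebra_of B g -> algebra_of B (fun x => f x * g x).

Lemma algebra_sum B (I : Type) (s : seq I) (f : I -> 'rV[R]_m -> R) :
  (forall i, algebra_of B (f i)) -> algebra_of B (fun x => \sum_(i <- s) f i x).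
Proof.
move=> Bf; elim: s => [|i s IH].
  by under eq_fun do rewrite big_nil; exact: algebra_cst.
by under eq_fun do rewrite big_cons; exact: algebraD.
Qed.

(** It suffices to differentiate the generators once: if their first partial derivatives stay in the
    algebra, the sum and product rules make the whole algebra stable under [partial], and iterated
    derivatives need no Leibniz formula. Taking for [B] the smooth functions themselves gives
    stability under sums and products. *)
Lemma algebra_smooth (B : ('rV[R]_m -> R) -> Prop) :
  (forall f, B f -> smooth1 f /\ forall j, algebra_of B (partial j f)) ->
  forall f, algebra_of B f -> smooth_polygrowth f.
Proof.
move=> HB.
have key f : algebra_of B f -> smooth1 f /\ forall j, algebra_of B (partial j f).
  elim=> {f} [f /HB//|c|f g Bf [f1 fp] Bg [g1 gp]|f g Bf [f1 fp] Bg [g1 gp]].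
  - by split; [exact: smooth1_cst|move=> j; rewrite partial_cst; exact: algebra_cst].
  - split; first exact: smooth1D.
    by move=> j; rewrite partialD//; exact: algebraD.
  - split; first exact: smooth1M.
    by move=> j; rewrite partialM//; apply: algebraD; exact: algebraM.
move=> f Bf s; have : algebra_of B (foldr (@partial R m) f s).
  by elim: s => //= j s IH; exact: (key _ IH).2.
by case/key.
Qed.

Lemma smooth_smooth1 f : smooth_polygrowth f -> smooth1 f.
Proof. by move=> /(_ [::]). Qed.

Lemma smooth_partial f j : smooth_polygrowth f -> smooth_polygrowth (partial j f).
Proof. by move=> fs s; have := fs (rcons s j); rewrite foldr_rcons. Qed.

Lemma smooth_C1 f : smooth_polygrowth f -> C1 f.
Proof.
move=> fs; have [cf fd _] := smooth_smooth1 fs; split=> // j.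
by have [] := smooth_smooth1 (smooth_partial j fs).
Qed.

Lemma smoothD f g : smooth_polygrowth f -> smooth_polygrowth g ->
  smooth_polygrowth (fun x => f x + g x).
Proof.
move=> fs gs; apply: (@algebra_smooth (@smooth_polygrowth R m)).
  move=> h hs; split; first exact: smooth_smooth1.
  by move=> j; apply/algebra_base/smooth_partial.
by apply: algebraD; exact: algebra_base.
Qed.

Lemma smoothM f g : smooth_polygrowth f -> smooth_polygrowth g ->
  smooth_polygrowth (fun x => f x * g x).
Proof.
move=> fs gs; apply: (@algebra_smooth (@smooth_polygrowth R m)).
  move=> h hs; split; first exact: smooth_smooth1.
  by move=> j; apply/algebra_base/smooth_partial.
by apply: algebraM; exact: algebra_base.
Qed.

Lemma smooth_cst (c : R) : smooth_polygrowth (fun _ : 'rV[R]_m => c).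
Proof.
by apply: (@algebra_smooth (fun=> False)) => //; exact: algebra_cst.
Qed.

End smooth_functions.

Section row_reindex.
Context {R : realType} (p m : nat) (sigma : 'I_p -> 'I_m).

(** Lets functions of two different families of Wiener integrals be read as functions of their
    concatenation. *)
Definition row_reindex (x : 'rV[R]_m) : 'rV[R]_p := \row_i x 0 (sigma i).

Lemma partial_reindex (f : 'rV[R]_p -> R) j : C1 f ->
  partial j (f \o row_reindex) =
  fun x => \sum_i (sigma i == j)%:R * partial i f (row_reindex x).
Proof.
move=> fC; apply/funext => x; apply: is_derive_partial.
apply: is_derive_of_line.
have := C1_is_derive_line (row_reindex x) (\row_i (sigma i == j)%:R) 0 fC.
move/is_derive_ext; apply=> [s|].
  by congr f; apply/rowP => i; rewrite !mxE eqxx.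
by rewrite scale0r addr0; apply: eq_bigr => i _; rewrite mxE.
Qed.

Lemma continuous_reindex : continuous row_reindex.
Proof.
move=> x; apply: (cvg_rowP (F := nbhs x)) => j; rewrite mxE; under eq_fun do rewrite mxE.
exact: continuous_coord.
Qed.

Lemma smooth_reindex (f : 'rV[R]_p -> R) : smooth_polygrowth f ->
  smooth_polygrowth (f \o row_reindex).
Proof.
move=> fs.
pose B (g : 'rV[R]_m -> R) := exists2 u : 'rV[R]_p -> R, smooth_polygrowth u & g = u \o row_reindex.
apply: (@algebra_smooth _ _ B); last by apply: algebra_base; exists f.
move=> _ [u us ->]; have uC := smooth_C1 us; split.
  have [cu _ [C [k uG]]] := smooth_smooth1 us; split.
  - by move=> x; apply: continuous_comp; [exact: continuous_reindex|exact: cu].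
  - move=> x j; have [//] : is_derive x (delta_mx 0 j) (u \o row_reindex) (\sum_i (sigma i == j)%:R * partial i u (row_reindex x)).
    apply: is_derive_of_line.
    have := C1_is_derive_line (row_reindex x) (\row_i (sigma i == j)%:R) 0 uC.
    move/is_derive_ext; apply=> [s|].
      by congr u; apply/rowP => i; rewrite !mxE eqxx.
    by rewrite scale0r addr0; apply: eq_bigr => i _; rewrite mxE.
  - exists (C * (1 + p%:R) ^+ k), k => x; apply: le_trans (uG _) _.
    have C0 : 0 <= C.
      by have := le_trans (normr_ge0 _) (uG 0); rewrite normr0 addr0 expr1n mulr1.
    rewrite -mulrA ler_wpM2l// -exprMn lerXn2r ?nnegrE ?addr_ge0 ?mulr_ge0 ?addr_ge0//.
    apply: (@le_trans _ _ (1 + p%:R * `|x|)); last first.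
      have := normr_ge0 x; have := ler0n R p; nra.
    rewrite lerD2l; apply: le_trans (mx_norm_le_sum _) _.
    apply: (@le_trans _ _ (\sum_(i < p) `|x|)); last by rewrite sumr_const card_ord mulr_natl.
    by apply: ler_sum => i _; rewrite mxE ler_mx_norm_coord.
move=> j; rewrite partial_reindex//; apply: algebra_sum => i.
apply: algebraM; first exact: algebra_cst.
by apply: algebra_base; exists (partial i u) => //; exact: smooth_partial.
Qed.

End row_reindex.

(** * The product space [0, T] x Omega *)

Section slab.
Context {d} {Omega : measurableType d} {R : realType} {P : probability Omega R} {T : R}.
Local Notation mu := (@lebesgue_measure R).
Local Notation M := ((lebesgue_measure : measure (measurableTypeR R) R) \x P)%E.
Local Notation E := (`[0, T]%classic `*` [set: Omega] : set (measurableTypeR R * Omega)).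

Lemma measurable_slab : measurable E.
Proof. by apply: measurableX => //; exact: measurable_itv. Qed.

Lemma slab_lty : (M E < +oo)%E.
Proof.
have I : measurable (`[0, T]%classic : set (measurableTypeR R)) by exact: measurable_itv.
have P1 : P setT = 1%E by exact: probability_setT.
rewrite product_measure1E// [X in (_ * X)%E]P1 mule1.
by rewrite -[X in (X < _)%E]/(mu _) lebesgue_measure_itv/=; case: ifP => // _; rewrite -EFinB ltry.
Qed.

(** Turns the iterated integral of [norm12] into one integral over a product measure, where the L^2
    lemmas above apply. *)
Lemma ge0_integral_slab (f : measurableTypeR R * Omega -> \bar R) :
  measurable_fun E f -> (forall p, E p -> (0 <= f p)%E) ->
  (\int[M]_(p in E) f p = \int[P]_w \int[mu]_(t in `[0%R, T]) f (t, w))%E.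
Proof.
move=> mf f0.
rewrite integral_mkcond (fubini_tonelli2 (f \_ E)).
- rewrite /fubini_G; apply: eq_integral => w _; rewrite [RHS]integral_mkcond.
  apply: eq_integral => t _; rewrite !patchE.
  by rewrite in_setX/= in_setT andbT.
- by apply/(measurable_restrict _ measurable_slab measurableT); rewrite setTI.
- by move=> p; rewrite patchE; case: ifPn => // /[!inE]; exact: f0.
Qed.

Lemma measurable_slab_integral (f : measurableTypeR R * Omega -> \bar R) :
  measurable_fun E f -> (forall p, (0 <= f p)%E) ->
  measurable_fun setT (fun w => \int[mu]_(t in `[0%R, T]) f (t, w))%E.
Proof.
move=> mf f0.
rewrite (_ : (fun w => _) = fubini_G mu (f \_ E)); last first.
  apply/funext => w; rewrite /fubini_G [LHS]integral_mkcond.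
  apply: eq_integral => t _; rewrite !patchE.
  by rewrite in_setX/= in_setT andbT.
apply: (@measurable_fun_fubini_tonelli_G _ _ _ _ _ (@lebesgue_measure R)).
- by apply/(measurable_restrict _ measurable_slab measurableT); rewrite setTI.
- by move=> p; rewrite patchE; case: ifPn => // _.
Qed.

Lemma measurable_slab_fst (v : measurableTypeR R -> R) : measurable_fun `[0, T]%classic v ->
  measurable_fun E (fun p => v p.1).
Proof.
move=> mv; apply: (measurable_comp (F := `[0, T]%classic : set (measurableTypeR R))) => //.
- by move=> _ [p [p1 _] <-].
- exact: measurable_funTS.
Qed.

Lemma measurable_slab_snd (u : Omega -> R) : measurable_fun setT u ->
  measurable_fun E (fun p => u p.2).
Proof.
by move=> mu_; apply: measurable_funTS; apply: measurableT_comp.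
Qed.

Lemma integral_iterated (u : Omega -> R) (v : measurableTypeR R -> R) :
  intg P setT u -> intg mu `[0, T]%classic v ->
  (\int[P]_w \int[mu]_(t in `[0%R, T]) (u w * v t)%:E)%E =
  ((\int[P]_w u w) * \int[mu]_(t in `[0, T]) v t)%:E.
Proof.
have mI : measurable (`[0, T]%classic : set (measurableTypeR R)) by exact: measurable_itv.
move=> iu iv; set Iv := \int[mu]_(t in _) _.
rewrite (eq_integral (fun w => (u w * Iv)%:E)); last first.
  by move=> w _; rewrite -EFin_Rintegral ?RintegralZl//; exact: intgZ.
have iuI : intg P setT (fun w => u w * Iv) by under eq_fun do rewrite mulrC; exact: intgZ.
by rewrite -EFin_Rintegral// RintegralZr.
Qed.

Lemma intg_slab (u : Omega -> R) (v : measurableTypeR R -> R) :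
  intg P setT u -> intg mu `[0, T]%classic v -> intg M E (fun p => u p.2 * v p.1).
Proof.
move=> iu iv; have mu_ := intg_meas iu; have mv := intg_meas iv.
have muv : measurable_fun E (fun p => u p.2 * v p.1).
  apply: measurable_funM; [exact: measurable_slab_snd|exact: measurable_slab_fst].
apply/integrableP; split; first exact/measurable_EFinP.
rewrite ge0_integral_slab//; last first.
  by apply: measurableT_comp => //; exact/measurable_EFinP.
have := @integral_iterated (fun w => `|u w|) (fun t => `|v t|).
move=> /(_ (integrable_norm iu) (integrable_norm iv)) E.
rewrite [ltLHS](_ : _ = (\int[P]_w \int[mu]_(t in `[0%R, T]) (`|u w| * `|v t|)%:E)%E).
  by rewrite E ltry.
by apply: eq_integral => w _; apply: eq_integral => t _; rewrite /= normrM.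
Qed.

Lemma Rintegral_slab (u : Omega -> R) (v : measurableTypeR R -> R) :
  intg P setT u -> intg mu `[0, T]%classic v ->
  \int[M]_(p in E) (u p.2 * v p.1) = (\int[P]_w u w) * \int[mu]_(t in `[0, T]) v t.
Proof.
move=> iu iv; have iuv := intg_slab iu iv.
apply: EFin_inj; rewrite EFin_Rintegral//; last exact: measurable_slab.
rewrite integral_mkcond.
have /integral21_prod_meas1 <- : M.-integrable setT ((fun p => (u p.2 * v p.1)%:E) \_ E).
  by apply/(integrable_mkcond _ measurable_slab).
rewrite -(integral_iterated iu iv); apply: eq_integral => w _.
rewrite /fubini_G [RHS]integral_mkcond; apply: eq_integral => t _; rewrite !patchE.
by rewrite in_setX/= in_setT andbT.
Qed.

Lemma sqint_slab (u : Omega -> R) (v : measurableTypeR R -> R) :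
  sqint P setT u -> sqint mu `[0, T]%classic v -> sqint M E (fun p => u p.2 * v p.1).
Proof.
move=> [mu_ su] [mv sv]; split.
  apply: measurable_funM; [exact: measurable_slab_snd|exact: measurable_slab_fst].
have := intg_slab su sv; congr intg; apply/funext => p /=.
by rewrite exprMn.
Qed.
End slab.

(** * Duality and uniqueness of the Malliavin derivative *)

Section reindex_partial.
Context {R : realType} (p m : nat) (sigma : 'I_p -> 'I_m) (f : 'rV[R]_p -> R).
Hypotheses (fC : C1 f).

Lemma partial_reindex_inj x i : injective sigma ->
  partial (sigma i) (f \o row_reindex sigma) x = partial i f (row_reindex sigma x).
Proof.
move=> sI; rewrite partial_reindex// (bigD1 i)//= eqxx mul1r big1 ?addr0// => j ji.
by rewrite (inj_eq sI) (negbTE ji) mul0r.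
Qed.

Lemma partial_reindex0 x j : (forall i, sigma i != j) ->
  partial j (f \o row_reindex sigma) x = 0.
Proof.
by move=> sj; rewrite partial_reindex// big1// => i _; rewrite (negbTE (sj i)) mul0r.
Qed.

End reindex_partial.

Definition split_case (m1 m2 : nat) (U : Type) (x : 'I_m1 -> U) (y : 'I_m2 -> U)
    (c : 'I_(m1 + m2)) : U :=
  match fintype.split c with inl a => x a | inr b => y b end.

Lemma split_case_lshift m1 m2 U x y a :
  @split_case m1 m2 U x y (lshift m2 a) = x a.
Proof. by rewrite /split_case -[lshift m2 a]/(unsplit (inl a)) unsplitK. Qed.

Lemma split_case_rshift m1 m2 U x y b :
  @split_case m1 m2 U x y (rshift m1 b) = y b.
Proof. by rewrite /split_case -[rshift m1 b]/(unsplit (inr b)) unsplitK. Qed.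

Lemma split_caseP m1 m2 (U : Type) (Q : 'I_(m1 + m2) -> U -> Prop) x y :
  (forall a, Q (lshift m2 a) (x a)) -> (forall b, Q (rshift m1 b) (y b)) ->
  forall c, Q c (@split_case m1 m2 U x y c).
Proof.
move=> Qx Qy c; rewrite -[c]splitK; case: (fintype.split c) => [a|b] /=.
  by rewrite split_case_lshift.
by rewrite split_case_rshift.
Qed.

Lemma dotC {R : realType} n (u v : 'rV[R]_n) : dot u v = dot v u.
Proof. by apply: eq_bigr => i _; rewrite mulrC. Qed.

Lemma dot_suml {R : realType} n (J : Type) (s : seq J) (a : J -> R) (u : J -> 'rV[R]_n) v :
  dot (\sum_(j <- s) a j *: u j) v = \sum_(j <- s) a j * dot (u j) v.
Proof.
rewrite /dot; under eq_bigr do rewrite summxE mulr_suml.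
rewrite exchange_big; apply: eq_bigr => j _; rewrite mulr_sumr.
by apply: eq_bigr => i _; rewrite mxE mulrA.
Qed.

Section malliavin_duality.
Context {d} {Omega : measurableType d} {R : realType} {P : probability Omega R}.
Context {T : R} {n : nat} {W : R -> Omega -> 'rV[R]_n}.
Hypotheses (T_gt0 : 0 < T) (W_bm : brownian_motion P T W).
Local Notation mu := (@lebesgue_measure R).
Local Notation M := ((lebesgue_measure : measure (measurableTypeR R) R) \x P)%E.
Local Notation E := (`[0, T]%classic `*` [set: Omega] : set (measurableTypeR R * Omega)).
Let I : set (measurableTypeR R) := `[0, T]%classic.
Let mI : measurable I. Proof. exact: measurable_itv. Qed.
Let mE : measurable E. Proof. exact: measurable_slab. Qed.

Lemma smooth_moments (m : nat) (f : 'rV[R]_m -> R) (h : 'I_m -> R -> 'rV[R]_n)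
    (X : 'I_m -> Omega -> R) : smooth_polygrowth f ->
  (forall j, L2_fun T (h j)) -> (forall j, wiener_integral P T W (h j) (X j)) ->
  all_moments P (fun w => f (\row_j X j w)).
Proof.
move=> /smooth_smooth1[cf _ fG] Lh HX; apply: all_moments_poly_growth => // j.
exact: (wiener_integral_moments T_gt0 W_bm (Lh j)).
Qed.

Lemma smooth_rv_moments F DF : smooth_rv P T W F DF -> all_moments P F.
Proof.
move=> [m [f [h [X [fs Lh HX FE _]]]]].
have -> : F = fun w => f (\row_j X j w) by apply/funext.
exact: smooth_moments Lh HX.
Qed.

Lemma smooth_rv_sqint F DF i : smooth_rv P T W F DF ->
  sqint M E (fun p => DF p.1 p.2 0 i).
Proof.
move=> [m [f [h [X [fs Lh HX _ DE]]]]].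
have -> : (fun p => DF p.1 p.2 0 i) = fun p : measurableTypeR R * Omega =>
    \sum_j (partial j f (\row_k X k p.2) * h j p.1 0 i).
  by apply/funext => p; rewrite DE summxE; apply: eq_bigr => j _; rewrite mxE.
apply: sqint_sum => // j; apply: (sqint_slab (u := fun w => partial j f (\row_k X k w)) (v := fun t => h j t 0 i)).
  exact/all_moments_sqint/(smooth_moments (smooth_partial j fs) Lh HX).
exact: L2_fun_sqint.
Qed.

(** Both variables are expressed over the concatenated family; a function reading one block has zero
    partial derivatives in the other, so the derivative splits. *)
Lemma smooth_rvD a b F DF G DG : smooth_rv P T W F DF -> smooth_rv P T W G DG ->
  smooth_rv P T W (fun w => a * F w + b * G w) (fun t w => a *: DF t w + b *: DG t w).
Proof.
move=> [m1 [f [h [X [fs Lh HX FE DFE]]]]] [m2 [g [k [Y [gs Lk HY GE DGE]]]]].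
pose l := @lshift m1 m2; pose r := @rshift m1 m2.
pose Z w := \row_c split_case X Y c w.
have Zl w : row_reindex l (Z w) = \row_j X j w.
  by apply/rowP => j; rewrite !mxE split_case_lshift.
have Zr w : row_reindex r (Z w) = \row_j Y j w.
  by apply/rowP => j; rewrite !mxE split_case_rshift.
have fls : smooth_polygrowth (f \o row_reindex l) by exact: smooth_reindex.
have grs : smooth_polygrowth (g \o row_reindex r) by exact: smooth_reindex.
exists (m1 + m2)%N, (fun x => a * (f \o row_reindex l) x + b * (g \o row_reindex r) x),
  (split_case h k), (split_case X Y); split.
- by apply: smoothD; apply: smoothM => //; exact: smooth_cst.
- exact: (@split_caseP _ _ _ (fun _ u => L2_fun T u)).
- by apply: (@split_caseP _ _ _ (fun c => wiener_integral P T W (split_case h k c))) => c;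
    rewrite (split_case_lshift, split_case_rshift).
- by move=> w; rewrite /= Zl Zr FE GE.
move=> t w; rewrite DFE DGE big_split_ord/= !scaler_sumr.
have pE c x : partial c (fun x => a * (f \o row_reindex l) x + b * (g \o row_reindex r) x) x =
    a * partial c (f \o row_reindex l) x + b * partial c (g \o row_reindex r) x.
  have := is_derive_partial (is_deriveD
    (is_deriveZ a (smooth1_is_derive x c (smooth_smooth1 fls)))
    (is_deriveZ b (smooth1_is_derive x c (smooth_smooth1 grs)))).
  by move=> <-.
congr (_ + _); apply: eq_bigr => j _; rewrite pE.
- rewrite split_case_lshift (partial_reindex_inj (smooth_C1 fs) _ _ (@lshift_inj m1 m2)).
  rewrite (partial_reindex0 (smooth_C1 gs)) ?mulr0 ?addr0 ?Zl ?scalerA// => i.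
  by rewrite eq_rlshift.
- rewrite split_case_rshift (partial_reindex_inj (smooth_C1 gs) _ _ (@rshift_inj m1 m2)).
  rewrite (partial_reindex0 (smooth_C1 fs)) ?mulr0 ?add0r ?Zr ?scalerA// => i.
  by rewrite eq_lrshift.
Qed.

(** Stein's identity for the Wiener integral [Y b], applied to [F] times the partial derivative of
    [g] in [b]. The derivatives that fall on [F] make up the inner product of [DF] and [DG]; those
    that fall on the other factor move to the right-hand side. *)
Lemma smooth_rv_duality G DG : smooth_rv P T W G DG ->
  exists2 delta : Omega -> R, sqint P setT delta & forall F DF, smooth_rv P T W F DF ->
    \int[M]_(p in E) dot (DF p.1 p.2) (DG p.1 p.2) = \int[P]_w (F w * delta w).
Proof.
move=> [m2 [g [k [Y [gs Lk HY GE DGE]]]]].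
pose ip (u v : R -> 'rV[R]_n) := \int[mu]_(t in I) dot (u t) (v t).
(* The divergence of [DG], that is, minus the Ornstein-Uhlenbeck operator applied to [G]. It does
   not depend on [F]. *)
exists (fun w => \sum_b (Y b w * partial b g (\row_j Y j w) -
  \sum_i ip (k b) (k i) * partial i (partial b g) (\row_j Y j w))).
  apply: all_moments_sqint; apply: all_moments_sum => b.
  under eq_fun do rewrite -[- _]mulN1r.
  apply: all_momentsD.
    apply: all_momentsM; first exact: wiener_integral_moments (Lk b) (HY b).
    exact: smooth_moments (smooth_partial b gs) Lk HY.
  apply: all_momentsM; first exact: all_moments_cst.
  apply: all_moments_sum => i; apply: all_momentsM; first exact: all_moments_cst.
  exact: smooth_moments (smooth_partial i (smooth_partial b gs)) Lk HY.
move=> F DF [m1 [f [h [X [fs Lh HX FE DFE]]]]].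
pose l := @lshift m1 m2; pose r := @rshift m1 m2.
pose H := split_case h k; pose Z w := \row_c split_case X Y c w.
have Zl w : row_reindex l (Z w) = \row_j X j w.
  by apply/rowP => j; rewrite !mxE split_case_lshift.
have Zr w : row_reindex r (Z w) = \row_j Y j w.
  by apply/rowP => j; rewrite !mxE split_case_rshift.
have LH c : L2_fun T (H c) by exact: (@split_caseP _ _ _ (fun _ u => L2_fun T u)).
have HZ c : wiener_integral P T W (H c) (split_case X Y c).
  move: c; apply: (@split_caseP _ _ _ (fun c => wiener_integral P T W (H c))) => c;
    by rewrite /H (split_case_lshift, split_case_rshift).
have fls : smooth_polygrowth (f \o row_reindex l) by exact: smooth_reindex.
pose A a b w := partial a f (\row_j X j w) * partial b g (\row_j Y j w).
have MA a b : all_moments P (A a b).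
  by apply: all_momentsM; [exact: smooth_moments (smooth_partial a fs) Lh HX|
    exact: smooth_moments (smooth_partial b gs) Lk HY].
have idot u v : L2_fun T u -> L2_fun T v -> intg mu I (fun t => dot (u t) (v t)).
  by move=> Lu Lv; apply: intg_sum => // i _; apply: sqint_mul => //; exact: L2_fun_sqint.
have MF : all_moments P F.
  have -> : F = fun w => f (\row_j X j w) by apply/funext.
  exact: smooth_moments Lh HX.
transitivity (\sum_b \sum_a ip (k b) (h a) * \int[P]_w A a b w).
  rewrite (_ : (fun p => _) = fun p : measurableTypeR R * Omega =>
      \sum_b \sum_a (A a b p.2 * dot (k b p.1) (h a p.1))); last first.
    apply/funext => p; rewrite DFE DGE dotC dot_suml; apply: eq_bigr => b _.
    rewrite dotC dot_suml mulr_sumr; apply: eq_bigr => a _.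
    by rewrite (dotC (h a _)) /A mulrA (mulrC (partial b g _)).
  have iA a b : intg M E (fun p => A a b p.2 * dot (k b p.1) (h a p.1)).
    apply: (intg_slab (u := A a b) (v := fun t => dot (k b t) (h a t))); last exact: idot.
    exact: all_moments_intg.
  rewrite Rintegral_sum//; last by move=> b _; exact: intg_sum.
  apply: eq_bigr => b _; rewrite Rintegral_sum//.
  apply: eq_bigr => a _; rewrite mulrC.
  apply: (Rintegral_slab (u := A a b) (v := fun t => dot (k b t) (h a t))); last exact: idot.
  exact: all_moments_intg.
have MYg b : all_moments P (fun w => F w * (Y b w * partial b g (\row_j Y j w))).
  apply: all_momentsM => //; apply: all_momentsM.
    exact: wiener_integral_moments (Lk b) (HY b).
  exact: smooth_moments (smooth_partial b gs) Lk HY.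
have Mg2 b i : all_moments P (fun w => F w * partial i (partial b g) (\row_j Y j w)).
  apply: all_momentsM => //.
  exact: smooth_moments (smooth_partial i (smooth_partial b gs)) Lk HY.
have iS b : intg P setT (fun w => \sum_i ip (k b) (k i) *
    (F w * partial i (partial b g) (\row_j Y j w))).
  by apply: intg_sum => // i _; apply: intgZ => //; exact: all_moments_intg.
rewrite (_ : (fun w => F w * _) = fun w => \sum_b (F w * (Y b w * partial b g (\row_j Y j w)) -
    \sum_i ip (k b) (k i) * (F w * partial i (partial b g) (\row_j Y j w)))); last first.
  apply/funext => w; rewrite mulr_sumr; apply: eq_bigr => b _; rewrite mulrBr mulr_sumr.
  by congr (_ - _); apply: eq_bigr => i _; rewrite mulrCA.
rewrite Rintegral_sum//; last by move=> b _; apply: intgB => //; exact: all_moments_intg.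
apply: eq_bigr => b _.
rewrite RintegralB//; [|exact: all_moments_intg|exact: iS].
have gbs := smooth_partial b gs.
have grs : smooth_polygrowth (partial b g \o row_reindex r) by exact: smooth_reindex.
pose phi x := (f \o row_reindex l) x * (partial b g \o row_reindex r) x.
have phis : smooth_polygrowth phi by exact: smoothM.
have phip c : poly_growth (partial c phi) by case: (smooth_smooth1 (smooth_partial c phis)).
have phig : poly_growth phi by case: (smooth_smooth1 phis).
have pphi c : partial c phi = fun x => partial c (f \o row_reindex l) x * partial b g (row_reindex r x) +
    f (row_reindex l x) * partial c (partial b g \o row_reindex r) x.
  by rewrite /phi partialM//; exact: smooth_smooth1.
have := stein_wiener T_gt0 W_bm LH HZ (smooth_C1 phis) phig phip (r b).
rewrite big_split_ord/= -/(Z _) /H !split_case_rshift => S.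
rewrite (_ : \int[P]_w _ = \int[P]_w (Y b w * phi (Z w))); last first.
  by apply: eq_Rintegral => w _; rewrite /phi /= Zl Zr FE mulrCA.
rewrite S Rintegral_sum//; last by move=> i _; apply: intgZ => //; exact: all_moments_intg.
apply/eqP; rewrite eq_sym subr_eq; apply/eqP; congr (_ + _); apply: eq_bigr => c _.
- rewrite split_case_lshift; congr (_ * _); apply: eq_Rintegral => w _.
  rewrite pphi (partial_reindex_inj (smooth_C1 fs) _ _ (@lshift_inj m1 m2)).
  rewrite (partial_reindex0 (smooth_C1 gbs)) ?mulr0 ?addr0 ?Zl ?Zr// => i.
  by rewrite eq_rlshift.
- rewrite split_case_rshift RintegralZl//; last exact: all_moments_intg.
  congr (_ * _); apply: eq_Rintegral => w _.
  rewrite pphi (partial_reindex_inj (smooth_C1 gbs) _ _ (@rshift_inj m1 m2)).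
  rewrite (partial_reindex0 (smooth_C1 fs)) ?mul0r ?add0r ?Zl ?Zr ?FE// => i.
  by rewrite eq_lrshift.
Qed.

End malliavin_duality.

(** Removes the square root in [norm12]. Values may be infinite, so eventual finiteness is
    transported along with convergence. *)
Lemma poweR12_cvg0 {R : realType} (Q : nat -> \bar R) : (forall k, (0 <= Q k)%E) ->
  (Q k `^ 2^-1)%E @[k --> \oo] --> 0%E <-> Q k @[k --> \oo] --> 0%E.
Proof.
move=> Q0.
have E k : Q k \is a fin_num -> fine (Q k `^ 2^-1)%E = Num.sqrt (fine (Q k)).
  by move=> Qfin; rewrite -[in LHS](fineK Qfin) poweR_EFin/= powR12_sqrt// fine_ge0.
split=> /fine_cvgP[Qfin Q_0]; apply/fine_cvgP.
  have Qfin' : \forall k \near \oo, Q k \is a fin_num.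
    apply: filterS Qfin => k; rewrite !ge0_fin_numE ?poweR_ge0//.
    by apply: lty_poweRy; rewrite invr_eq0.
  split=> //.
  apply: cvg_trans (_ : (fine (Q k `^ 2^-1)%E) ^+ 2 @[k --> \oo] --> (0 : R)); last first.
    by rewrite -[X in _ --> X](expr0n R 2); exact: cvg_sqr.
  apply: near_eq_cvg; apply: filterS Qfin' => k kfin /=.
  by rewrite E// sqr_sqrtr// fine_ge0.
split.
  by apply: filterS Qfin => k; rewrite !ge0_fin_numE ?poweR_ge0//; exact: poweR_lty.
apply: cvg_trans (_ : Num.sqrt (fine (Q k)) @[k --> \oo] --> (0 : R)); last first.
  apply: cvg_of_sqr_le Q_0 => k /=; rewrite subr0 sqr_sqrtr// fine_ge0//.
by apply: near_eq_cvg; apply: filterS Qfin => k kfin /=; rewrite E.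
Qed.

(** * The norm of the domain as a product-space norm, and uniqueness of the derivative *)

Section uniqueness.
Context {d} {Omega : measurableType d} {R : realType} {P : probability Omega R}.
Context {T : R} {n : nat} {W : R -> Omega -> 'rV[R]_n}.
Hypotheses (T_gt0 : 0 < T) (W_bm : brownian_motion P T W).
Local Notation mu := (@lebesgue_measure R).
Local Notation M := ((lebesgue_measure : measure (measurableTypeR R) R) \x P)%E.
Local Notation E := (`[0, T]%classic `*` [set: Omega] : set (measurableTypeR R * Omega)).
Let mE : measurable E. Proof. exact: measurable_slab. Qed.

Lemma norm12E (u : Omega -> R) (D : R -> Omega -> 'rV[R]_n) :
  measurable_fun setT u -> (forall i, measurable_fun E (fun p => D p.1 p.2 0 i)) ->
  norm12 P T u D = ((\int[P]_w (u w ^+ 2)%:E + \int[M]_(p in E) (sqnorm (D p.1 p.2))%:E) `^ 2^-1)%E.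
Proof.
move=> mu_ mD; have msq : measurable_fun E (fun p => (sqnorm (D p.1 p.2))%:E).
  by apply/measurable_EFinP; exact: measurable_sqnorm.
have sq0 t w : (0 <= (sqnorm (D t w))%:E)%E by rewrite lee_fin sqnorm_ge0.
rewrite /norm12 ge0_integral_slab// ge0_integralD//.
- by move=> w _; rewrite lee_fin sqr_ge0.
- by apply/measurable_EFinP; exact: measurable_funX.
- by move=> w _; exact: integral_ge0.
- exact: (measurable_slab_integral msq).
Qed.

Lemma norm12_cvg0 (u : nat -> Omega -> R) (D : nat -> R -> Omega -> 'rV[R]_n) :
  (forall k, measurable_fun setT (u k)) ->
  (forall k i, measurable_fun E (fun p => D k p.1 p.2 0 i)) ->
  norm12 P T (u k) (D k) @[k --> \oo] --> 0%E <->
  (\int[P]_w (u k w ^+ 2)%:E)%E @[k --> \oo] --> 0%E /\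
  (\int[M]_(p in E) (sqnorm (D k p.1 p.2))%:E)%E @[k --> \oo] --> 0%E.
Proof.
move=> mu_ mD.
have u0 k : (0 <= \int[P]_w (u k w ^+ 2)%:E)%E.
  by apply: integral_ge0 => w _; rewrite lee_fin sqr_ge0.
have D0 k : (0 <= \int[M]_(p in E) (sqnorm (D k p.1 p.2))%:E)%E.
  by apply: integral_ge0 => w _; rewrite lee_fin sqnorm_ge0.
under eq_fun do rewrite norm12E//.
rewrite poweR12_cvg0; last by move=> k; rewrite adde_ge0.
split=> [S|[cu cD]]; last by rewrite -[X in _ --> X]adde0; apply: cvgeD.
split.
  apply: (squeeze_cvge _ (cvg_cst 0%E) S); near=> k.
  by rewrite u0/= leeDl.
apply: (squeeze_cvge _ (cvg_cst 0%E) S); near=> k.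
by rewrite D0/= leeDr.
Unshelve. all: by end_near. Qed.

(** Finiteness of the approximating norms makes [xi] and the coordinates of [D] square-integrable,
    and the convergence can then be stated with real integrals. *)
Lemma malliavin_derivative_cvg (xi : Omega -> R) D : malliavin_derivative P T W xi D ->
  [/\ sqint P setT xi, forall i, sqint M E (fun p => D p.1 p.2 0 i) &
  exists (F : nat -> Omega -> R) (DF : nat -> R -> Omega -> 'rV[R]_n),
  [/\ forall k, smooth_rv P T W (F k) (DF k),
    (\int[P]_w ((F k w - xi w) ^+ 2)) @[k --> \oo] --> 0 &
    forall i, (\int[M]_(p in E) ((DF k p.1 p.2 0 i - D p.1 p.2 0 i) ^+ 2)) @[k --> \oo] --> 0]].
Proof.
move=> [mxi mD [F [DF [sF]]]].
have mF k : measurable_fun setT (F k) by have [] := smooth_rv_moments T_gt0 W_bm (sF k).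
have mDF k i := sqint_meas (smooth_rv_sqint T_gt0 W_bm i (sF k)).
have mB k i : measurable_fun E (fun p => (DF k p.1 p.2 - D p.1 p.2) 0 i).
  rewrite (_ : (fun p => _) = (fun p : measurableTypeR R * Omega => DF k p.1 p.2 0 i - D p.1 p.2 0 i)).
    exact: (measurable_funB (mDF k i) (mD i)).
  by apply/funext => p; rewrite !mxE.
move/norm12_cvg0 => -[k|k i|cF cDF]; [exact: measurable_funB|exact: mB|].
have cDFi i : (\int[M]_(p in E) ((DF k p.1 p.2 0 i - D p.1 p.2 0 i) ^+ 2)%:E)%E @[k --> \oo] --> 0%E.
  apply: (squeeze_cvge _ (cvg_cst 0%E) cDF); near=> k.
  apply/andP; split; first by apply: integral_ge0 => w _; rewrite lee_fin sqr_ge0.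
  apply: ge0_le_integral => //.
  - by move=> p _; rewrite lee_fin sqr_ge0.
  - by apply/measurable_EFinP; apply: measurable_funX; exact: (measurable_funB (mDF k i) (mD i)).
  - by apply/measurable_EFinP; apply: measurable_sqnorm => j; exact: mB.
  - move=> p _; rewrite lee_fin.
    by have := sqnorm_coord_le (DF k p.1 p.2 - D p.1 p.2) i; rewrite !mxE.
split.
- by apply: (sqint_of_cvg0 measurableT _ mxi cF) => k; exact: (all_moments_sqint (smooth_rv_moments T_gt0 W_bm (sF k))).
- by move=> i; apply: (sqint_of_cvg0 mE _ (mD i) (cDFi i)) => k; exact: (smooth_rv_sqint T_gt0 W_bm i (sF k)).
exists F, DF; split=> // [|i]; first exact: fine_cvg cF.
exact: fine_cvg (cDFi i).
Unshelve. all: by end_near. Qed.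

Definition slab_dot (D D' : R -> Omega -> 'rV[R]_n) :=
  \int[M]_(p in E) dot (D p.1 p.2) (D' p.1 p.2).

Lemma cvg_slab_dot (DF : nat -> R -> Omega -> 'rV[R]_n) (D D' : R -> Omega -> 'rV[R]_n) :
  (forall k i, sqint M E (fun p => DF k p.1 p.2 0 i)) ->
  (forall i, sqint M E (fun p => D p.1 p.2 0 i)) ->
  (forall i, sqint M E (fun p => D' p.1 p.2 0 i)) ->
  (forall i, (\int[M]_(p in E) ((DF k p.1 p.2 0 i - D p.1 p.2 0 i) ^+ 2)) @[k --> \oo] --> 0) ->
  slab_dot (DF k) D' @[k --> \oo] --> slab_dot D D'.
Proof.
move=> sF sD sD' cF.
have dE (X : R -> Omega -> 'rV[R]_n) : (forall i, sqint M E (fun p => X p.1 p.2 0 i)) ->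
    slab_dot X D' = \sum_i \int[M]_(p in E) (X p.1 p.2 0 i * D' p.1 p.2 0 i).
  by move=> sX; rewrite /slab_dot Rintegral_sum// => i _; exact: sqint_mul.
rewrite dE//; under eq_fun do rewrite dE//.
apply: cvg_sumr => i _.
have z : (\int[M]_(p in E) ((D' p.1 p.2 0 i - D' p.1 p.2 0 i) ^+ 2)) @[_ --> \oo] --> (0 : R).
  under eq_Rintegral do rewrite subrr expr0n.
  by rewrite Rintegral_cst// mul0r; exact: cvg_cst.
exact: (cvg_Rintegral_mul mE (fun k => sF k i) (fun=> sD' i) (sD i) (sD' i) (cF i) z).
Qed.

(* By duality, the inner product of a derivative of [xi] with [DK] is
   [E[xi delta(K)]] for every smooth [K], whatever the derivative. *)
Lemma malliavin_derivative_unique (xi : Omega -> R) D D' :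
  malliavin_derivative P T W xi D -> malliavin_derivative P T W xi D' -> forall i,
  {ae M, forall p, p.1 \in `[0, T] -> D p.1 p.2 0 i = D' p.1 p.2 0 i}.
Proof.
move=> /malliavin_derivative_cvg[sxi sD [F [DF [sF cF cDF]]]].
move=> /malliavin_derivative_cvg[_ sD' [G [DG [sG cG cDG]]]] i.
have sDF k j := smooth_rv_sqint T_gt0 W_bm j (sF k).
have sDG k j := smooth_rv_sqint T_gt0 W_bm j (sG k).
have dot_eq K DK : smooth_rv P T W K DK -> slab_dot D DK = slab_dot D' DK.
  move=> sK; have [de sde dE] := smooth_rv_duality T_gt0 W_bm sK.
  have key (U : nat -> Omega -> R) (DU : nat -> R -> Omega -> 'rV[R]_n)
      (D0 : R -> Omega -> 'rV[R]_n) : (forall k, smooth_rv P T W (U k) (DU k)) ->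
      (forall i, sqint M E (fun p => D0 p.1 p.2 0 i)) ->
      (\int[P]_w ((U k w - xi w) ^+ 2)) @[k --> \oo] --> 0 ->
      (forall i, (\int[M]_(p in E) ((DU k p.1 p.2 0 i - D0 p.1 p.2 0 i) ^+ 2)) @[k --> \oo] --> 0) ->
      slab_dot D0 DK = \int[P]_w (xi w * de w).
    move=> sU sD0 cU cDU.
    have c1 : slab_dot (DU k) DK @[k --> \oo] --> slab_dot D0 DK.
      exact: (cvg_slab_dot (fun k j => smooth_rv_sqint T_gt0 W_bm j (sU k)) sD0
        (fun j => smooth_rv_sqint T_gt0 W_bm j sK) cDU).
    apply: (cvg_unique _ c1) => //.
    rewrite /= (_ : (fun k => slab_dot (DU k) DK) = fun k => \int[P]_w (U k w * de w)); last first.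
      by apply/funext => k; exact: dE (sU k).
    have z : (\int[P]_w ((de w - de w) ^+ 2)) @[_ --> \oo] --> (0 : R).
      under eq_Rintegral do rewrite subrr expr0n.
      by rewrite Rintegral_cst// mul0r; exact: cvg_cst.
    exact: (cvg_Rintegral_mul measurableT (fun k => all_moments_sqint
      (smooth_rv_moments T_gt0 W_bm (sU k))) (fun=> sde) sxi sde cU z).
  by rewrite (key F DF D)// (key G DG D').
have slab_dotC (A B : R -> Omega -> 'rV[R]_n) : slab_dot A B = slab_dot B A.
  by apply: eq_Rintegral => p _; exact: dotC.
(* [D] is a limit of derivatives of smooth variables, against which [D] and [D'] have the same inner
   products. The symmetric argument for [D'] then gives norm 0 for [D - D']. *)
have E1 : slab_dot D D = slab_dot D D'.
  have c1 := cvg_slab_dot sDF sD sD cDF; apply: (cvg_unique _ c1) => //.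
  rewrite /= (_ : (fun k => slab_dot (DF k) D) = fun k => slab_dot (DF k) D'); last first.
    by apply/funext => k; rewrite slab_dotC (dot_eq _ _ (sF k)) slab_dotC.
  exact: cvg_slab_dot sDF sD sD' cDF.
have E2 : slab_dot D D' = slab_dot D' D'.
  have c1 := cvg_slab_dot sDG sD' sD' cDG; apply/esym; apply: (cvg_unique _ c1) => //.
  rewrite /= (_ : (fun k => slab_dot (DG k) D') = fun k => slab_dot (DG k) D); last first.
    by apply/funext => k; rewrite slab_dotC -(dot_eq _ _ (sG k)) slab_dotC.
  by rewrite (slab_dotC D); exact: cvg_slab_dot sDG sD' sD cDG.
have sB j : sqint M E (fun p => D p.1 p.2 0 j - D' p.1 p.2 0 j) by exact: sqintB.
have idot (A B : R -> Omega -> 'rV[R]_n) : (forall i, sqint M E (fun p => A p.1 p.2 0 i)) ->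
    (forall i, sqint M E (fun p => B p.1 p.2 0 i)) ->
    intg M E (fun p => dot (A p.1 p.2) (B p.1 p.2)).
  by move=> sA sB'; apply: intg_sum => // j _; exact: sqint_mul.
have I0 : \int[M]_(p in E) (\sum_j (D p.1 p.2 0 j - D' p.1 p.2 0 j) ^+ 2) = 0.
  rewrite (_ : (fun p => _) = fun p : measurableTypeR R * Omega =>
      dot (D p.1 p.2) (D p.1 p.2) - dot (D p.1 p.2) (D' p.1 p.2) -
      (dot (D p.1 p.2) (D' p.1 p.2) - dot (D' p.1 p.2) (D' p.1 p.2))); last first.
    apply/funext => p; rewrite /dot -!sumrB; apply: eq_bigr => j _; ring.
  rewrite RintegralB//; [|by apply: intgB => //; exact: idot..].
  rewrite !RintegralB//; try exact: idot.
  by rewrite -!/(slab_dot _ _) E1 E2 !subrr.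
have iS : intg M E (fun p => \sum_j (D p.1 p.2 0 j - D' p.1 p.2 0 j) ^+ 2).
  by apply: intg_sum => // j _; case: (sB j).
have := @ae_eq_integral_abs _ _ _ M E mE _ ((measurable_EFinP _ _).2 (intg_meas iS)).
have S0 p : 0 <= \sum_j (D p.1 p.2 0 j - D' p.1 p.2 0 j) ^+ 2.
  by apply: sumr_ge0 => j _; exact: sqr_ge0.
under eq_integral do rewrite /= ger0_norm//.
rewrite -EFin_Rintegral// I0 => -[/(_ erefl) H _].
apply: filterS H => p H pT.
have {}H : \sum_j (D p.1 p.2 0 j - D' p.1 p.2 0 j) ^+ 2 = 0.
  by apply: EFin_inj; apply: H; split.
apply/eqP; rewrite -subr_eq0 -sqrf_eq0 eq_le sqr_ge0 andbT -H.
by rewrite (bigD1 i)//= lerDl sumr_ge0// => j _; exact: sqr_ge0.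
Qed.

End uniqueness.

(** * Existence of the Malliavin derivative from bounded smooth approximations *)

Section existence.
Context {d} {Omega : measurableType d} {R : realType} {P : probability Omega R}.
Context {T : R} {n : nat} {W : R -> Omega -> 'rV[R]_n}.
Hypotheses (T_gt0 : 0 < T) (W_bm : brownian_motion P T W).
Local Notation mu := (@lebesgue_measure R).
Local Notation M := ((lebesgue_measure : measure (measurableTypeR R) R) \x P)%E.
Local Notation E := (`[0, T]%classic `*` [set: Omega] : set (measurableTypeR R * Omega)).
Let mE : measurable E. Proof. exact: measurable_slab. Qed.
Local Notation slab := (@slab_dot d Omega R P T n).

Lemma intg_slab_dot (A B : R -> Omega -> 'rV[R]_n) :
  (forall i, sqint M E (fun p => A p.1 p.2 0 i)) ->
  (forall i, sqint M E (fun p => B p.1 p.2 0 i)) ->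
  intg M E (fun p => dot (A p.1 p.2) (B p.1 p.2)).
Proof. by move=> sA sB; apply: intg_sum => // j _; exact: sqint_mul. Qed.

Lemma slab_dot_parallelogram (A B : R -> Omega -> 'rV[R]_n) :
  (forall i, sqint M E (fun p => A p.1 p.2 0 i)) ->
  (forall i, sqint M E (fun p => B p.1 p.2 0 i)) ->
  slab (fun t w => A t w - B t w) (fun t w => A t w - B t w) =
  2 * slab A A + 2 * slab B B - 4 * slab (fun t w => 2^-1 *: A t w + 2^-1 *: B t w)
    (fun t w => 2^-1 *: A t w + 2^-1 *: B t w).
Proof.
move=> sA sB.
have iAA := intg_slab_dot sA sA; have iBB := intg_slab_dot sB sB.
have iAB := intg_slab_dot sA sB.
rewrite /slab_dot.
rewrite (_ : \int[M]_(p in E) dot (2^-1 *: _ + _) _ = 4^-1 * slab A A + 2^-1 * slab A B + 4^-1 * slab B B).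
  rewrite (_ : (fun p => _) = fun p : measurableTypeR R * Omega => dot (A p.1 p.2) (A p.1 p.2) -
      2 * dot (A p.1 p.2) (B p.1 p.2) + dot (B p.1 p.2) (B p.1 p.2)).
    rewrite RintegralD//; last by apply: intgB => //; exact: intgZ.
    rewrite RintegralB//; last exact: intgZ.
    by rewrite RintegralZl// /slab_dot; field.
  apply/funext => p; rewrite /dot mulr_sumr -sumrB -big_split.
  by apply: eq_bigr => j _; rewrite !mxE/=; ring.
rewrite (_ : (fun p => _) = fun p : measurableTypeR R * Omega => 4^-1 * dot (A p.1 p.2) (A p.1 p.2) +
    2^-1 * dot (A p.1 p.2) (B p.1 p.2) + 4^-1 * dot (B p.1 p.2) (B p.1 p.2)).
  rewrite RintegralD//; [|by apply: intgD => //; exact: intgZ|exact: intgZ].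
  rewrite RintegralD//; [|exact: intgZ..].
  by rewrite !RintegralZl.
apply/funext => p; rewrite /dot !mulr_sumr -!big_split.
by apply: eq_bigr => j _; rewrite !mxE/=; field.
Qed.

Lemma slab_dot_coord_le (A : R -> Omega -> 'rV[R]_n) i :
  (forall i, sqint M E (fun p => A p.1 p.2 0 i)) ->
  \int[M]_(p in E) (A p.1 p.2 0 i ^+ 2) <= slab A A.
Proof.
move=> sA; apply: le_Rintegral => //; [exact: (sqint_sqr (sA i))|exact: intg_slab_dot|].
move=> p _; rewrite /dot (bigD1 i)//= -expr2 lerDl sumr_ge0// => j _.
by rewrite -expr2 sqr_ge0.
Qed.

Variables (xi : Omega -> R) (A : 'I_n -> R).
Hypotheses (sxi : sqint P setT xi).

(** [F] is hidden under the existential because the minimisation concerns derivatives only. The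
    bound is imposed at every point, so it survives averaging and limits without exceptional
    sets. *)
Definition bounded_approx (e : R) (DF : R -> Omega -> 'rV[R]_n) :=
  (forall i t w, t \in `[0, T] -> `|DF t w 0 i| <= A i) /\
  exists2 F, smooth_rv P T W F DF & \int[P]_w ((F w - xi w) ^+ 2) <= e.

Hypothesis approx : forall e, 0 < e -> exists DF, bounded_approx e DF.

(** Linearity of the derivative together with convexity of the pointwise bound and of the squared
    error. *)
Lemma bounded_approx_mean e DF DG : bounded_approx e DF -> bounded_approx e DG ->
  bounded_approx e (fun t w => 2^-1 *: DF t w + 2^-1 *: DG t w).
Proof.
move=> [bF [F sF Fe]] [bG [G sG Ge]]; split.
  move=> i t w tT; rewrite !mxE.
  have := bF i t w tT; have := bG i t w tT; rewrite !ler_norml => /andP[? ?] /andP[? ?].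
  by apply/andP; split; lra.
exists (fun w => 2^-1 * F w + 2^-1 * G w); first exact: smooth_rvD.
have sFx : sqint P setT (fun w => F w - xi w).
  by apply: sqintB => //; exact: (all_moments_sqint (smooth_rv_moments T_gt0 W_bm sF)).
have sGx : sqint P setT (fun w => G w - xi w).
  by apply: sqintB => //; exact: (all_moments_sqint (smooth_rv_moments T_gt0 W_bm sG)).
have iH : intg P setT (fun w => 2^-1 * (F w - xi w) ^+ 2 + 2^-1 * (G w - xi w) ^+ 2).
  by apply: intgD => //; apply: intgZ => //; exact: sqint_sqr.
apply: (@le_trans _ _ (\int[P]_w (2^-1 * (F w - xi w) ^+ 2 + 2^-1 * (G w - xi w) ^+ 2))).
  have le w : (2^-1 * F w + 2^-1 * G w - xi w) ^+ 2 <= 2^-1 * (F w - xi w) ^+ 2 + 2^-1 * (G w - xi w) ^+ 2.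
    rewrite -subr_ge0 (_ : _ - _ = 4^-1 * (F w - G w) ^+ 2); last by field.
    by rewrite mulr_ge0 ?sqr_ge0.
  apply: le_Rintegral => //; apply: (intg_le measurableT _ iH).
    have := sqintD measurableT (sqintZ measurableT 2^-1 sFx) (sqintZ measurableT 2^-1 sGx).
    move=> /sqint_sqr /intg_meas; congr (measurable_fun _ _); apply/funext => w.
    by congr (_ ^+ 2); field.
  by move=> w _; rewrite ger0_norm ?sqr_ge0.
rewrite RintegralD//; [|by apply: intgZ => //; exact: sqint_sqr..].
by rewrite !RintegralZl//; [lra|exact: sqint_sqr..].
Qed.

(* The sets of admissible approximations are convex and shrink with [e]. By the
   parallelogram law, derivatives of nearly minimal norm in them are Cauchy. *)
Lemma malliavin_derivative_of_approx : exists D, malliavin_derivative P T W xi D /\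
  forall i t w, t \in `[0, T] -> `|D t w 0 i| <= A i.
Proof.
pose e N : R := N.+1%:R^-1.
have e0 N : 0 < e N by rewrite invr_gt0.
pose S N := [set slab DF DF | DF in bounded_approx (e N)].
have sD N DF i : bounded_approx (e N) DF -> sqint M E (fun p => DF p.1 p.2 0 i).
  by move=> [_ [F sF _]]; exact: (smooth_rv_sqint T_gt0 W_bm i sF).
have slab0 (D : R -> Omega -> 'rV[R]_n) : 0 <= slab D D.
  by apply: Rintegral_ge0 => p _; apply: sumr_ge0 => j _; rewrite -expr2 sqr_ge0.
have infS N : has_inf (S N).
  split; first by have [DF DFe] := approx (e0 N); exists (slab DF DF), DF.
  by exists 0 => _ [DF _ <-].
have /(@choice _ _ _)[DF DFP] : forall N, exists DF, bounded_approx (e N) DF /\ slab DF DF < inf (S N) + e N.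
  by move=> N; have [_ [DF DFe <-] lt] := inf_adherent (e0 N) (infS N); exists DF.
(* The pointwise bound and the finite measure of the product space bound all squared norms. The
   infima, which increase with [N], therefore converge. *)
pose B := \sum_i A i ^+ 2 * fine (M E).
have SB N x : S N x -> x <= B.
  move=> [DG DGe <-]; have sG i := sD N DG i DGe.
  have Mfin : (M E < +oo)%E by exact: slab_lty.
  apply: (@le_trans _ _ (\int[M]_(p in E) (\sum_i A i ^+ 2))).
    apply: le_Rintegral => //; [exact: intg_slab_dot|exact: intg_cst|].
    move=> p [p1 _]; apply: ler_sum => i _; rewrite -expr2 -real_normK ?num_real//.
    case: DGe => bG _; have bp := bG i p.1 p.2 p1.
    by rewrite lerXn2r ?nnegrE//; exact: le_trans bp.
  by rewrite Rintegral_cst// /B mulr_suml.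
have eN m k : (m <= k)%N -> e k <= e m.
  by move=> mk; rewrite lef_pV2 ?posrE// ler_nat.
have sub m k DG : (m <= k)%N -> bounded_approx (e k) DG -> bounded_approx (e m) DG.
  move=> mk [bG [G sG Ge]]; split=> //; exists G => //; apply: le_trans Ge _; exact: eN.
have I_mono m k : (m <= k)%N -> inf (S m) <= inf (S k).
  move=> mk; apply: lb_le_inf; first by case: (infS k).
  move=> _ [DG DGe <-]; apply: ge_inf; first by case: (infS m).
  by exists DG => //; exact: sub mk DGe.
have I_B k : inf (S k) <= B.
  have [[x Sx] lb] := infS k; apply: le_trans (SB _ _ Sx).
  by apply: ge_inf.
(* For [m <= k] the midpoint is still admissible at level [m], so its squared norm is at least
   [inf (S m)]; the parallelogram identity and near-minimality give the rest. *)
have cauchy_le m k : (m <= k)%N -> slab (fun t w => DF m t w - DF k t w) (fun t w => DF m t w - DF k t w)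
    <= 2 * (inf (S k) - inf (S m)) + 4 * e m.
  move=> mk; have [am lm] := DFP m; have [ak lk] := DFP k.
  rewrite slab_dot_parallelogram; [|by move=> i; exact: sD am|by move=> i; exact: sD ak].
  have : inf (S m) <= slab (fun t w => 2^-1 *: DF m t w + 2^-1 *: DF k t w)
    (fun t w => 2^-1 *: DF m t w + 2^-1 *: DF k t w).
    apply: ge_inf; first by case: (infS m).
    by eexists; [exact: (bounded_approx_mean am (sub _ _ _ mk ak))|].
  have := eN _ _ mk; lra.
have cI : cvgn (fun k => inf (S k)).
  by apply: nondecreasing_is_cvgn => //; exists B => _ [k _ <-].
have slab_sym m k : slab (fun t w => DF m t w - DF k t w) (fun t w => DF m t w - DF k t w) =
    slab (fun t w => DF k t w - DF m t w) (fun t w => DF k t w - DF m t w).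
  apply: eq_Rintegral => p _; apply: eq_bigr => i _; rewrite !mxE; ring.
have cauchy eps : 0 < eps -> exists N, forall m k, (N <= m)%N -> (N <= k)%N ->
    slab (fun t w => DF m t w - DF k t w) (fun t w => DF m t w - DF k t w) <= eps.
  move=> eps0; set I := limn (fun k => inf (S k)).
  have lim0 : 2 * (I - inf (S m)) + 4 * e m @[m --> \oo] --> 2 * (I - I) + 4 * 0.
    apply: cvgD; apply: cvgM; try exact: cvg_cst; last exact: cvg_harmonic.
    by apply: cvgB; [exact: cvg_cst|exact: cI].
  rewrite subrr !mulr0 addr0 in lim0.
  move/cvgrPdist_le : lim0 => /(_ _ eps0)[N _ HN].
  have key m k : (N <= m)%N -> (m <= k)%N ->
      slab (fun t w => DF m t w - DF k t w) (fun t w => DF m t w - DF k t w) <= eps.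
    move=> Nm mk; apply: le_trans (cauchy_le _ _ mk) _.
    apply: le_trans (le_trans (ler_norm _) (_ : _ <= eps)); last first.
      have := HN m Nm; rewrite sub0r normrN; exact.
    have Ik : inf (S k) <= I by apply: (nondecreasing_cvgn_le _ cI) => //.
    lra.
  exists N => m k Nm Nk; have [mk|/ltnW km] := leqP m k; first exact: key.
  by rewrite slab_sym; exact: key.
have sB m k i : sqint M E (fun p => (DF m p.1 p.2 - DF k p.1 p.2) 0 i).
  rewrite (_ : (fun p => _) = fun p : measurableTypeR R * Omega => DF m p.1 p.2 0 i - DF k p.1 p.2 0 i).
    by apply: sqintB => //; [exact: sD (DFP m).1|exact: sD (DFP k).1].
  by apply/funext => p; rewrite !mxE.
(* The limit is taken coordinate by coordinate, so that each coordinate keeps its own bound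
   [A i]. *)
have /(@choice _ _ _)[g gP] : forall i, exists g : measurableTypeR R * Omega -> R,
    [/\ measurable_fun E g, forall p, E p -> `|g p| <= A i &
    (\int[M]_(p in E) (DF k p.1 p.2 0 i - g p) ^+ 2) @[k --> \oo] --> 0].
  move=> i; apply: (bounded_L2_complete mE (f := fun k p => DF k p.1 p.2 0 i)).
  - exact: slab_lty.
  - by move=> k; exact: sqint_meas (sD _ _ i (DFP k).1).
  - by move=> k p [p1 _]; case: (DFP k) => -[bF _] _; exact: bF.
  - move=> eps eps0; have [N HN] := cauchy _ eps0; exists N => m k Nm Nk.
    apply: le_trans (HN m k Nm Nk); apply: le_trans (slab_dot_coord_le i (sB m k)).
    by rewrite le_eqVlt; apply/orP; left; apply/eqP; apply: eq_Rintegral => p _; rewrite !mxE.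
have /(@choice _ _ _)[F FP] : forall k, exists F, smooth_rv P T W F (DF k) /\
    \int[P]_w ((F w - xi w) ^+ 2) <= e k.
  by move=> k; case: (DFP k) => -[_ [F sF Fe]] _; exists F.
pose D t w := \row_i g i (t, w).
have DE i : (fun p : measurableTypeR R * Omega => D p.1 p.2 0 i) = g i.
  by apply/funext => -[t w]; rewrite mxE.
have mD i : measurable_fun E (fun p => D p.1 p.2 0 i) by rewrite DE; case: (gP i).
have sF k := all_moments_sqint (smooth_rv_moments T_gt0 W_bm (FP k).1).
exists D; split; last first.
  by move=> i t w tT; rewrite mxE; case: (gP i) => _ + _; apply; split.
split; [exact: sqint_meas sxi|exact: mD|exists F, DF; split].
  by move=> k; case: (FP k).
have sFx k : sqint P setT (fun w => F k w - xi w) by exact: sqintB.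
have sg i : sqint M E (g i).
  have [mg bg _] := gP i; split=> //.
  apply: (intg_le mE _ (intg_cst mE (A i ^+ 2) slab_lty)); first exact: measurable_funX.
  move=> p Ep; rewrite ger0_norm ?sqr_ge0// -real_normK ?num_real//.
  by have bp := bg p Ep; rewrite lerXn2r ?nnegrE//; exact: le_trans bp.
have DDE k i : (fun p : measurableTypeR R * Omega => (DF k p.1 p.2 - D p.1 p.2) 0 i) =
    fun p => DF k p.1 p.2 0 i - g i p.
  by apply/funext => -[t w]; rewrite !mxE.
have sDg k i : sqint M E (fun p => DF k p.1 p.2 0 i - g i p).
  by apply: sqintB => //; exact: sD (DFP k).1.
have sDD k i : sqint M E (fun p => (DF k p.1 p.2 - D p.1 p.2) 0 i).
  by rewrite DDE; exact: sDg.
have iDD k i := sqint_sqr (sDg k i).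
apply/norm12_cvg0.
- by move=> k; exact: sqint_meas (sFx k).
- by move=> k i; exact: sqint_meas (sDD k i).
split.
  rewrite (_ : (fun k => _) = fun k => (\int[P]_w ((F k w - xi w) ^+ 2))%:E); last first.
    by apply/funext => k; rewrite EFin_Rintegral//; exact: sqint_sqr.
  apply: cvg_EFin; first exact: nearW.
  apply: (squeeze_cvgr (f := fun=> 0) (h := e)); last 2 first.
  - exact: cvg_cst.
  - exact: cvg_harmonic.
  near=> k; case: (FP k) => _ ->; rewrite andbT.
  by apply: Rintegral_ge0 => w _; exact: sqr_ge0.
rewrite (_ : (fun k => _) = fun k => (\sum_i \int[M]_(p in E) ((DF k p.1 p.2 0 i - g i p) ^+ 2))%:E); last first.
  apply/funext => k; rewrite -Rintegral_sum// EFin_Rintegral//; last exact: intg_sum.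
  by apply: eq_integral => -[t w] _; congr EFin; apply: eq_bigr => i _; rewrite !mxE.
rewrite [X in _ --> X](_ : 0%E = (\sum_(i < n) (0 : R))%:E); last by rewrite big1.
apply: cvg_EFin; first exact: nearW.
by apply: cvg_sumr => i _; case: (gP i).
Unshelve. all: by end_near. Qed.

End existence.

Arguments bounded_approx {d Omega R} P T {n} W xi A e DF.

(** * Smoothing Lipschitz functions of several variables *)

Section bernstein.
Context {R : realType}.
Implicit Types (s : R) (a b : nat -> R).

(** De Casteljau's recursion for the Bernstein polynomial with coefficients [a 0, ..., a N]; for [s]
    in [[0, 1]], the mean of [a] at a binomial variable with parameters [N] and [s]. No binomial
    coefficient appears. *)
Fixpoint bern (N : nat) s a : R :=
  if N is N'.+1 then (1 - s) * bern N' s a + s * bern N' s (fun k => a k.+1) else a 0%N.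

Lemma bern_linear N s c a b :
  bern N s (fun k => c * a k + b k) = c * bern N s a + bern N s b.
Proof. by elim: N a b => //= N IH a b; rewrite !IH; ring. Qed.

Lemma bern_cst N s c : bern N s (fun=> c) = c.
Proof. by elim: N => //= N ->; ring. Qed.

Lemma bern_ext N s a b : (forall k, (k <= N)%N -> a k = b k) -> bern N s a = bern N s b.
Proof.
elim: N a b => [|N IH] a b ab /=; first exact: ab.
by congr (_ * _ + _ * _); apply: IH => k kN; apply: ab => //; exact: leqW.
Qed.

Lemma bern_le N s a b : 0 <= s <= 1 -> (forall k, (k <= N)%N -> a k <= b k) ->
  bern N s a <= bern N s b.
Proof.
move=> /andP[s0 s1]; elim: N a b => [|N IH] a b ab /=; first exact: ab.
apply: lerD; rewrite ler_wpM2l ?subr_ge0//; apply: IH => k kN; apply: ab => //.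
exact: leqW.
Qed.

Lemma bern_norm_le N s a b e : 0 <= s <= 1 ->
  (forall k, (k <= N)%N -> `|a k - b k| <= e) -> `|bern N s a - bern N s b| <= e.
Proof.
move=> /andP[s0 s1]; elim: N a b => [|N IH] a b ab /=; first exact: ab.
have h1 : `|bern N s a - bern N s b| <= e.
  by apply: IH => k kN; apply: ab; exact: leqW.
have h2 : `|bern N s (fun k => a k.+1) - bern N s (fun k => b k.+1)| <= e.
  by apply: IH => k kN; exact: ab.
by move: h1 h2; rewrite !ler_norml => /andP[? ?] /andP[? ?]; apply/andP; split; nra.
Qed.

(** With samples of an [L]-Lipschitz function at mesh [1 / N], [D] is [L / N] and the polynomial has
    constant exactly [L]: this is why the bounds [A i] survive smoothing. *)
Lemma bern_lip N s s' a D : 0 <= s <= 1 -> 0 <= s' <= 1 ->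
  (forall k, (k < N)%N -> `|a k.+1 - a k| <= D) ->
  `|bern N s a - bern N s' a| <= N%:R * D * `|s - s'|.
Proof.
move=> s01 s01'; elim: N a => [|N IH] a aD /=; first by rewrite subrr normr0 !mul0r.
have h1 := IH a (fun k kN => aD k (ltnW kN)).
have h2 := IH (fun k => a k.+1) (fun k kN => aD k.+1 kN).
have h3 : `|bern N s' (fun k => a k.+1) - bern N s' a| <= D.
  by apply: bern_norm_le => // k kN; exact: aD.
set x := bern N s a in h1 *; set y := bern N s' a in h1 h3 *.
set u := bern N s _ in h2 *; set v := bern N s' _ in h2 h3 *.
rewrite (_ : _ - _ = (1 - s) * (x - y) + s * (u - v) + (s - s') * (v - y)); last by ring.
apply: le_trans (ler_normD _ _) _; rewrite -natr1 (mulrDl _ _ D) (mulrDl _ _ `|s - s'|) mul1r lerD//; last first.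
  by rewrite normrM mulrC ler_wpM2r.
apply: le_trans (ler_normD _ _) _; rewrite !normrM.
case/andP: s01 => s0 s1; have s1' : 0 <= 1 - s by rewrite subr_ge0.
rewrite (ger0_norm s0) (ger0_norm s1').
by have := ler_wpM2l s1' h1; have := ler_wpM2l s0 h2; lra.
Qed.

(** Variance plus squared bias of a binomial variable. The centre [z] is general because the
    recursion shifts it by 1. *)
Lemma bern_moment2 N s z :
  bern N s (fun k => (k%:R - z) ^+ 2) = N%:R * s * (1 - s) + (N%:R * s - z) ^+ 2.
Proof.
elim: N z => [|N IH] z /=; first by ring.
rewrite IH (@bern_ext _ _ _ (fun k => (k%:R - (z - 1)) ^+ 2)); last first.
  by move=> k _; rewrite -natr1; ring.
by rewrite IH -natr1; ring.
Qed.

(** With [m = M + 1], the bound [2 |x| <= m x^2 + 1 / m] replaces the absolute value by a quadratic,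
    whose Bernstein transform is explicit. The degree is a square so that the natural scale [1 / m]
    involves no root. *)
Lemma bern_approx M s (h : R -> R) L : 0 <= s <= 1 -> 0 <= L ->
  (forall t, 0 <= t <= 1 -> `|h t - h s| <= L * `|t - s|) ->
  `|bern (M.+1 ^ 2) s (fun k => h (k%:R / (M.+1 ^ 2)%:R)) - h s| <= L / M.+1%:R.
Proof.
move=> s01 L0 hL; set N := (M.+1 ^ 2)%N; set m : R := M.+1%:R.
have m0 : 0 < m by rewrite ltr0n.
have Nm : N%:R = m ^+ 2 :> R by rewrite /N natrX.
have N0 : 0 < N%:R :> R by rewrite Nm exprn_gt0.
pose ub (k : nat) : R := (L * m / 2 / N%:R ^+ 2) * (k%:R - N%:R * s) ^+ 2 + L / m / 2.
have hub k : (k <= N)%N -> `|h (k%:R / N%:R) - h s| <= ub k.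
  move=> kN; apply: le_trans (hL _ _) _.
    by rewrite divr_ge0//= ler_pdivrMr// mul1r ler_nat.
  set x := k%:R / N%:R - s.
  have -> : ub k = L / 2 * (m * x ^+ 2 + m^-1).
    by rewrite /ub /x; field; rewrite !gt_eqF.
  have -> : L * `|x| = L / 2 * (2 * `|x|) by field.
  rewrite ler_wpM2l ?divr_ge0//.
  rewrite -(ler_pM2l m0) mulrDr mulfV ?gt_eqF// -(real_normK (num_real x)).
  by have := sqr_ge0 (m * `|x| - 1); nra.
have bub : bern N s ub = L * m / 2 / N%:R ^+ 2 * (N%:R * s * (1 - s)) + L / m / 2.
  by rewrite /ub bern_linear bern_moment2 bern_cst subrr expr0n addr0.
have hle : bern N s ub <= L / m.
  rewrite bub Nm.
  have -> : L * m / 2 / m ^+ 2 ^+ 2 * (m ^+ 2 * s * (1 - s)) = L / m / 2 * (s * (1 - s)).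
    by field; rewrite gt_eqF.
  have : s * (1 - s) <= 1 by case/andP: s01 => ? ?; nra.
  have : 0 <= L / m by rewrite divr_ge0// ltW.
  set K := L / m; set y := s * (1 - s) => K0 y1.
  have := ler_piMr K0 y1; set Ky := K * y => KyK.
  rewrite (_ : K / 2 * y = Ky / 2); [lra|by rewrite /Ky; field].
rewrite ler_norml; apply/andP; split.
  rewrite lerNl opprB -[h s](bern_cst N s).
  apply: le_trans hle; rewrite -[leLHS]addrC -mulN1r -bern_linear.
  apply: bern_le => // k kN; apply: le_trans (hub k kN); rewrite mulN1r addrC.
  by rewrite -normrN opprB ler_norm.
rewrite lerBlDr; apply: (@le_trans _ _ (bern N s (fun k => 1 * ub k + h s))).
  apply: bern_le => // k kN; rewrite mul1r -lerBlDr; exact: le_trans (ler_norm _) (hub k kN).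
by rewrite bern_linear bern_cst mul1r lerD2r.
Qed.

End bernstein.

Section coordinate_lipschitz.
Context {R : realType} (m : nat).
Implicit Types (x : 'rV[R]_m) (G : 'rV[R]_m -> R) (j : 'I_m) (L : 'I_m -> R).

Definition upd x j (y : R) : 'rV[R]_m := \row_i if i == j then y else x 0 i.

Lemma updE x j y i : upd x j y 0 i = if i == j then y else x 0 i.
Proof. by rewrite mxE. Qed.

Lemma upd_upd x j y z : upd (upd x j y) j z = upd x j z.
Proof. by apply/rowP => i; rewrite !updE; case: ifP => // ->. Qed.

Lemma upd_swap x i j y z : i != j -> upd (upd x i y) j z = upd (upd x j z) i y.
Proof.
move=> ij; apply/rowP => k; rewrite !updE.
by case: (eqVneq k j) => [->|//]; rewrite eq_sym (negbTE ij).
Qed.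

Lemma upd_id x j : upd x j (x 0 j) = x.
Proof. by apply/rowP => i; rewrite updE; case: eqVneq => [->|]. Qed.

Lemma addr_delta_upd x j t : x + t *: delta_mx 0 j = upd x j (x 0 j + t).
Proof.
apply/rowP => i; rewrite !mxE eqxx/=; case: eqVneq => [->|]; first by rewrite mulr1.
by rewrite mulr0 addr0.
Qed.

Definition cube x := forall j, 0 <= x 0 j <= 1.

(** One constant per coordinate, since each must come through unchanged; the cube is where the grid
    points and the logistic values lie. *)
Definition coord_lip L G := forall x j y, cube x -> 0 <= y <= 1 ->
  `|G (upd x j y) - G x| <= L j * `|y - x 0 j|.

Lemma cube_upd x j y : cube x -> 0 <= y <= 1 -> cube (upd x j y).
Proof. by move=> cx y01 i; rewrite updE; case: ifP. Qed.

Definition bernstein_at (M : nat) G j x :=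
  bern (M.+1 ^ 2) (x 0 j) (fun k => G (upd x j (k%:R / (M.+1 ^ 2)%:R))).

Lemma grid01 (N k : nat) : (k <= N)%N -> 0 <= (k%:R / N%:R : R) <= 1.
Proof.
move=> kN; case: N kN => [|N] kN; first by rewrite invr0 mulr0 lexx ler01.
by rewrite divr_ge0//= ler_pdivrMr ?ltr0Sn// mul1r ler_nat.
Qed.

(** In the variable [j] this is [bern_lip]; in any other variable the operator averages functions
    that all have the same constant. *)
Lemma bernstein_at_lip M G j L : coord_lip L G -> coord_lip L (bernstein_at M G j).
Proof.
move=> GL x i y cx y01; rewrite /bernstein_at updE.
have N0 : 0 < (M.+1 ^ 2)%:R :> R by rewrite ltr0n expn_gt0.
have [ji|ji] := eqVneq j i.
  subst i; rewrite (@bern_ext _ _ _ _ (fun k => G (upd x j (k%:R / (M.+1 ^ 2)%:R)))); last first.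
    by move=> k _; rewrite upd_upd.
  have := @bern_lip _ (M.+1 ^ 2) y (x 0 j) (fun k => G (upd x j (k%:R / (M.+1 ^ 2)%:R))) (L j / (M.+1 ^ 2)%:R) y01 (cx j).
  rewrite mulrCA divff ?gt_eqF// mulr1; apply => k kN.
  have := GL (upd x j (k%:R / (M.+1 ^ 2)%:R)) j (k.+1%:R / (M.+1 ^ 2)%:R).
  rewrite upd_upd updE eqxx -mulrBl -natrB// subSnn mul1r (ger0_norm (x := _^-1)) ?invr_ge0//.
  by apply; [apply: cube_upd => //; exact: grid01 (ltnW kN)|exact: grid01].
apply: bern_norm_le => // k kN; rewrite upd_swap 1?eq_sym//.
have := GL (upd x j (k%:R / (M.+1 ^ 2)%:R)) i y (cube_upd j cx (grid01 kN)) y01.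
by rewrite updE eq_sym (negbTE ji).
Qed.

Lemma bernstein_at_approx M G j L x : coord_lip L G -> cube x -> 0 <= L j ->
  `|bernstein_at M G j x - G x| <= L j / M.+1%:R.
Proof.
move=> GL cx L0; rewrite -[in G x](upd_id x j).
apply: (@bern_approx _ M (x 0 j) (fun y => G (upd x j y)) (L j)) => // t t01.
by rewrite (upd_id x j); exact: GL.
Qed.

Definition bernstein M G (js : seq 'I_m) := foldr (fun j H => bernstein_at M H j) G js.

Lemma bernstein_lip M G js L : coord_lip L G -> coord_lip L (bernstein M G js).
Proof. by move=> GL; elim: js => //= j js IH; exact: bernstein_at_lip. Qed.

Lemma bernstein_approx M G js L x : coord_lip L G -> cube x -> (forall j, 0 <= L j) ->
  `|bernstein M G js x - G x| <= \sum_(j <- js) L j / M.+1%:R.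
Proof.
move=> GL cx L0; elim: js => [|j js IH] /=; first by rewrite big_nil subrr normr0.
rewrite big_cons; apply: le_trans (lerD (bernstein_at_approx M (bernstein_lip M js GL) cx (L0 j)) IH).
by apply: le_trans (ler_normD _ _); rewrite subrKA.
Qed.

Lemma bern_algebra p (B : ('rV[R]_p -> R) -> Prop) N (s : 'rV[R]_p -> R)
    (a : nat -> 'rV[R]_p -> R) :
  algebra_of B s -> (forall k, algebra_of B (a k)) ->
  algebra_of B (fun z => bern N (s z) (a ^~ z)).
Proof.
move=> Bs; elim: N a => [|N IH] a Ba /=; first exact: Ba.
apply: algebraD; apply: algebraM => //; try exact: IH.
- rewrite (_ : (fun z => 1 - s z) = fun z => 1 + (-1) * s z).
    apply: algebraD; first exact: algebra_cst.
    by apply: algebraM => //; exact: algebra_cst.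
  by apply/funext => z; rewrite mulN1r.
Qed.

(** Each pass replaces one variable by grid points and leaves polynomial weights in front. When the
    list is exhausted every argument of [G] is constant, so [G] enters only through finitely many
    values. *)
Lemma bernstein_algebra p (B : ('rV[R]_p -> R) -> Prop) M G js
    (sigma : 'I_m -> 'rV[R]_p -> R) :
  (forall i, algebra_of B (sigma i)) ->
  (forall i, i \notin js -> exists c, sigma i = fun=> c) ->
  algebra_of B (fun z => bernstein M G js (\row_i sigma i z)).
Proof.
elim: js sigma => [|j js IH] sigma Bs cs /=.
  have /(@choice _ _ _)[c cE] : forall i, exists c, sigma i = fun=> c by move=> i; exact: cs.
  rewrite (_ : (fun z => _) = fun=> G (\row_i c i)); first exact: algebra_cst.
  by apply/funext => z; congr G; apply/rowP => i; rewrite !mxE cE.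
rewrite (_ : (fun z => _) = fun z => bern (M.+1 ^ 2) (sigma j z)
    (fun k => bernstein M G js (\row_i (if i == j then fun=> k%:R / (M.+1 ^ 2)%:R else sigma i) z))).
  apply: bern_algebra => // k; apply: IH => i.
    by case: ifP => // _; exact: algebra_cst.
  case: eqVneq => [_ _|ij ijs]; first by exists (k%:R / (M.+1 ^ 2)%:R).
  by apply: cs; rewrite inE negb_or ij.
apply/funext => z; rewrite /bernstein_at mxE; apply: bern_ext => k _.
by congr bernstein; apply/rowP => i; rewrite !mxE; case: ifP.
Qed.

End coordinate_lipschitz.

Section smoothing.
Context {R : realType} (m : nat).
Implicit Types (x : 'rV[R]_m) (g : 'rV[R]_m -> R).

Definition sigm_coord (h : 'rV[R]_m -> R) :=
  exists j c, h = fun x => sigm (2 * x 0 j / c).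

(** The logistic function satisfies [sigm' = sigm (1 - sigm)], so its derivatives are polynomials in
    itself. *)
Lemma sigm_coord_smooth h : sigm_coord h -> smooth1 h /\ forall j, algebra_of sigm_coord (partial j h).
Proof.
move=> [i [c ->]].
have D x j : is_derive x (delta_mx 0 j) (fun x => sigm (2 * x 0 i / c))
    (2 / c * (i == j)%:R * (sigm (2 * x 0 i / c) * (1 - sigm (2 * x 0 i / c)))).
  apply: is_derive_of_line.
  have D1 : is_derive (0 : R) 1 (fun s : R => 2 * (x + s *: delta_mx 0 j) 0 i / c) (2 / c * (i == j)%:R).
    have := is_deriveD (is_derive_cst (2 * x 0 i / c) (0 : R) 1)
      (is_deriveM (is_derive_id (0 : R) 1) (is_derive_cst (2 / c * (i == j)%:R) (0 : R) 1)).
    move/is_derive_ext; apply=> [s|].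
      rewrite -[LHS]/(2 * x 0 i / c + s * (2 / c * (i == j)%:R)) !mxE eqxx/=; ring.
    by rewrite /= scaler0 add0r add0r [_%:A]mulr1.
  have := is_derive1_comp (is_derive_sigm _) D1.
  by move/is_derive_ext; apply=> //; rewrite scale0r addr0 mulrC.
split.
  split.
  - have cl : continuous (fun x : 'rV[R]_m => 2 * x 0 i / c).
      apply: continuous_funM; last exact: cst_continuous.
      by apply: continuous_funM; [exact: cst_continuous|exact: continuous_coord].
    move=> x; apply: (cvg_comp (fun x : 'rV[R]_m => 2 * x 0 i / c) sigm); first exact: cl.
    exact: continuous_sigm.
  - by move=> x j; case: (D x j).
  - exists 1, 0%N => x; rewrite mul1r expr0 ger0_norm ?ltW//; [exact: sigm_lt1|exact: sigm_gt0].
move=> j; rewrite (_ : partial j _ = fun x => 2 / c * (i == j)%:R * (sigm (2 * x 0 i / c) * (1 + (-1) * sigm (2 * x 0 i / c)))).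
  have As : algebra_of sigm_coord (fun x => sigm (2 * x 0 i / c)) by apply: algebra_base; exists i, c.
  apply: algebraM; first exact: algebra_cst.
  apply: algebraM => //; apply: algebraD; first exact: algebra_cst.
  by apply: algebraM => //; exact: algebra_cst.
by apply/funext => x; rewrite mulN1r; exact: is_derive_partial (D x j).
Qed.

Lemma is_derive_lip (f : 'rV[R]_m -> R) x v (df K : R) : is_derive x v f df ->
  (forall t : R, `|f (x + t *: v) - f x| <= K * `|t|) -> `|df| <= K.
Proof.
move=> [fd <-] fK.
have c : (fun h : R => h^-1 *: ((f \o shift x) (h *: v) - f x)) h @[h --> 0^'] --> 'D_v f x by exact: fd.
have cn : `|h^-1 *: ((f \o shift x) (h *: v) - f x)| @[h --> 0^'] --> `|'D_v f x|.
  exact: cvg_norm c.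
rewrite -(cvg_lim (@Rhausdorff R) cn).
apply: limr_le; first by apply/cvg_ex; eexists; exact: cn.
near=> h; have h0 : h != 0 by near: h; exact: nbhs_dnbhs_neq.
rewrite /= [h *: v + x]addrC normrM normfV ler_pdivrMl ?normr_gt0// mulrC.
exact: fK.
Unshelve. all: by end_near. Qed.

(** The function is transported to the unit cube, smoothed there, and composed with
    [sigm (2 x / c)]. The transport multiplies the [j]-th constant by [2 c] and the logistic map
    divides it by [2 c], so the partial derivatives are bounded by [a j] itself. *)
Lemma lipschitz_smooth_approx g (a : 'I_m -> R) (c : R) (M : nat) : 0 < c ->
  (forall j, 0 <= a j) ->
  (forall x j y, `|g (upd x j y) - g x| <= a j * `|y - x 0 j|) ->
  exists f : 'rV[R]_m -> R, [/\ smooth_polygrowth f,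
    forall j x, `|partial j f x| <= a j &
    forall x, `|f x - g (\row_j psi c (x 0 j))| <= \sum_j 2 * c * a j / M.+1%:R].
Proof.
move=> c0 a0 ga.
pose G (s : 'rV[R]_m) := g (\row_j (c * (2 * s 0 j - 1))).
pose L j := 2 * c * a j.
have L0 j : 0 <= L j by rewrite !mulr_ge0// ltW.
have GL : coord_lip L G.
  move=> s j y _ _; rewrite /G.
  have -> : \row_i (c * (2 * upd s j y 0 i - 1)) =
      upd (\row_i (c * (2 * s 0 i - 1))) j (c * (2 * y - 1)).
    by apply/rowP => i; rewrite !mxE; case: ifP.
  apply: le_trans (ga _ _ _) _; rewrite mxE -mulrBr.
  rewrite (_ : 2 * y - 1 - _ = 2 * (y - s 0 j)); last by ring.
  rewrite !normrM (gtr0_norm c0) normr_nat.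
  by rewrite /L (_ : 2 * c * a j * _ = a j * (c * (2 * `|y - s 0 j|)))//; ring.
pose S x : 'rV[R]_m := \row_j sigm (2 * x 0 j / c).
have cS x : cube (S x).
  by move=> j; rewrite mxE !ltW//; [exact: sigm_lt1|exact: sigm_gt0].
have GS x : G (S x) = g (\row_j psi c (x 0 j)).
  by congr g; apply/rowP => j; rewrite !mxE.
have fs : smooth_polygrowth (fun x => bernstein M G (enum 'I_m) (S x)).
  apply: (algebra_smooth sigm_coord_smooth).
  apply: (@bernstein_algebra R m m _ M G (enum 'I_m) (fun j x => sigm (2 * x 0 j / c))).
    by move=> i; apply: algebra_base; exists i, c.
  by move=> i; rewrite mem_enum.
exists (fun x => bernstein M G (enum 'I_m) (S x)); split=> //.
- move=> j x; have [_ fd _] := smooth_smooth1 fs.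
  apply: (is_derive_lip (smooth1_is_derive x j (smooth_smooth1 fs))) => t.
  have -> : S (x + t *: delta_mx 0 j) = upd (S x) j (sigm (2 * (x 0 j + t) / c)).
    by apply/rowP => i; rewrite addr_delta_upd !mxE; case: ifP.
  apply: le_trans (bernstein_lip M (enum 'I_m) GL j (cS x) _) _.
    by rewrite !ltW//; [exact: sigm_lt1|exact: sigm_gt0].
  rewrite mxE /L.
  have := psi_lip (x 0 j + t) (x 0 j) c0; rewrite addrAC subrr add0r /psi -mulrBr.
  set u := sigm _; set v := sigm _.
  rewrite (_ : 2 * u - 1 - _ = 2 * (u - v)); last by ring.
  rewrite !normrM (gtr0_norm c0) normr_nat => h.
  by rewrite (_ : 2 * c * a j * _ = a j * (c * (2 * `|u - v|))); [rewrite ler_wpM2l|ring].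
- move=> x; rewrite -GS; apply: le_trans (bernstein_approx M (enum 'I_m) GL (cS x) L0) _.
  by rewrite big_enum.
Qed.

End smoothing.

(** * Piecewise linear interpolation of paths *)

Section ramp.
Context {R : realType}.
Implicit Types a b t : R.

Definition ramp a b t := Num.max 0 (Num.min 1 ((t - a) / (b - a))).

Lemma ramp_itv01 a b t : 0 <= ramp a b t <= 1.
Proof. by rewrite le_max lexx/= ge_max ler01 ge_min lexx. Qed.

Lemma ramp_le a b t : a < b -> t <= a -> ramp a b t = 0.
Proof.
move=> ab ta; apply/eqP; rewrite eq_le le_max lexx/= andbT ge_max lexx/= ge_min.
by rewrite pmulr_lle0 ?invr_gt0 ?subr_gt0// subr_le0 ta orbT.
Qed.

Lemma ramp_ge a b t : a < b -> b <= t -> ramp a b t = 1.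
Proof.
move=> ab bt; rewrite /ramp min_l; first by rewrite max_r.
by rewrite ler_pdivlMr ?subr_gt0// mul1r lerB.
Qed.

Lemma continuous_ramp a b : continuous (ramp a b).
Proof.
move=> t; apply: (@continuous_max R R (fun=> 0) (fun t => Num.min 1 ((t - a) / (b - a)))).
  exact: cst_continuous.
apply: (@continuous_min R R (fun=> 1) (fun t => (t - a) / (b - a))).
  exact: cst_continuous.
apply: cvgM; last exact: cvg_cst.
by apply: cvgB; [exact: cvg_id|exact: cvg_cst].
Qed.

End ramp.

Lemma expr4D_le {R : realType} (x y : R) : (x + y) ^+ 4 <= 8 * (x ^+ 4 + y ^+ 4).
Proof.
rewrite -subr_ge0.
rewrite (_ : _ - _ = (x - y) ^+ 2 * (7 * x ^+ 2 + 10 * (x * y) + 7 * y ^+ 2)); last by ring.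
rewrite mulr_ge0 ?sqr_ge0//; have := sqr_ge0 (x + y); have := sqr_ge0 x; have := sqr_ge0 y.
by rewrite !expr2; nra.
Qed.

Section interpolation.
Context {R : realType}.
Variables (T : R) (n : nat).
Hypothesis T_gt0 : 0 < T.
Implicit Types v : R -> 'rV[R]_n.

Definition grid (N k : nat) : R := T * k%:R / N%:R.

Lemma grid0 N : grid N 0 = 0. Proof. by rewrite /grid mulr0 mul0r. Qed.

Lemma gridN N : (0 < N)%N -> grid N N = T.
Proof. by move=> N0; rewrite /grid mulfK// pnatr_eq0 -lt0n. Qed.

Lemma ltr_grid N j k : (0 < N)%N -> (grid N j < grid N k) = (j < k)%N.
Proof. by move=> N0; rewrite /grid ltr_pM2r ?invr_gt0 ?ltr0n// ltr_pM2l// ltr_nat. Qed.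

Lemma ler_grid N j k : (0 < N)%N -> (grid N j <= grid N k) = (j <= k)%N.
Proof. by move=> N0; rewrite /grid ler_pM2r ?invr_gt0 ?ltr0n// ler_pM2l// ler_nat. Qed.

Lemma grid_itv N k : (k <= N)%N -> (0 < N)%N -> 0 <= grid N k <= T.
Proof.
move=> kN N0; apply/andP; split; first by rewrite -[leLHS](grid0 N) ler_grid.
by rewrite -[leRHS](gridN N0) ler_grid.
Qed.

Lemma grid_double N k : grid N.*2 k.*2 = grid N k.
Proof.
rewrite /grid -!muln2 !natrM; have [->|N0] := eqVneq N 0%N; first by rewrite mul0r !invr0 !mulr0.
by field; rewrite pnatr_eq0.
Qed.

Lemma gridS N k : grid N k.+1 - grid N k = T / N%:R.
Proof. by rewrite /grid -mulrBl -mulrBr -natr1 addrAC subrr add0r mulr1. Qed.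

Lemma grid_cell N t : (0 < N)%N -> 0 <= t <= T ->
  exists k, [/\ (k < N)%N, grid N k <= t & t <= grid N k.+1].
Proof.
move=> N0 /andP[t0 tT].
have ex : exists k, t <= grid N k.+1 by exists N.-1; rewrite prednK// gridN.
case: (ex_minnP ex) => k tk kmin; exists k; split=> //.
  by rewrite -(prednK N0) ltnS; apply: kmin; rewrite prednK// gridN.
case: k tk kmin => [|k] tk kmin; first by rewrite grid0.
by rewrite leNgt; apply/negP => /ltW /kmin; rewrite ltnn.
Qed.

(** The piecewise linear path with prescribed increments over the cells, written as a sum of ramps:
    it is linear in the increments, with coefficients in [[0, 1]]. *)
Definition gpath (N : nat) (x : 'I_N -> 'rV[R]_n) (t : R) : 'rV[R]_n :=
  \sum_(l < N) ramp (grid N l) (grid N l.+1) t *: x l.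

Definition increments v N (l : nat) := v (grid N l.+1) - v (grid N l).

Lemma gpath_C0path N (x : 'I_N -> 'rV[R]_n) : C0path T (gpath x).
Proof.
split.
  apply: continuous_subspaceT => t; rewrite /gpath; apply: (cvg_rowP (F := nbhs t)) => i.
  rewrite summxE; under eq_fun do rewrite summxE.
  apply: cvg_sumr => l _; rewrite mxE; under eq_fun do rewrite mxE.
  by apply: cvgM; [exact: continuous_ramp|exact: cvg_cst].
rewrite /gpath big1// => l _; have N0 : (0 < N)%N by case: l => l; case: N {x}.
by rewrite ramp_le ?scale0r// ?ltr_grid// -[leLHS](grid0 N) ler_grid.
Qed.

(** Ramps of earlier cells equal 1 and telescope to the value of [v] at the left grid point, those
    of later cells are 0, and the current one gives the convex weight. *)
Lemma gpath_increments v N t : (0 < N)%N -> v 0 = 0 -> 0 <= t <= T ->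
  exists a b r, [/\ 0 <= a <= T /\ `|a - t| <= T / N%:R, 0 <= b <= T /\ `|b - t| <= T / N%:R, 0 <= r <= 1 &
    gpath (fun l : 'I_N => increments v N l) t = v a + r *: (v b - v a)].
Proof.
move=> N0 v0 tT; have [k [kN kt tk]] := grid_cell N0 tT.
exists (grid N k), (grid N k.+1), (ramp (grid N k) (grid N k.+1) t); split.
- split; first exact: grid_itv (ltnW kN) N0.
  by rewrite distrC ger0_norm ?subr_ge0// -(gridS N k) lerB.
- split; first exact: grid_itv kN N0.
  by rewrite ger0_norm ?subr_ge0// -(gridS N k) lerB.
- exact: ramp_itv01.
rewrite /gpath -(big_mkord xpredT (fun l => ramp (grid N l) (grid N l.+1) t *: increments v N l)).
rewrite (big_cat_nat (n := k.+1))//= big_nat_recr//=.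
rewrite [X in _ + X]big_nat_cond [X in _ + X]big1 ?addr0; last first.
  move=> l; rewrite andbT => /andP[kl lN]; rewrite ramp_le ?scale0r// ?ltr_grid//.
  by apply: le_trans tk _; rewrite ler_grid.
congr (_ + _).
rewrite (eq_big_nat _ _ (F2 := fun l => v (grid N l.+1) - v (grid N l))); last first.
  move=> l /andP[_ lk]; rewrite ramp_ge ?scale1r// ?ltr_grid//.
  by apply: le_trans kt; rewrite ler_grid.
by rewrite telescope_sumr// grid0 v0 subr0.
Qed.

Lemma supdist_le (i : 'I_n) v (w : R -> 'rV[R]_n) c :
  (forall t, 0 <= t <= T -> `|v t 0 i - w t 0 i| <= c) -> supdist T i v w <= c.
Proof.
move=> vwc; apply: ge_sup.
  by exists `|v 0 0 i - w 0 0 i|, 0 => //=; rewrite in_itv/= lexx ltW.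
by move=> _ [t /= tT <-]; apply: vwc; rewrite in_itv/= in tT.
Qed.

Lemma sum_double (V : nmodType) (F : nat -> V) N :
  \sum_(l < N.*2) F l = \sum_(k < N) (F k.*2 + F k.*2.+1).
Proof.
elim: N => [|N IH]; first by rewrite !big_ord0.
by rewrite doubleS !big_ord_recr/= IH addrA.
Qed.

(** Refining changes the path only inside the coarse cell that contains [t], by two fine increments
    with coefficients in [[-1, 1]]. Summing over all cells makes the bound independent of [t], hence
    valid for the supremum. *)
Lemma gpath_refine v N t i : (0 < N)%N ->
  (gpath (fun l : 'I_N.*2 => increments v N.*2 l) t 0 i -
   gpath (fun l : 'I_N => increments v N l) t 0 i) ^+ 4 <=
  8 * \sum_(l < N.*2) (increments v N.*2 l 0 i) ^+ 4.
Proof.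
move=> N0; have N20 : (0 < N.*2)%N by rewrite double_gt0.
pose D l := increments v N.*2 l 0 i.
pose r l := ramp (grid N.*2 l) (grid N.*2 l.+1) t.
pose q l := ramp (grid N l) (grid N l.+1) t.
pose c k := D k.*2 * (r k.*2 - q k) + D k.*2.+1 * (r k.*2.+1 - q k).
have E : gpath (fun l : 'I_N.*2 => increments v N.*2 l) t 0 i -
   gpath (fun l : 'I_N => increments v N l) t 0 i = \sum_(k < N) c k.
  rewrite /gpath !summxE (sum_double (fun l => (r l *: increments v N.*2 l) 0 i)) -sumrB.
  apply: eq_bigr => k _; rewrite !mxE /c /D /increments !mxE.
  rewrite -/(q k) -/(r k.*2) -/(r k.*2.+1).
  rewrite -(grid_double N k) -(grid_double N k.+1) doubleS; ring.
have c0 k : (c k != 0) -> grid N k < t < grid N k.+1.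
  apply: contraNT; rewrite negb_and -!leNgt => /orP[tk|kt].
    have r1 : r k.*2 = 0 by apply: ramp_le; rewrite ?ltr_grid// grid_double.
    have r2 : r k.*2.+1 = 0.
      apply: ramp_le; rewrite ?ltr_grid//; apply: le_trans tk _.
      by rewrite -grid_double ler_grid.
    have q1 : q k = 0 by apply: ramp_le; rewrite ?ltr_grid.
    by rewrite /c r1 r2 q1 subrr !mulr0 addr0.
  have k2 : grid N.*2 k.*2.+2 = grid N k.+1 by rewrite -doubleS grid_double.
  have r1 : r k.*2 = 1.
    apply: ramp_ge; rewrite ?ltr_grid//; apply: le_trans kt.
    by rewrite -k2 ler_grid.
  have r2 : r k.*2.+1 = 1 by apply: ramp_ge; rewrite ?ltr_grid// k2.
  have q1 : q k = 1 by apply: ramp_ge; rewrite ?ltr_grid.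
  by rewrite /c r1 r2 q1 subrr !mulr0 addr0.
have le4 (u a b : R) : 0 <= a <= 1 -> 0 <= b <= 1 -> (u * (a - b)) ^+ 4 <= u ^+ 4.
  move=> /andP[a0 a1] /andP[b0 b1]; rewrite exprMn ler_piMr ?exprn_even_ge0//.
  have : (a - b) ^+ 2 <= 1 by nra.
  by rewrite -[4%N]/(2 * 2)%N exprM => h; rewrite -(expr1n _ 2) lerXn2r ?nnegrE ?sqr_ge0.
have cb k : (c k) ^+ 4 <= 8 * (D k.*2 ^+ 4 + D k.*2.+1 ^+ 4).
  apply: le_trans (expr4D_le _ _) _; rewrite ler_wpM2l// lerD//; apply: le4; exact: ramp_itv01.
rewrite E (sum_double (fun l => D l ^+ 4)) mulr_sumr.
have sge0 (p : pred 'I_N) : 0 <= \sum_(k < N | p k) 8 * (D k.*2 ^+ 4 + D k.*2.+1 ^+ 4).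
  by apply: sumr_ge0 => k _; rewrite mulr_ge0// addr_ge0// exprn_even_ge0.
have [/existsP[k ck]|none] := boolP [exists k : 'I_N, c k != 0]; last first.
  rewrite big1 ?expr0n// => k _; apply/eqP/negPn; apply: contra none => ck.
  by apply/existsP; exists k.
rewrite (bigD1 k)//= big1 ?addr0; last first.
  move=> j jk; apply/eqP/negPn; apply: contra jk => cj.
  have /andP[k1 k2] := c0 _ ck; have /andP[j1 j2] := c0 _ cj.
  have := lt_trans j1 k2; have := lt_trans k1 j2.
  by rewrite !ltr_grid// !ltnS => kj jk; rewrite -val_eqE eqn_leq kj jk.
by rewrite [leRHS](bigD1 k)//=; apply: le_trans (cb k) _; rewrite lerDl sge0.
Qed.

Lemma gpath_cvg v i : {within `[0, T], continuous v} -> v 0 = 0 -> forall e, 0 < e ->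
  \forall N \near \oo, forall t, 0 <= t <= T ->
    `|gpath (fun l : 'I_N => increments v N l) t 0 i - v t 0 i| <= e.
Proof.
move=> cv v0 e e0.
(* It is enough to find, around each [x], a neighbourhood and a rank that work together. There the
   values of [v] at [t] and at the two grid points are all within [e / 4] of its value at [x]. *)
have := (compact_near_coveringP _).1 (@segment_compact R 0 T).
move=> /(_ nat \oo (fun N t => (0 < N)%N -> 0 <= t <= T ->
  `|gpath (fun l : 'I_N => increments v N l) t 0 i - v t 0 i| <= e) _) H.
have {H} := H _; case=> [x /= xT|N0 _ HN0]; last first.
  exists N0.+1 => // N /= NN0 t tT; apply: (HN0 N (ltnW NN0) t) => //.
  exact: leq_ltn_trans NN0.
have e4 : 0 < e / 4 by rewrite divr_gt0.
have [dl /= dl0 Hd] : exists2 dl, 0 < dl & forall s, 0 <= s <= T -> `|s - x| < dl ->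
    `|v s 0 i - v x 0 i| <= e / 4.
  have cvx : (fun s => v s 0 i) s @[s --> within `[0, T] (nbhs x)] --> v x 0 i.
    apply: (cvg_comp v (fun y : 'rV[R]_n => y 0 i)); last exact: continuous_coord.
    by move/subspace_continuousP : cv; apply.
  move/cvgrPdist_le : cvx => /(_ _ e4) /nbhs_normP[dl /= dl0 H].
  exists dl => // s sT sx; rewrite distrC; apply: H; last by rewrite /= in_itv.
  by rewrite /= distrC.
have [N1 N1P] : exists N1 : nat, T / (dl / 2) < N1%:R by exists (Num.truncn (T / (dl / 2))).+1; exact: truncnS_gt.
exists ([set t | `|t - x| < dl / 2], [set N | (N1 <= N)%N]).
  split; last by exists N1.
  apply/nbhs_normP; exists (dl / 2) => /=; first by rewrite divr_gt0.
  by move=> t /=; rewrite distrC.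
move=> [t N] /= [tx N1N] N0 tT.
have TN : T / N%:R < dl / 2.
  rewrite ltr_pdivrMr ?ltr0n// mulrC -ltr_pdivrMr ?divr_gt0//.
  by apply: lt_le_trans N1P _; rewrite ler_nat.
have [a [b [r [[aT at_] [bT bt] /andP[r0 r1] ->]]]] := gpath_increments N0 v0 tT.
have near s : 0 <= s <= T -> `|s - t| <= T / N%:R -> `|v s 0 i - v x 0 i| <= e / 4.
  move=> sT st; apply: Hd => //; rewrite -(subrKA t).
  apply: le_lt_trans (ler_normD _ _) _; rewrite [ltRHS]splitr.
  by apply: ltrD => //; exact: le_lt_trans TN.
have := near _ aT at_; have := near _ bT bt; have := Hd t tT.
have dl2 : dl / 2 < dl by lra.
move=> /(_ (lt_trans tx dl2)).
rewrite !mxE !ler_norml => /andP[? ?] /andP[? ?] /andP[? ?]; apply/andP; split; nra.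
Qed.

End interpolation.

(** * Smooth approximation of Lipschitz functionals *)

Section geometric_cvg.
Context {d} {Omega : measurableType d} {R : realType} {P : probability Omega R}.
Variables (u : nat -> Omega -> R) (xi : Omega -> R) (C : R).
Hypotheses (su : forall J, sqint P setT (u J)) (C0 : 0 <= C).
Hypothesis uC : forall J, \int[P]_w ((u J.+1 w - u J w) ^+ 2) <= C * (3 / 4) ^+ J.
Hypothesis u_cvg : forall w, u J w @[J --> \oo] --> xi w.

(* [(x + y)^2 <= 7 x^2 + (7/6) y^2] and [7 + 56 * (7/6) * (3/4) = 56] *)
Lemma geometric_cauchy J k :
  \int[P]_w ((u J w - u (J + k)%N w) ^+ 2) <= 56 * C * (3 / 4) ^+ J.
Proof.
elim: k J => [|k IH] J.
  under eq_Rintegral do rewrite addn0 subrr expr0n.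
  by rewrite Rintegral_cst// mul0r !mulr_ge0// exprn_ge0// divr_ge0.
have s1 : sqint P setT (fun w => u J.+1 w - u J w) by exact: sqintB.
have s2 : sqint P setT (fun w => u J.+1 w - u (J.+1 + k)%N w) by exact: sqintB.
have s3 : sqint P setT (fun w => u J w - u (J + k.+1)%N w) by exact: sqintB.
apply: (@le_trans _ _ (\int[P]_w (7 * (u J.+1 w - u J w) ^+ 2 + 7 / 6 * (u J.+1 w - u (J.+1 + k)%N w) ^+ 2))).
  apply: le_Rintegral => //; first exact: sqint_sqr s3.
    by apply: intgD => //; apply: intgZ => //; [exact: sqint_sqr s1|exact: sqint_sqr s2].
  move=> w _; rewrite -addSnnS; set a := u J w; set b := u J.+1 w; set c := u _ w.
  rewrite -subr_ge0 (_ : _ - _ = 6^-1 * (6 * (b - a) + (b - c)) ^+ 2); last by field.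
  by rewrite mulr_ge0 ?sqr_ge0.
rewrite RintegralD//; [|by apply: intgZ => //; [exact: sqint_sqr s1]|by apply: intgZ => //; exact: sqint_sqr s2].
rewrite !RintegralZl//; [|exact: sqint_sqr s2|exact: sqint_sqr s1].
by have := uC J; have := IH J.+1; rewrite exprS; lra.
Qed.

(** Fatou's lemma in the second index of [geometric_cauchy], using the pointwise convergence of
    [u]. *)
Lemma geometric_limit : sqint P setT xi /\
  forall J, \int[P]_w ((u J w - xi w) ^+ 2) <= 56 * C * (3 / 4) ^+ J.
Proof.
have mxi : measurable_fun setT xi.
  by apply: (measurable_fun_cvg (h := u)) => [J|w _]; [exact: sqint_meas (su J)|exact: u_cvg].
have sB J k : sqint P setT (fun w => u J w - u k w) by exact: sqintB.
have F J : (\int[P]_w ((u J w - xi w) ^+ 2)%:E <= (56 * C * (3 / 4) ^+ J)%:E)%E.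
  have := @fatou _ _ _ P setT measurableT (fun k w => ((u J w - u (J + k)%N w) ^+ 2)%:E).
  move=> /(_ (fun k => (measurable_EFinP _ _).2 (intg_meas (sqint_sqr (sB J (J + k)%N))))) H.
  rewrite -(_ : \int[P]_w limn_einf (fun k => ((u J w - u (J + k)%N w) ^+ 2)%:E) =
    \int[P]_w ((u J w - xi w) ^+ 2)%:E)%E; last first.
    apply: eq_integral => w _.
    apply: (fun l => (@cvg_limn_einf_sup R _ _ l).1); apply: cvg_EFin; first exact: nearW.
    apply: cvg_sqr; apply: cvgB; first exact: cvg_cst.
    have c := @u_cvg w; rewrite -(cvg_shiftn J) in c.
    by under eq_fun do rewrite addnC.
  apply: le_trans (H _) _; first by move=> k w _; rewrite lee_fin sqr_ge0.
  apply: limn_einf_le => k; rewrite -EFin_Rintegral ?lee_fin//; first exact: geometric_cauchy.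
  exact: sqint_sqr.
have sX J : sqint P setT (fun w => u J w - xi w).
  have mB : measurable_fun setT (fun w => u J w - xi w).
    by apply: measurable_funB => //; exact: sqint_meas (su J).
  split=> //; apply: intg_ltP => //; first exact: measurable_funX.
    by move=> w _; exact: sqr_ge0.
  by apply: le_lt_trans (F J) _; rewrite ltry.
split=> [|J].
  have := sqintB measurableT (su 0) (sX 0%N).
  by under eq_fun do rewrite opprB addrC subrK.
by rewrite -lee_fin EFin_Rintegral//; exact: sqint_sqr.
Qed.

End geometric_cvg.

Section lipschitz_approximation.
Context {d} {Omega : measurableType d} {R : realType} {P : probability Omega R}.
Variables (m : nat) (X : 'I_m -> Omega -> R) (a : 'I_m -> R) (g : 'rV[R]_m -> R).
Hypotheses (MX : forall j, all_moments P (X j)) (a0 : forall j, 0 <= a j).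
Hypothesis g_lip : forall x y, `|g x - g y| <= \sum_j a j * `|x 0 j - y 0 j|.

Lemma continuous_lip : continuous g.
Proof.
move=> x; apply/(cvgrPdist_le (F := nbhs x)) => e e0.
pose S := 1 + \sum_j a j.
have S0 : 0 < S by rewrite ltr_pwDl// sumr_ge0.
near=> y.
apply: le_trans (g_lip _ _) _.
have xy : `|x - y| <= e / S.
  near: y; apply: cvgr_dist_le; first exact: cvg_id.
  by rewrite divr_gt0.
apply: (@le_trans _ _ ((\sum_j a j) * (e / S))).
  rewrite mulr_suml; apply: ler_sum => j _; rewrite ler_wpM2l//.
  apply: le_trans xy; have := ler_mx_norm_coord (x - y) j; by rewrite !mxE.
rewrite mulrA ler_pdivrMr// mulrC ler_wpM2l ?(ltW e0)//.
by rewrite /S lerDr.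
Unshelve. all: by end_near. Qed.

Lemma lip_moments : all_moments P (fun w => g (\row_j X j w)).
Proof.
apply: (all_moments_le (g := fun w => `|g 0| + \sum_j a j * `|X j w|)).
- apply: measurable_continuous_rV => //; first exact: continuous_lip.
  by move=> j; case: (MX j).
- apply: all_momentsD; first exact: all_moments_cst.
  apply: all_moments_sum => j; apply: all_momentsM; first exact: all_moments_cst.
  exact: all_moments_norm.
move=> w; rewrite [leRHS]ger0_norm; last first.
  by rewrite addr_ge0// sumr_ge0// => j _; rewrite mulr_ge0.
rewrite -[g _](subrK (g 0)) addrC; apply: le_trans (ler_normD _ _) _; rewrite lerD2l.
apply: le_trans (g_lip _ _) _; apply: ler_sum => j _.
by rewrite !mxE subr0.
Qed.

(** Two errors add up: the Bernstein error, uniform, and the squashing error, at most [V / c^2],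
    where [V] has all moments by the cubic bound [psi_approx]. Since the first grows with [c], the
    level [c] is fixed before the degree. *)
Lemma lipschitz_L2_approx e : 0 < e -> exists f : 'rV[R]_m -> R,
  [/\ smooth_polygrowth f, forall j x, `|partial j f x| <= a j &
  \int[P]_w ((f (\row_j X j w) - g (\row_j X j w)) ^+ 2) <= e].
Proof.
move=> e0.
pose V w := \sum_j a j * `|X j w| ^+ 3.
have MV : all_moments P V.
  apply: all_moments_sum => j; apply: all_momentsM; first exact: all_moments_cst.
  exact/all_momentsX/all_moments_norm.
have sV := sqint_sqr (all_moments_sqint MV).
pose EV := \int[P]_w (V w ^+ 2).
have EV0 : 0 <= EV by apply: Rintegral_ge0 => w _; exact: sqr_ge0.
(* Makes the squashing part [2 EV / c^4] at most [e / 2], because [c^4 >= c >= 4 EV / e]. *)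
pose c := 1 + 4 * EV / e.
have c1 : 1 <= c by rewrite lerDl divr_ge0 ?mulr_ge0// ltW.
have c0 : 0 < c by apply: lt_le_trans c1.
pose S := \sum_j 2 * c * a j.
(* Makes the Bernstein part [2 S^2 / (M + 1)^2] at most [e / 2]. *)
pose M := Num.truncn (4 * S ^+ 2 / e).
have M1 : 4 * S ^+ 2 / e < M.+1%:R by exact: truncnS_gt.
have g_upd x j y : `|g (upd x j y) - g x| <= a j * `|y - x 0 j|.
  apply: le_trans (g_lip _ _) _; rewrite (bigD1 j)//= updE eqxx big1 ?addr0// => i ij.
  by rewrite updE (negbTE ij) subrr normr0 mulr0.
have [f [fs fa fg]] := lipschitz_smooth_approx M c0 a0 g_upd.
exists f; split=> //.
have Mf : all_moments P (fun w => f (\row_j X j w)).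
  by have [cf _ fG] := smooth_smooth1 fs; exact: all_moments_poly_growth.
have sfg : sqint P setT (fun w => f (\row_j X j w) - g (\row_j X j w)).
  by apply: sqintB => //; [exact: all_moments_sqint Mf|exact: all_moments_sqint lip_moments].
pose B := S / M.+1%:R.
have bnd w : `|f (\row_j X j w) - g (\row_j X j w)| <= B + V w / c ^+ 2.
  rewrite -(subrKA (g (\row_j psi c ((\row_j X j w) 0 j)))).
  apply: le_trans (ler_normD _ _) _; apply: lerD.
    by rewrite /B /S mulr_suml; exact: fg.
  apply: le_trans (g_lip _ _) _; rewrite /V mulr_suml; apply: ler_sum => j _.
  by rewrite !mxE -mulrA ler_wpM2l// distrC; exact: psi_approx.
apply: (@le_trans _ _ (\int[P]_w (2 * B ^+ 2 + 2 / c ^+ 4 * V w ^+ 2))).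
  apply: le_Rintegral => //; first exact: sqint_sqr sfg.
    by apply: intgD => //; [exact: (all_moments_intg (all_moments_cst P _))|exact: intgZ].
  move=> w _; apply: (@le_trans _ _ ((B + V w / c ^+ 2) ^+ 2)).
    rewrite -[leLHS]real_normK ?num_real// lerXn2r ?nnegrE//.
    exact: le_trans (normr_ge0 _) (bnd w).
  rewrite -subr_ge0 (_ : _ - _ = (B - V w / c ^+ 2) ^+ 2); first exact: sqr_ge0.
  by field; rewrite gt_eqF.
rewrite RintegralD//; [|exact: (all_moments_intg (all_moments_cst P _))|exact: intgZ].
rewrite [X in _ + X]RintegralZl// -/EV.
have P1 : fine (P setT) = 1 by rewrite probability_setT.
rewrite Rintegral_cst// [X in _ * X + _]P1 mulr1.
have h1 : 2 * B ^+ 2 <= e / 2.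
  have q1 : 1 <= M.+1%:R :> R by rewrite ler1n.
  rewrite /B expr_div_n mulrA ler_pdivrMr ?exprn_gt0//.
  by move: M1; rewrite ltr_pdivrMr// => M1; nra.
have h2 : 2 / c ^+ 4 * EV <= e / 2.
  rewrite mulrAC ler_pdivrMr ?exprn_gt0//.
  have c4 : c <= c ^+ 4 by rewrite ler_eXnr.
  have ec : e * c = e + 4 * EV by rewrite /c; field; rewrite gt_eqF.
  by have := ler_wpM2l (ltW e0) c4; lra.
by lra.
Qed.

End lipschitz_approximation.

Lemma sqr_sum_le {R : realType} (k : nat) (u : 'I_k -> R) :
  (\sum_i u i) ^+ 2 <= k%:R * \sum_i u i ^+ 2.
Proof.
elim: k u => [|k IH] u; first by rewrite !big_ord0 expr0n mulr0.
rewrite !big_ord_recl/=; have := IH (fun i => u (lift ord0 i)).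
set S := \sum_(i < k) _; set Q := \sum_(i < k) _; set v := u ord0 => SQ.
have Q0 : 0 <= Q by apply: sumr_ge0 => i _; exact: sqr_ge0.
case: k IH u S Q v SQ Q0 => [|k] _ u S Q v SQ Q0.
  have -> : S = 0.
    by apply/eqP; rewrite -sqrf_eq0 eq_le sqr_ge0 andbT; move: SQ; rewrite mul0r.
  by rewrite addr0 mul1r lerDl.
have k0 : 0 < k.+1%:R :> R by rewrite ltr0n.
suff : 2 * (S * v) <= Q + k.+1%:R * v ^+ 2.
  by rewrite -natr1; set K : R := k.+1%:R in SQ *; nra.
rewrite -(ler_pM2l k0) mulrDr; apply: le_trans (lerD SQ (lexx _)).
have := sqr_ge0 (S - k.+1%:R * v); set K : R := k.+1%:R; nra.
Qed.

Section step_wiener.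
Context {d} {Omega : measurableType d} {R : realType} {P : probability Omega R}.
Context {T : R} {n : nat} {W : R -> Omega -> 'rV[R]_n}.
Hypotheses (T_gt0 : 0 < T) (W_bm : brownian_motion P T W).

Lemma L2_fun_step s : L2_fun T (@step_fun R n s).
Proof.
split=> [i|]; first exact: sqint_meas (step_fun_sqint T_gt0 s i).
have mI : measurable (`[0, T]%classic : set (measurableTypeR R)) by exact: measurable_itv.
have : intg (@lebesgue_measure R) `[0, T]%classic (fun t => sqnorm (step_fun s t)).
  by apply: intg_sum => // i _; exact: sqint_sqr (step_fun_sqint T_gt0 s i).
exact: integrable_lty.
Qed.

Lemma wiener_integral_step s : step_in T s ->
  wiener_integral P T W (step_fun s) (step_integral W s).
Proof.
move=> sT; split; first exact: sqint_meas (step_integral_sqint W_bm sT).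
exists (fun=> s); split=> //.
- rewrite [X in X @ _](_ : _ = fun=> 0%E); first exact: cvg_cst.
  apply/funext => k; apply: integral0_eq => t _; rewrite subrr /sqnorm big1// => i _.
  by rewrite mxE expr0n.
- rewrite [X in X @ _](_ : _ = fun=> 0%E); first exact: cvg_cst.
  by apply/funext => k; apply: integral0_eq => w _; rewrite subrr expr0n.
Qed.

End step_wiener.

(** * Dyadic interpolations of the Brownian functional *)

Section brownian_functional.
Context {d} {Omega : measurableType d} {R : realType} {P : probability Omega R}.
Context {T : R} {n : nat} {W : R -> Omega -> 'rV[R]_n}.
Variables (A : 'I_n -> R) (phi : (R -> 'rV[R]_n) -> R).
Hypotheses (T_gt0 : 0 < T) (W_bm : brownian_motion P T W).
Hypothesis A_ge0 : forall i, 0 <= A i.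
Hypothesis phi_lip : forall v w : R -> 'rV[R]_n, C0path T v -> C0path T w ->
  `|phi v - phi w| <= \sum_(i < n) A i * supdist T i v w.

Section fixed_grid.
Variable N : nat.
Hypothesis N0 : (0 < N)%N.
Local Notation J := 'I_#|{: 'I_N * 'I_n}|.

Definition vec_path (x : 'rV[R]_#|{: 'I_N * 'I_n}|) (l : 'I_N) : 'rV[R]_n :=
  \row_i x 0 (enum_rank (l, i)).

Definition grid_fun x := phi (gpath T (vec_path x)).

(** A unit vector on a single cell, so that its Wiener integral is one coordinate of one
    increment. *)
Definition grid_step (j : J) : seq (R * R * 'rV[R]_n) :=
  [:: (grid T N (enum_val j).1, grid T N (enum_val j).1.+1, delta_mx 0 (enum_val j).2)].

Definition grid_increment (j : J) w := step_integral W (grid_step j) w.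

Lemma grid_incrementE j w : grid_increment j w =
  increments T (W ^~ w) N (enum_val j).1 0 (enum_val j).2.
Proof.
rewrite /grid_increment /step_integral big_seq1 /= (bigD1 (enum_val j).2)//= !mxE !eqxx/= mul1r.
rewrite big1 ?addr0// => i ij.
by rewrite mxE (negbTE ij) andbF mul0r.
Qed.

Lemma grid_step_in j : step_in T (grid_step j).
Proof.
move=> x; rewrite inE => /eqP -> /=; set l := (enum_val j).1.
have /andP[-> _] := grid_itv T_gt0 (ltnW (ltn_ord l)) N0.
by have /andP[_ ->] := grid_itv T_gt0 (ltn_ord l) N0; rewrite ler_grid// leqnSn.
Qed.

Lemma grid_increment_moments j : all_moments P (grid_increment j).
Proof.
have H := wiener_integral_step W_bm (@grid_step_in j).
exact: (wiener_integral_moments T_gt0 W_bm (L2_fun_step T_gt0 (grid_step j)) H).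
Qed.

(** Ramps lie in [[0, 1]], so the sup distance in coordinate [i] is at most the sum of the changes
    of its increments; each increment receives the constant [A i], independently of the grid. *)
Lemma grid_fun_lip x y :
  `|grid_fun x - grid_fun y| <= \sum_j A (enum_val j).2 * `|x 0 j - y 0 j|.
Proof.
apply: le_trans (phi_lip (gpath_C0path T_gt0 _) (gpath_C0path T_gt0 _)) _.
apply: (@le_trans _ _ (\sum_i A i * \sum_(l < N) `|x 0 (enum_rank (l, i)) - y 0 (enum_rank (l, i))|)).
  apply: ler_sum => i _; rewrite ler_wpM2l//; apply: supdist_le => // t _.
  rewrite /gpath !summxE -sumrB; apply: le_trans (ler_norm_sum _ _ _) _.
  apply: ler_sum => l _; rewrite !mxE -mulrBr normrM ler_piMl//.
  by have /andP[r0 r1] := ramp_itv01 (grid T N l) (grid T N l.+1) t; rewrite ger0_norm.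
under eq_bigr do rewrite mulr_sumr.
rewrite exchange_big pair_big/=.
rewrite le_eqVlt; apply/orP; left; apply/eqP.
rewrite [LHS](reindex (fun j : J => enum_val j : 'I_N * 'I_n))/=; last first.
  exists enum_rank => p _; [exact: enum_valK|exact: enum_rankK].
by apply: eq_bigr => j _; rewrite -surjective_pairing enum_valK.
Qed.

Lemma grid_funE w : grid_fun (\row_j grid_increment j w) =
  phi (gpath T (fun l : 'I_N => increments T (W ^~ w) N l)).
Proof.
congr phi; apply/funext => t; apply: eq_bigr => l _; congr (_ *: _).
by apply/rowP => i; rewrite mxE mxE grid_incrementE enum_rankK.
Qed.

Lemma grid_fun_moments : all_moments P (fun w =>
  phi (gpath T (fun l : 'I_N => increments T (W ^~ w) N l))).
Proof.
under eq_fun do rewrite -grid_funE.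
by apply: (lip_moments _ _ grid_fun_lip) => // j; exact: grid_increment_moments.
Qed.

Lemma grid_fun_approx e : 0 < e -> exists F DF, [/\ smooth_rv P T W F DF,
  forall i t w, `|DF t w 0 i| <= A i &
  \int[P]_w ((F w - phi (gpath T (fun l : 'I_N => increments T (W ^~ w) N l))) ^+ 2) <= e].
Proof.
move=> e0.
have [f [fs fa fe]] := lipschitz_L2_approx grid_increment_moments
  (fun j => A_ge0 (enum_val j).2) grid_fun_lip e0.
exists (fun w => f (\row_j grid_increment j w)),
  (fun t w => \sum_j partial j f (\row_k grid_increment k w) *: step_fun (grid_step j) t); split.
- exists #|{: 'I_N * 'I_n}|, f, (fun j => step_fun (grid_step j)), grid_increment; split=> //.
    by move=> j; exact: L2_fun_step.
  by move=> j; have H := wiener_integral_step W_bm (@grid_step_in j); exact: H.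
- move=> i t w; rewrite summxE; under eq_bigr do rewrite mxE.
  have hE j : step_fun (grid_step j) t 0 i =
      if (grid T N (enum_val j).1 < t <= grid T N (enum_val j).1.+1) && (i == (enum_val j).2) then 1 else 0.
    rewrite /step_fun big_seq1/= in_itv/=; case: ifP => _ /=; last by rewrite mxE.
    by rewrite mxE eqxx/=; case: ifP.
  (* Cells are disjoint and each step function has one nonzero coordinate, so at most one term of
     the derivative survives at [(t, i)]: the bound is [A i], not a multiple growing with [N]. *)
  have [/existsP[j hj]|none] := boolP [exists j, step_fun (grid_step j) t 0 i != 0]; last first.
    rewrite big1 ?normr0// => j _; move/existsPn : none => /(_ j) /negPn/eqP ->.
    by rewrite mulr0.
  rewrite (bigD1 j)//= big1 ?addr0; last first.
    move=> k kj; rewrite hE; case: ifPn => [/andP[/andP[k1 k2] /eqP ki]|_]; last by rewrite mulr0.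
    move: hj; rewrite hE; case: ifPn => [/andP[/andP[j1 j2] /eqP ji] _|_]; last by rewrite eqxx.
    have := lt_le_trans k1 j2; have := lt_le_trans j1 k2; rewrite !ltr_grid// !ltnS => jk kj'.
    case/eqP: kj; apply: enum_val_inj; rewrite [LHS]surjective_pairing [RHS]surjective_pairing -ki -ji.
    by congr (_, _); apply: val_inj; apply/eqP; rewrite eqn_leq jk kj'.
  move: hj; rewrite hE; case: ifPn => [/andP[_ /eqP ->] _|_]; last by rewrite eqxx.
  by rewrite mulr1.
- by under eq_Rintegral do rewrite -grid_funE.
Qed.

Lemma increments_fourth (l : 'I_N) i :
  \int[P]_w (increments T (W ^~ w) N l 0 i ^+ 4) <= 128 * (T / N%:R) ^+ 2.
Proof.
rewrite -lee_fin EFin_Rintegral//; last first.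
  have := all_moments_intg (all_momentsX 4 (grid_increment_moments (enum_rank (l, i)))).
  by under eq_fun do rewrite grid_incrementE enum_rankK.
have /andP[g0 _] := grid_itv T_gt0 (ltnW (ltn_ord l)) N0.
have /andP[_ gT] := grid_itv T_gt0 (ltn_ord l) N0.
have := increment_fourth_moment W_bm i g0 _ gT.
rewrite gridS ler_grid// leqnSn => /(_ isT); apply: le_trans.
by rewrite le_eqVlt; apply/orP; left; apply/eqP; apply: eq_integral => w _; rewrite !mxE.
Qed.

End fixed_grid.

Definition interpolated N w := phi (gpath T (fun l : 'I_N => increments T (W ^~ w) N l)).

(** Every path is continuous by [bm_path], so its interpolations converge uniformly on [[0, T]], and
    [phi] is Lipschitz for the sup distances. *)
Lemma interpolated_cvg w : interpolated (2 ^ J)%N w @[J --> \oo] --> phi (W ^~ w).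
Proof.
have [cW W0] := bm_path W_bm w.
have c2 : (2 ^ J)%N @[J --> \oo] --> \oo by apply: cvg_ge_id => k; apply: ltnW; exact: ltn_expl.
apply: (cvg_comp (fun J => (2 ^ J)%N) (interpolated ^~ w) c2).
apply/cvgrPdist_le => e e0.
pose S := 1 + \sum_i A i.
have S0 : 0 < S by rewrite ltr_pwDl// sumr_ge0.
have eS : 0 < e / S by rewrite divr_gt0.
have near_all : \forall N \near \oo, forall i : 'I_n, forall t, 0 <= t <= T ->
    `|gpath T (fun l : 'I_N => increments T (W ^~ w) N l) t 0 i - W t w 0 i| <= e / S.
  by apply: filter_forall => i; exact: (gpath_cvg T_gt0 (v := W ^~ w)).
apply: filterS near_all => N HN; rewrite distrC.
apply: le_trans (phi_lip (gpath_C0path T_gt0 _) (bm_path W_bm w)) _.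
apply: (@le_trans _ _ ((\sum_i A i) * (e / S))).
  rewrite mulr_suml; apply: ler_sum => i _; rewrite ler_wpM2l//.
  by apply: supdist_le => // t tT; exact: HN.
by rewrite mulrA ler_pdivrMr// mulrC ler_wpM2l ?(ltW e0)// /S lerDr.
Qed.

(** [gpath_refine] controls a fourth power where a square is wanted. The inequality
    [x^2 <= (r + x^4 / r) / 2] with a free [r] bridges the gap without taking the root of an
    expectation. *)
Lemma interpolated_refine : exists2 K, 0 <= K & forall N r, (0 < N)%N -> 0 < r ->
  \int[P]_w ((interpolated N.*2 w - interpolated N w) ^+ 2) <=
  n%:R * \sum_i A i ^+ 2 * (2^-1 * (r + K / (N%:R * r))).
Proof.
(* The 8 is that of [gpath_refine]; [2 N] increments of fourth moment at most [128 (T / (2 N))^2]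
   add up to [64 T^2 / N]. *)
exists (8 * (64 * T ^+ 2)); first by have := sqr_ge0 T; lra.
move=> N r N0 r0; have N20 : (0 < N.*2)%N by rewrite double_gt0.
have NR : 0 < N%:R :> R by rewrite ltr0n.
pose D i w := \sum_(l < N.*2) increments T (W ^~ w) N.*2 l 0 i ^+ 4.
pose q i w := 2^-1 * (r + 8 * D i w / r).
have Ml (l : 'I_N.*2) i : all_moments P (fun w => increments T (W ^~ w) N.*2 l 0 i ^+ 4).
  have := all_momentsX 4 (grid_increment_moments N20 (enum_rank (l, i))).
  by under eq_fun do rewrite grid_incrementE enum_rankK.
have D0 i w : 0 <= D i w by apply: sumr_ge0 => l _; exact: exprn_even_ge0.
have q0 i w : 0 <= q i w.
  by rewrite mulr_ge0// addr_ge0 ?(ltW r0)// divr_ge0 ?(ltW r0)// mulr_ge0.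
have MD i : all_moments P (D i) by apply: all_moments_sum => l; exact: Ml.
have Mq i : all_moments P (q i).
  apply: all_momentsM; first exact: all_moments_cst.
  apply: all_momentsD; first exact: all_moments_cst.
  apply: all_momentsM; last exact: all_moments_cst.
  by apply: all_momentsM => //; exact: all_moments_cst.
have bound w : (interpolated N.*2 w - interpolated N w) ^+ 2 <= n%:R * \sum_i A i ^+ 2 * q i w.
  have h : `|interpolated N.*2 w - interpolated N w| <= \sum_i A i * Num.sqrt (q i w).
    apply: le_trans (phi_lip (gpath_C0path T_gt0 _) (gpath_C0path T_gt0 _)) _.
    apply: ler_sum => i _; rewrite ler_wpM2l//; apply: supdist_le => // t _.
    rewrite -sqrtr_sqr ler_wsqrtr//.
    have := gpath_refine T_gt0 (W ^~ w) t i N0; rewrite -/(D i w).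
    set x := _ - _ => x4; rewrite /q -(ler_pM2l r0).
    rewrite (_ : r * (2^-1 * _) = 2^-1 * (r ^+ 2 + 8 * D i w)); last by field; rewrite gt_eqF.
    (* [x^2 <= (r + x^4 / r) / 2] *)
    have := sqr_ge0 (r - x ^+ 2); have : (x ^+ 2) ^+ 2 = x ^+ 4 by rewrite -exprM.
    by nra.
  rewrite -[leLHS]real_normK ?num_real//.
  apply: (@le_trans _ _ ((\sum_i A i * Num.sqrt (q i w)) ^+ 2)).
    by rewrite lerXn2r ?nnegrE//; exact: le_trans h.
  apply: le_trans (sqr_sum_le _) _; rewrite ler_wpM2l//; apply: ler_sum => i _.
  by rewrite exprMn sqr_sqrtr.
have iq i : intg P setT (q i) by exact: all_moments_intg.
have iS : intg P setT (fun w => \sum_i A i ^+ 2 * q i w).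
  by apply: intg_sum => // i _; exact: intgZ.
apply: (@le_trans _ _ (\int[P]_w (n%:R * \sum_i A i ^+ 2 * q i w))).
  apply: le_Rintegral => //; last exact: intgZ.
  have sI K : (0 < K)%N -> sqint P setT (interpolated K).
    by move=> K0; exact: all_moments_sqint (grid_fun_moments K0).
  by have := sqintB measurableT (sI _ N20) (sI _ N0); exact: sqint_sqr.
rewrite RintegralZl// Rintegral_sum//; last by move=> i _; exact: intgZ.
apply: ler_wpM2l => //; apply: ler_sum => i _; rewrite (RintegralZl _ measurableT (iq i)).
apply: ler_wpM2l; first exact: sqr_ge0.
have iD : intg P setT (D i) by exact: all_moments_intg.
have ED : \int[P]_w D i w <= 64 * T ^+ 2 / N%:R.
  rewrite Rintegral_sum//; last by move=> l _; exact: all_moments_intg (Ml l i).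
  apply: (@le_trans _ _ (\sum_(l < N.*2) 128 * (T / N.*2%:R) ^+ 2)).
    by apply: ler_sum => l _; exact: increments_fourth.
  rewrite sumr_const card_ord -mulr_natl -muln2 natrM le_eqVlt; apply/orP; left; apply/eqP.
  by field; rewrite gt_eqF.
have P1 : fine (P setT) = 1 by rewrite probability_setT.
rewrite (_ : \int[P]_w q i w = 2^-1 * (r + 8 / r * \int[P]_w D i w)); last first.
  rewrite /q RintegralZl//; last first.
    apply: intgD => //; first exact: (all_moments_intg (all_moments_cst P r)).
    by under eq_fun do rewrite mulrAC; exact: intgZ.
  congr (_ * _); under eq_Rintegral do rewrite mulrAC.
  rewrite RintegralD//; [|exact: (all_moments_intg (all_moments_cst P r))|exact: intgZ].
  by rewrite RintegralZl// Rintegral_cst// [X in r * X]P1 mulr1.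
apply: ler_wpM2l => //; rewrite lerD2l; apply: (@le_trans _ _ (8 / r * (64 * T ^+ 2 / N%:R))).
  by apply: ler_wpM2l => //; rewrite divr_ge0// ltW.
rewrite le_eqVlt; apply/orP; left; apply/eqP; field.
by rewrite !gt_eqF.
Qed.

Lemma functional_geometric : exists C, [/\ 0 <= C, sqint P setT (fun w => phi (W ^~ w)) &
  forall J, \int[P]_w ((interpolated (2 ^ J)%N w - phi (W ^~ w)) ^+ 2) <= C * (3 / 4) ^+ J].
Proof.
have [K K0 refine] := interpolated_refine.
pose C := n%:R * \sum_i A i ^+ 2 * (2^-1 * (1 + K)).
have C0 : 0 <= C.
  rewrite mulr_ge0// sumr_ge0// => i _; rewrite mulr_ge0 ?sqr_ge0// mulr_ge0//.
  by rewrite addr_ge0.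
have N0 J : (0 < 2 ^ J)%N by rewrite expn_gt0.
have step J : \int[P]_w ((interpolated (2 ^ J.+1)%N w - interpolated (2 ^ J)%N w) ^+ 2) <=
    C * (3 / 4) ^+ J.
  (* With [N = 2 ^ J], [N r^2 = (9 / 8) ^ J] is at least 1, so both terms of the refinement bound
     are of order [r]. *)
  pose r : R := (3 / 4) ^+ J.
  have r0 : 0 < r by rewrite exprn_gt0// divr_gt0.
  rewrite expnS mul2n; apply: le_trans (refine _ _ (N0 J) r0) _.
  have Nr : ((2 ^ J)%:R * r)^-1 <= r.
    rewrite -div1r ler_pdivrMr ?mulr_gt0 ?ltr0n//.
    rewrite (_ : r * _ = (9 / 8) ^+ J); first by rewrite exprn_ege1//; lra.
    by rewrite natrX /r mulrCA -!exprMn; congr (_ ^+ _); field.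
  rewrite /C -/r -mulrA; apply: ler_wpM2l => //; rewrite mulr_suml; apply: ler_sum => i _.
  rewrite -mulrA; apply: ler_wpM2l; first exact: sqr_ge0.
  rewrite -mulrA; apply: ler_wpM2l => //; rewrite mulrDl mul1r lerD2l.
  exact: ler_wpM2l.
have [sxi lim] := geometric_limit (u := fun J => interpolated (2 ^ J)%N) (xi := fun w => phi (W ^~ w))
  (fun J => all_moments_sqint (grid_fun_moments (N0 J))) C0 step interpolated_cvg.
exists (56 * C); split=> //; exact: mulr_ge0.
Qed.

Lemma functional_bounded_approx e : 0 < e ->
  exists DF, bounded_approx P T W (fun w => phi (W ^~ w)) A e DF.
Proof.
move=> e0; have [C [C0 sxi HC]] := functional_geometric.
(* Grid error and smoothing error are each kept below [e / 4], as squaring their sum doubles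
   both. *)
have [J HJ] : exists J, C * (3 / 4) ^+ J <= e / 4.
  have : C * (3 / 4) ^+ J @[J --> \oo] --> C * 0.
    by apply: cvgM; [exact: cvg_cst|apply: cvg_expr; rewrite ger0_norm; lra].
  rewrite mulr0 => /cvgrPdist_le /(_ (e / 4)) [|N _ HN]; first by rewrite divr_gt0.
  exists N; have := HN N (leqnn N); rewrite sub0r normrN; exact: le_trans (ler_norm _).
have N0 : (0 < 2 ^ J)%N by rewrite expn_gt0.
have e4 : 0 < e / 4 by rewrite divr_gt0.
have [F [DF [sF bF Fe]]] := grid_fun_approx N0 e4.
exists DF; split; first by move=> i t w _; exact: bF.
exists F => //.
have sI := all_moments_sqint (grid_fun_moments N0).
have s1 : sqint P setT (fun w => F w - interpolated (2 ^ J)%N w).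
  by apply: sqintB => //; exact: all_moments_sqint (smooth_rv_moments T_gt0 W_bm sF).
have s2 : sqint P setT (fun w => interpolated (2 ^ J)%N w - phi (W ^~ w)) by exact: sqintB.
have := Rintegral_sqrD_le measurableT s1 s2.
under eq_Rintegral do rewrite subrKA.
move=> /le_trans; apply; have := HC J.
rewrite -/(interpolated _) in Fe *; move: Fe HJ; rewrite /interpolated; lra.
Qed.

End brownian_functional.

Theorem proposition3p2 (R : realType) (d : measure_display)
    (Omega : measurableType d) (P : probability Omega R) (T : R) (n : nat)
    (W : R -> Omega -> 'rV[R]_n) (A : 'I_n -> R)
    (phi : (R -> 'rV[R]_n) -> R) (xi : Omega -> R)
    (T_gt0 : 0 < T)
    (W_bm : brownian_motion P T W)
    (A_ge0 : forall i, 0 <= A i)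
    (phi_lip : forall v w : R -> 'rV[R]_n, C0path T v -> C0path T w ->
       `|phi v - phi w| <= \sum_(i < n) A i * supdist T i v w)
    (xiE : forall w : Omega, xi w = phi (fun t => W t w)) :
  D12 P T W xi /\
  forall D : R -> Omega -> 'rV[R]_n, malliavin_derivative P T W xi D ->
    forall i : 'I_n,
      {ae ((lebesgue_measure : measure (measurableTypeR R) R) \x P)%E,
        forall p, p.1 \in `[0, T] -> `|D p.1 p.2 0 i| <= A i}.
Proof.
have xi_eq : xi = fun w => phi (W ^~ w) by apply/funext.
have [C [_ sxi _]] := functional_geometric T_gt0 W_bm A_ge0 phi_lip.
have approx := functional_bounded_approx T_gt0 W_bm A_ge0 phi_lip.
have [D0 [MD0 D0A]] := malliavin_derivative_of_approx T_gt0 W_bm sxi approx.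
rewrite xi_eq; split; first by exists D0.
move=> D MD i.
(* [D0] satisfies the bound everywhere on [[0, T]], so the bound for [D] can fail only where [D] and
   [D0] differ, a negligible set. *)
apply: negligibleS (malliavin_derivative_unique T_gt0 W_bm MD MD0 i) => p /=.
by apply: contra_not => DE pT; rewrite DE// D0A.
Qed.
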